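(* For every $\gamma\in(0,\min\{\alpha,1\}]$, the following properties hold. 1. The phase transition locus $\mathcal{PT}(\gamma)$ is linear homeomorphic to the graph of a real-valued convex function. More precisely, there is a co-dimension $1$ vector subspace $\mathcal{K}$ of $C^\gamma(\mathbb{R})$, a convex function $\tau\colon\mathcal{K}\to(0,+\infty)$, and a linear homeomorphism from $C^\gamma(\mathbb{R})$ onto $\mathcal{K}\times\mathbb{R}$ that is the identity on $\mathcal{K}$ (i.e., maps each $\psi\in\mathcal{K}$ to $(\psi,0)$) and that maps $\mathcal{PT}(\gamma)$ onto the graph of $\tau$. 2. Every affine space contained in $\mathcal{PT}(\gamma)\cup\mathcal{S}(\gamma)$ is a translate of a vector subspace of $\mathcal{C}(\gamma)$ and it is of infinite co-dimension in $C^\gamma(\mathbb{R})$.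
   Context: Fix $\alpha\in(0,+\infty)$ and let $f\colon[0,1]\to[0,1]$ be the intermittent map given by $f(x)=x(1+x^{\alpha})$ if $x(1+x^{\alpha})\le 1$, and $f(x)=x(1+x^{\alpha})-1$ otherwise. Let $\mathscr{M}$ be the set of Borel probability measures on $[0,1]$ invariant by $f$; for $\nu\in\mathscr{M}$ let $h_\nu$ be its measure-theoretic entropy. For $\gamma\in(0,1]$, $C^{\gamma}(\mathbb{R})$ is the Banach space of real-valued $\gamma$-Hölder continuous functions on $[0,1]$ with norm $\|\varphi\|_\gamma=\|\varphi\|+|\varphi|_\gamma$, where $\|\varphi\|=\sup_{[0,1]}|\varphi|$ and $|\varphi|_\gamma=\sup_{x\ne y}|\varphi(x)-\varphi(y)|/|x-y|^\gamma$. For a continuous $\varphi\colon[0,1]\to\mathbb{R}$ (a potential), the pressure is $P(\varphi)=\sup\{h_\nu+\int\varphi\,d\nu:\nu\in\mathscr{M}\}$, and a Gibbs state of $f$ for $\varphi$ is a measure in $\mathscr{M}$ attaining this supremum. $\delta_0$ is the Dirac mass at $0$. A measure $\nu\in\mathscr{M}$ is exponentially mixing if there are $C\in(0,+\infty)$ and $\rho\in(0,1)$ such that for every bounded measurable $\psi\colon[0,1]\to\mathbb{R}$, every Lipschitz $\tilde\psi\colon[0,1]\to\mathbb{R}$ and every $n\in\mathbb{N}$, $|\int\psi\circ f^n\cdot\tilde\psi\,d\nu-\int\psi\,d\nu\int\tilde\psi\,d\nu|\le C\|\psi\|\,|\tilde\psi|_1\,\rho^n$. The intermittent phase $\mathcal{I}(\gamma)$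 is the set of $\varphi\in C^\gamma(\mathbb{R})$ for which there is an exponentially mixing Gibbs state of strictly positive entropy. The stationary phase $\mathcal{S}(\gamma)$ is the interior in $C^\gamma(\mathbb{R})$ of the set of $\varphi$ for which $\delta_0$ is the unique Gibbs state. For $\gamma\in(0,\min\{\alpha,1\}]$, the phase transition locus $\mathcal{PT}(\gamma)$ is the common boundary $\partial\mathcal{I}(\gamma)=\partial\mathcal{S}(\gamma)$ in $C^\gamma(\mathbb{R})$ (these two boundaries coincide). $\mathcal{C}(\gamma)=\{\varphi\in C^\gamma(\mathbb{R}):\text{for every }\nu\in\mathscr{M},\ \int\varphi\,d\nu=\varphi(0)\}$, a closed vector subspace of $C^\gamma(\mathbb{R})$. *)

(* Defs.v *)
From HB Require Import structures.
From mathcomp Require Import all_boot all_order all_algebra.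
From mathcomp Require Import all_classical all_reals all_analysis.
From mathcomp Require Import lra.

Set Implicit Arguments.
Unset Strict Implicit.
Unset Printing Implicit Defensive.

Import Order.TTheory GRing.Theory Num.Theory.
Import numFieldNormedType.Exports.

Local Open Scope classical_set_scope.
Local Open Scope ring_scope.

Definition boundary {T : topologicalType} (A : set T) : set T :=
  closure A `\` A°.

(* Codimension of a vector subspace W of V, i.e. the dimension of V / W: the
   supremum of the sizes of families that are linearly independent modulo W. *)
Definition free_modulo {F : fieldType} {V : lmodType F} (W : set V) (n : nat)
    (v : 'I_n -> V) : Prop :=
  forall c : 'I_n -> F, W (\sum_(i < n) c i *: v i) -> forall i, c i = 0.

Definition codim_ge {F : fieldType} {V : lmodType F} (W : set V) (n : nat) :
    Prop :=
  exists v : 'I_n -> V, free_modulo W v.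

Definition has_codim {F : fieldType} {V : lmodType F} (W : set V) (n : nat) :
    Prop :=
  codim_ge W n /\ ~ codim_ge W n.+1.

Definition infinite_codim {F : fieldType} {V : lmodType F} (W : set V) : Prop :=
  forall n, codim_ge W n.

Definition translate {V : zmodType} (v : V) (W : set V) : set V :=
  [set v + w | w in W].

(* The codimension of an affine space is that of its direction W. *)
Definition affine_space {F : fieldType} {V : lmodType F} (A : set V) : Prop :=
  exists (v : V) (W : set V), submod_closed (mem W) /\ A = translate v W.

(* The unit interval, with the metric induced by that of R and its Borel
   sigma-algebra. *)
Definition unitI (R : realType) : Type := `[0, 1]%classic : set R.

HB.instance Definition _ (R : realType) :=
  PseudoMetric.copy (unitI R) (`[0, 1]%classic : set R).

Lemma unitI_subproof0 (R : realType) : (0 : R) \in `[0, 1]%classic.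
Proof. by rewrite inE/= in_itv/= lexx ler01. Qed.

Definition unitI0 (R : realType) : unitI R := exist _ 0 (unitI_subproof0 R).
HB.instance Definition _ (R : realType) := isPointed.Build (unitI R) (unitI0 R).

HB.instance Definition _ (R : realType) :=
  Measurable.copy (unitI R) (g_sigma_algebraType (@open (unitI R))).

Definition unitI_val {R : realType} (x : unitI R) : R := \val x.
Coercion unitI_val : unitI >-> Real.sort.

Section sup_norms.
Context {R : realType}.
Implicit Types (g M : R) (phi psi : unitI R -> R).

Definition sup_norm phi : R := sup [set `|phi x| | x in [set: unitI R]].

Definition holder_ratios g phi : set R :=
  [set r | exists x y : unitI R, x != y /\
    r = `|phi x - phi y| / `|(x : R) - (y : R)| `^ g].

Definition holder_seminorm g phi : R := sup (holder_ratios g phi).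

Definition holder_continuous g phi : Prop :=
  exists M, forall x y : unitI R, `|phi x - phi y| <= M * `|(x : R) - (y : R)| `^ g.

Lemma unitI_ge0 (x : unitI R) : 0 <= (x : R).
Proof. by have := valP x; rewrite inE/= in_itv/= => /andP[]. Qed.

Lemma unitI_le1 (x : unitI R) : (x : R) <= 1.
Proof. by have := valP x; rewrite inE/= in_itv/= => /andP[]. Qed.

Lemma unitI_dist_gt0 (x y : unitI R) : x != y -> 0 < `|(x : R) - (y : R)|.
Proof.
move=> xy; rewrite normr_gt0 subr_eq0; apply: contra xy => /eqP xy.
by apply/eqP/val_inj.
Qed.

Lemma unitI_dist_le1 (x y : unitI R) : `|(x : R) - (y : R)| <= 1.
Proof.
have := unitI_ge0 x; have := unitI_le1 x.
have := unitI_ge0 y; have := unitI_le1 y.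
by move=> *; rewrite ler_norml; apply/andP; split; lra.
Qed.

Lemma powR_le1 (a g : R) : 0 <= g -> 0 <= a <= 1 -> a `^ g <= 1.
Proof.
move=> g0 /andP[a0 a1]; have <- : (1 : R) `^ g = 1 by rewrite powR1.
by apply: ge0_ler_powR; rewrite // nnegrE.
Qed.

Lemma unitI_subproof1 : (1 : R) \in `[0, 1]%classic.
Proof. by rewrite inE/= in_itv/= lexx ler01. Qed.

Definition unitI1 : unitI R := exist _ 1 unitI_subproof1.

Lemma unitI0_neq1 : unitI0 R != unitI1.
Proof.
apply/eqP => /(congr1 unitI_val); rewrite /unitI_val /= => /eqP.
by rewrite eq_sym oner_eq0.
Qed.

Lemma holder_ratios_neq0 g phi : holder_ratios g phi !=set0.
Proof. by eexists; exists (unitI0 R), unitI1; split=> //; exact: unitI0_neq1. Qed.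

Lemma sup_norm_le phi M : (forall x, `|phi x| <= M) -> sup_norm phi <= M.
Proof.
move=> hM; apply: ge_sup; first by exists `|phi (unitI0 R)|, (unitI0 R).
by move=> _ [x _ <-].
Qed.

Lemma holder_seminorm_le g phi M :
  (forall x y : unitI R, `|phi x - phi y| <= M * `|(x : R) - (y : R)| `^ g) ->
  holder_seminorm g phi <= M.
Proof.
move=> hM; apply: ge_sup; first exact: holder_ratios_neq0.
move=> _ [x [y [xy ->]]]; rewrite ler_pdivrMr ?hM//.
by rewrite powR_gt0 ?unitI_dist_gt0.
Qed.

Lemma le_sup_norm phi x :
  (exists M, forall x, `|phi x| <= M) -> `|phi x| <= sup_norm phi.
Proof.
move=> [M hM]; apply: ub_le_sup; last by exists x.
by exists M => _ [y _ <-].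
Qed.

Lemma le_holder_seminorm g phi x y : holder_continuous g phi ->
  `|phi x - phi y| <= holder_seminorm g phi * `|(x : R) - (y : R)| `^ g.
Proof.
move=> [M hM]; have [->|xy] := eqVneq x y.
  rewrite !subrr normr0 mulr_ge0 ?powR_ge0//.
  have [r [a [b [ab rE]]]] := holder_ratios_neq0 g phi.
  apply: (@le_trans _ _ r); first by rewrite rE mulr_ge0 ?invr_ge0 ?powR_ge0.
  apply: ub_le_sup; last by exists a, b.
  exists M => _ [c [d [cd ->]]]; rewrite ler_pdivrMr ?hM//.
  by rewrite powR_gt0 ?unitI_dist_gt0.
rewrite -ler_pdivrMr ?powR_gt0 ?unitI_dist_gt0//.
apply: ub_le_sup; last by exists x, y.
exists M => _ [c [d [cd ->]]]; rewrite ler_pdivrMr ?hM//.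
by rewrite powR_gt0 ?unitI_dist_gt0.
Qed.

Lemma holder_bounded g phi : 0 <= g -> holder_continuous g phi ->
  exists M, forall x, `|phi x| <= M.
Proof.
move=> g0 [M hM]; exists (`|phi (unitI0 R)| + `|M|) => x.
rewrite -[phi x](subrK (phi (unitI0 R))) addrC.
rewrite (le_trans (ler_normD _ _))// lerD2l (le_trans (hM _ _))//.
rewrite (@le_trans _ _ (`|M| * `|(x : R) - (unitI0 R : R)| `^ g))//.
  by rewrite ler_wpM2r ?powR_ge0 ?ler_norm.
by rewrite ler_piMr// powR_le1// normr_ge0 unitI_dist_le1.
Qed.

Lemma holder_submod g : submod_closed (mem [set phi | holder_continuous g phi]).
Proof.
split=> [|a phi psi]; rewrite !inE/=.
  by exists 0 => x y; rewrite subrr normr0 mul0r.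
move=> [M hM] [N hN]; exists (`|a| * M + N) => x y.
rewrite opprD addrACA -mulrBr mulrDl (le_trans (ler_normD _ _))// lerD//.
by rewrite normrM -mulrA ler_wpM2l.
Qed.

End sup_norms.

(* C^gamma(R), normed by ||phi|| + |phi|_gamma; boundedness is automatic since
   gamma > 0. *)
Section holder_space.
Context {R : realType} (gamma : {posnum R}).

Definition holder_pred : {pred unitI R -> R} :=
  mem [set phi : unitI R -> R | holder_continuous gamma%:num phi].

Record holder := Holder {
  holder_fun :> unitI R -> R ;
  holder_funP : holder_fun \in holder_pred }.

HB.instance Definition _ := [isSub for holder_fun].
HB.instance Definition _ := [Choice of holder by <:].
HB.instance Definition _ :=
  GRing.isSubmodClosed.Build R (unitI R -> R) holder_pred
    (GRing.submod_closed_semi (holder_submod gamma%:num)).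
HB.instance Definition _ := [SubChoice_isSubLmodule of holder by <:].

Definition holder_norm (phi : holder) : R :=
  sup_norm phi + holder_seminorm gamma%:num phi.

Lemma holderP (phi : holder) : holder_continuous gamma%:num phi.
Proof. by have := holder_funP phi; rewrite inE. Qed.

Lemma holder_le_sup_norm (phi : holder) x : `|phi x| <= sup_norm phi.
Proof. by apply/le_sup_norm/(holder_bounded _ (holderP phi)). Qed.

Lemma holder_normD (phi psi : holder) :
  holder_norm (phi + psi) <= holder_norm phi + holder_norm psi.
Proof.
rewrite /holder_norm addrACA lerD//.
  apply: sup_norm_le => x.
  by rewrite (le_trans (ler_normD _ _))// lerD// holder_le_sup_norm.
apply: holder_seminorm_le => x y.
rewrite opprD addrACA mulrDl (le_trans (ler_normD _ _))//.
by rewrite lerD// le_holder_seminorm//; exact: holderP.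
Qed.

Let holder_norm_leZ (l : R) (phi : holder) :
  holder_norm (l *: phi) <= `|l| * holder_norm phi.
Proof.
rewrite /holder_norm mulrDr lerD//.
  by apply: sup_norm_le => x; rewrite normrM ler_wpM2l// holder_le_sup_norm.
apply: holder_seminorm_le => x y.
rewrite -mulrBr normrM -mulrA ler_wpM2l// le_holder_seminorm//.
exact: holderP.
Qed.

Lemma holder_norm_ge0 (phi : holder) : 0 <= holder_norm phi.
Proof.
rewrite addr_ge0// ?(le_trans _ (holder_le_sup_norm phi (unitI0 R)))//.
have := le_holder_seminorm (unitI0 R) unitI1 (holderP phi).
have d0 : 0 < `|(unitI0 R : R) - (unitI1 : R)| by rewrite unitI_dist_gt0 ?unitI0_neq1.
by move=> /(le_trans (normr_ge0 _)); rewrite pmulr_lge0// powR_gt0.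
Qed.

Lemma holder_normZ (l : R) (phi : holder) :
  holder_norm (l *: phi) = `|l| * holder_norm phi.
Proof.
apply/eqP; rewrite eq_le holder_norm_leZ/=.
have [->|l0] := eqVneq l 0; first by rewrite normr0 mul0r holder_norm_ge0.
rewrite mulrC -ler_pdivlMr ?normr_gt0// mulrC -normfV.
by have := holder_norm_leZ l^-1 (l *: phi); rewrite scalerA mulVf// scale1r.
Qed.

Lemma holder_norm0_eq0 (phi : holder) : holder_norm phi = 0 -> phi = 0.
Proof.
move=> n0; apply/val_inj/funext => x; apply/normr0_eq0/eqP.
rewrite eq_le normr_ge0 andbT (le_trans (holder_le_sup_norm phi x))// -n0.
rewrite lerDl.
have := le_holder_seminorm (unitI0 R) unitI1 (holderP phi).
have d0 : 0 < `|(unitI0 R : R) - (unitI1 : R)| by rewrite unitI_dist_gt0 ?unitI0_neq1.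
by move=> /(le_trans (normr_ge0 _)); rewrite pmulr_lge0// powR_gt0.
Qed.

HB.instance Definition _ := Lmodule_isNormed.Build R holder
  holder_normD holder_normZ holder_norm0_eq0.

End holder_space.

(* Kolmogorov-Sinai entropy of f with respect to mu. *)
Section entropy.
Context d (T : measurableType d) (R : realType).
Variables (mu : probability T R) (f : T -> T).

(* Cells may be empty or null: they do not contribute, because ln 0 = 0. *)
Definition finite_partition (k : nat) (A : 'I_k -> set T) : Prop :=
  [/\ forall i, measurable (A i), trivIset setT A & \bigcup_i A i = setT].

(* The cell, labelled by the word w, of the n-th refinement of A, which is the
   join of f^-i(A) for 0 <= i < n. *)
Definition refinement_cell (k : nat) (A : 'I_k -> set T) (n : nat)
    (w : {ffun 'I_n -> 'I_k}) : set T :=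
  \bigcap_(i in [set: 'I_n]) (iter i f @^-1` A (w i)).

Definition refinement_entropy (k : nat) (A : 'I_k -> set T) (n : nat) : R :=
  - \sum_(w : {ffun 'I_n -> 'I_k})
      (let p := fine (mu (refinement_cell A w)) in p * ln p).

Definition partition_entropy (k : nat) (A : 'I_k -> set T) : R :=
  limn (fun n => refinement_entropy A n / n%:R).

Definition entropy : \bar R :=
  ereal_sup [set h | exists (k : nat) (A : 'I_k -> set T),
    finite_partition A /\ h = (partition_entropy A)%:E].

End entropy.

Section intermittent_map.
Context {R : realType} (alpha : {posnum R}).

Definition intermittent_fun (x : R) : R :=
  let y := x * (1 + x `^ alpha%:num) in if y <= 1 then y else y - 1.

Lemma intermittent_fun_subproof (x : unitI R) :
  intermittent_fun x \in `[0, 1]%classic.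
Proof.
have x0 := unitI_ge0 x; have x1 := unitI_le1 x.
have p1 : (x : R) `^ alpha%:num <= 1 by rewrite powR_le1// x0.
have p0 : 0 <= (x : R) `^ alpha%:num := powR_ge0 _ _.
rewrite inE/= in_itv/= /intermittent_fun.
have [h|h] := leP (_ * (1 + _)) 1.
  by apply/andP; split=> //; rewrite mulr_ge0 ?addr_ge0.
have h2 : (x : R) * (1 + (x : R) `^ alpha%:num) <= 2 by nra.
by apply/andP; split; lra.
Qed.

Definition intermittent_map (x : unitI R) : unitI R :=
  exist _ (intermittent_fun x) (intermittent_fun_subproof x).

Local Notation f := intermittent_map.
Implicit Types (nu : probability (unitI R) R) (phi : unitI R -> R).

Definition invariant_probability nu : Prop :=
  forall A : set (unitI R), measurable A -> nu (f @^-1` A) = nu A.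

Definition free_energy phi nu : \bar R :=
  (entropy nu f + \int[nu]_x (phi x)%:E)%E.

Definition pressure phi : \bar R :=
  ereal_sup [set free_energy phi nu | nu in invariant_probability].

Definition gibbs_state phi nu : Prop :=
  invariant_probability nu /\ free_energy phi nu = pressure phi.

Definition exponentially_mixing nu : Prop :=
  exists C rho : R, [/\ 0 < C, 0 < rho < 1 &
    forall (psi psi' : unitI R -> R) (n : nat),
      measurable_fun setT psi -> bounded_fun psi -> holder_continuous 1 psi' ->
      `|\int[nu]_x (psi (iter n f x) * psi' x)
         - (\int[nu]_x psi x) * (\int[nu]_x psi' x)|
      <= C * sup_norm psi * holder_seminorm 1 psi' * rho ^+ n].

Definition dirac0_unique_gibbs phi : Prop :=
  gibbs_state phi \d_(unitI0 R) /\
  forall nu, gibbs_state phi nu ->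
    forall A, measurable A -> nu A = \d_(unitI0 R) A.

Variable gamma : {posnum R}.

Definition intermittent_phase : set (holder gamma) :=
  [set phi | exists nu, [/\ gibbs_state phi nu, exponentially_mixing nu &
    (0 < entropy nu f)%E]].

Definition stationary_phase : set (holder gamma) :=
  [set phi : holder gamma | dirac0_unique_gibbs phi]°.

(* For gamma <= min(alpha, 1) this is also the boundary of the stationary
   phase. *)
Definition phase_transition_locus : set (holder gamma) :=
  boundary intermittent_phase.

Definition constant_integral_space : set (holder gamma) :=
  [set phi : holder gamma | forall nu, invariant_probability nu ->
    (\int[nu]_x (phi x)%:E = (phi (unitI0 R))%:E)%E].

End intermittent_map.

Arguments intermittent_phase {R} alpha gamma.
Arguments stationary_phase {R} alpha gamma.
Arguments phase_transition_locus {R} alpha gamma.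
Arguments constant_integral_space {R} alpha gamma.

(* Main.v *)
From HB Require Import structures.
Require Import Defs.
From mathcomp Require Import all_boot all_order all_algebra.
From mathcomp Require Import all_classical all_reals all_analysis.
From mathcomp Require Import ring lra.
From mathcomp Require Import measurable_realfun.

(* Let y_0, y_1 be the two inverse branches of f and L the transfer operator of
   a Hoelder potential phi. If some h bounded away from 0 and infinity satisfies
   L h <= z h, then h_nu + int phi dnu <= ln z for every invariant nu; let lam be
   the infimum of these z. If e^(phi 0) < lam, then L has a Hoelder eigenfunction
   for lam, and the stationary measure of the Markov operator normalized by this
   eigenfunction is an exponentially mixing equilibrium state of positive
   entropy. Hence phi is intermittent as soon as some invariant measure has free
   energy greater than phi 0.
   Let omega(x) = x^gamma. The functions 1 / (x^alpha + eta) show that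
   h_nu <= t int omega dnu for some t. So each line {psi - s omega} leaves the
   intermittent phase at a single time tau(psi), the infimum of the s such that
   h_nu + int psi dnu - psi 0 <= s int omega dnu for all nu. This is convex in
   psi, as a supremum of affine functions, and the phase transition locus is the
   graph {s = tau(psi)}. Take for K the potentials psi with int psi dnu0 = psi 0,
   where nu0 has positive entropy: then tau > 0 on K.
   An affine space in the remaining part of the parameter space satisfies
   h_nu + int phi dnu <= phi 0 throughout, so its directions have the same mean
   for all invariant measures; measures on periodic orbits give infinitely many
   independent constraints. *)

Set Implicit Arguments.
Unset Strict Implicit.
Unset Printing Implicit Defensive.

Import Order.TTheory GRing.Theory Num.Theory.
Import numFieldNormedType.Exports.

Local Open Scope classical_set_scope.
Local Open Scope ring_scope.

(** * Inverse branches and the coding *)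

(** The obstacle is the indifferent fixed point: the branch through 0 has no uniform contraction, so
    that neither a spectral gap of L on Hoelder functions nor bounded distortion is available in
    general. Two devices replace them. The distortion of Birkhoff sums may grow linearly, with an
    arbitrarily small slope that disappears after division by n. Hoelder seminorms are measured
    against a weight W: only the branch y_1 contracts, by a factor theta, and the condition e^(phi
    0) < lam makes the growth rate of the correspondingly damped operator smaller than lam, whence a
    Lasota-Yorke inequality. The direction omega is chosen because it dominates phi - phi 0 up to
    the norm of phi: a change of phi by d in norm changes int phi dnu - phi 0 by at most d int omega
    dnu, hence moves the exit time by at most d. The hypothesis gamma <= alpha enters only through
    the bound h_nu <= t int omega dnu. *)

Section branches.
Context {R : realType} (alpha : {posnum R}).
Local Notation a := (alpha%:num).
Local Notation f := (intermittent_map alpha).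
Local Notation T := (unitI R).
Local Notation ev := (@unitI_val R).
Implicit Types (x y z : T) (w : seq bool).

(** The map before reduction modulo 1; it increases from 0 to 2 on the unit interval, which yields
    one inverse branch for each digit. *)
Definition lift_map (t : R) : R := t * (1 + t `^ a).

(** The two sides differ by u (v^a - u^a). The factor 1 + v^a, taken at the right end point, later
    gives the contraction away from 0. *)
Lemma lift_map_expand (u v : R) : 0 <= u -> u <= v ->
  (v - u) * (1 + v `^ a) <= lift_map v - lift_map u.
Proof.
move=> u0 uv.
have : u `^ a <= v `^ a by apply: ge0_ler_powR; rewrite ?nnegrE// (le_trans u0).
have := powR_ge0 u a; rewrite /lift_map; nra.
Qed.

Lemma lift_map_expand1 (u v : R) : 0 <= u -> u <= v ->
  v - u <= lift_map v - lift_map u.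
Proof.
move=> u0 uv; apply: le_trans (lift_map_expand u0 uv).
by rewrite ler_peMr ?subr_ge0// lerDl powR_ge0.
Qed.

Lemma lift_map_inj (u v : R) : 0 <= u -> 0 <= v -> lift_map u = lift_map v -> u = v.
Proof.
move=> u0 v0 uv; have [h|h] := leP u v.
  by have := lift_map_expand1 u0 h; rewrite uv; lra.
by have := lift_map_expand1 v0 (ltW h); rewrite uv; lra.
Qed.


(** The absolute value removes the jump of [powR] at 0 from the left, so that the intermediate value
    theorem is applied to a function continuous on the whole line. *)
Lemma continuous_normr_powR : continuous (fun t : R => `|t| `^ a).
Proof.
move=> t; have [->|t0] := eqVneq t 0.
  apply/cvgrPdist_lt => e e0; near=> u.
  rewrite normr0 powR0 ?gt_eqF// sub0r normrN ger0_norm ?powR_ge0//.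
  rewrite -[ltRHS]powRr1 ?ltW// -(@mulVf _ a)// powRrM.
  rewrite gt0_ltr_powR ?nnegrE ?powR_ge0//.
  near: u; exists (e `^ a^-1); first exact: powR_gt0.
by move=> z /=; rewrite sub0r normrN.
have H : (fun u : R => expR (a * ln `|u|)) @ t --> expR (a * ln `|t|).
  apply: continuous_cvg; first exact: continuous_expR.
  apply: cvgM; first exact: cvg_cst.
  apply: (@continuous_comp _ _ _ (fun u : R => `|u|) (@ln R) t).
    exact: norm_continuous.
  by apply: continuous_ln; rewrite normr_gt0.
rewrite /continuous_at [X in _ --> X]/powR normr_eq0 (negPf t0).
apply: cvg_trans H; apply: near_eq_cvg; near=> u.
rewrite /powR normr_eq0 ifN//; near: u.
by apply: (cvgr_neq0 t) => //; exact: cvg_id.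
Unshelve. all: by end_near. Qed.

Lemma lift_map_surj (s : R) : 0 <= s <= 2 ->
  exists y : T, lift_map (ev y) = s.
Proof.
move=> /andP[s0 s2].
pose g t := t * (1 + `|t| `^ a).
have c : {within `[(0:R), 1], continuous g}.
  apply/continuous_subspaceT => t; apply: cvgM; first exact: cvg_id.
  by apply: cvgD; [exact: cvg_cst|exact: continuous_normr_powR].
have [|t tI gt] := @IVT R g 0 1 s ler01 c.
  by rewrite /g mul0r normr1 powR1 mul1r ge_min le_max s0/=; apply/orP; right; lra.
have tin : t \in `[0, 1]%classic by rewrite inE.
exists (exist _ t tin); rewrite -gt /g /lift_map /unitI_val/=.
by move: tI; rewrite in_itv/= => /andP[t0 _]; rewrite ger0_norm.
Qed.

Lemma lift_branch_subproof (i : bool) x :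
  exists y : T, lift_map (ev y) = ev x + i%:R.
Proof.
apply: lift_map_surj; have := unitI_ge0 x; have := unitI_le1 x.
by case: i => /=; lra.
Qed.

Definition branch (i : bool) x : T := sval (cid (lift_branch_subproof i x)).

Lemma branchP (i : bool) x : lift_map (ev (branch i x)) = ev x + i%:R.
Proof. by rewrite /branch; case: cid. Qed.

Definition digit x : bool := 1 < lift_map (ev x).

Lemma lift_mapE x : lift_map (ev x) = ev (f x) + (digit x)%:R.
Proof.
rewrite /digit [ev (f x)]/unitI_val/=.
by have [h|h] := leP (lift_map (ev x)) 1; rewrite /= /intermittent_fun -/(lift_map (ev x)) ?h ?leNgt ?h /= ?addr0 ?subrK.
Qed.

Lemma unitI_val_inj : injective (@unitI_val R).
Proof. by move=> x y xy; apply: val_inj. Qed.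

Lemma branch_digit x : branch (digit x) (f x) = x.
Proof.
apply: unitI_val_inj; apply: lift_map_inj; rewrite ?unitI_ge0//.
by rewrite branchP -lift_mapE.
Qed.

(** At 0 this fails: [branch true 0] is the breakpoint, whose lift is exactly 1 and whose digit is
    therefore [false]. Hence the later proof that 0 is negligible, [mean_indic0]. *)
Lemma digit_branch i x : x != unitI0 R -> digit (branch i x) = i.
Proof.
move=> x0; rewrite /digit branchP.
have : 0 < ev x.
  rewrite lt_neqAle unitI_ge0 andbT eq_sym; apply: contra x0 => /eqP h.
  by apply/eqP/unitI_val_inj.
have := unitI_le1 x; case: i => /= ? ?; first by lra.
by rewrite addr0; apply/negbTE; rewrite -leNgt.
Qed.

Lemma digit_branch0 x : digit (branch false x) = false.
Proof. by rewrite /digit branchP addr0; apply/negbTE; rewrite -leNgt unitI_le1. Qed.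

Lemma branchK i x : x != unitI0 R -> f (branch i x) = x.
Proof.
move=> x0; apply: unitI_val_inj; have := lift_mapE (branch i x).
by rewrite digit_branch// branchP => /addIr.
Qed.

Lemma branch0K x : f (branch false x) = x.
Proof.
apply: unitI_val_inj; have := lift_mapE (branch false x).
by rewrite digit_branch0 branchP => /addIr.
Qed.

Lemma branch_neq0 i x : x != unitI0 R -> branch i x != unitI0 R.
Proof.
move=> x0; apply: contra x0 => /eqP h; have := branchP i x; rewrite h.
rewrite /lift_map /unitI_val/= mul0r => /esym/eqP; rewrite paddr_eq0 ?unitI_ge0//.
by move=> /andP[/eqP e _]; apply/eqP/unitI_val_inj.
Qed.

Lemma branch_contract i x y : ev x <= ev y ->
  ev (branch i x) <= ev (branch i y) /\
  (ev (branch i y) - ev (branch i x)) * (1 + ev (branch i y) `^ a) <= ev y - ev x.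
Proof.
move=> xy; have e : lift_map (branch i y) - lift_map (ev (branch i x)) = ev y - ev x.
  by rewrite !branchP; lra.
have bb : ev (branch i x) <= ev (branch i y).
  have [//|h] := leP (ev (branch i x)) (ev (branch i y)).
  by have := lift_map_expand1 (unitI_ge0 (branch i y)) (ltW h); lra.
by split=> //; rewrite -e; apply: lift_map_expand; rewrite ?unitI_ge0.
Qed.

Lemma branch_le i x : ev x / 2 <= ev (branch i x).
Proof.
have := branchP i x; rewrite /lift_map.
have := unitI_ge0 (branch i x); have := unitI_le1 (branch i x) => b1 b0.
have : ev (branch i x) `^ a <= 1 by rewrite powR_le1// b0.
have := ler0n R i; nra.
Qed.

Lemma branch0_le x : ev (branch false x) <= ev x.
Proof.
have := branchP false x; rewrite /lift_map addr0 => <-.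
by rewrite ler_peMr ?unitI_ge0// lerDl powR_ge0.
Qed.

Lemma branch0_0 : branch false (unitI0 R) = unitI0 R.
Proof.
apply: unitI_val_inj; apply/eqP; rewrite eq_le unitI_ge0 andbT.
exact: branch0_le.
Qed.

Definition breakpoint : T := branch false (unitI1 : T).
Local Notation kappa := (ev breakpoint).

Lemma breakpoint_gt0 : 0 < kappa.
Proof. by apply: lt_le_trans (branch_le _ _); rewrite divr_gt0. Qed.

Lemma breakpointE : kappa * (1 + kappa `^ a) = 1.
Proof. by have := branchP false (unitI1 : T); rewrite addr0. Qed.

Lemma breakpoint_lt1 : kappa < 1.
Proof.
have := breakpointE; have := breakpoint_gt0; have := powR_gt0 a breakpoint_gt0.
nra.
Qed.

Lemma branch1_0 : branch true (unitI0 R) = breakpoint.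
Proof.
apply: unitI_val_inj; apply: lift_map_inj; rewrite ?unitI_ge0// !branchP.
by rewrite addr0 add0r.
Qed.

Lemma breakpoint_le_branch1 x : kappa <= ev (branch true x).
Proof. by rewrite -branch1_0; apply: (branch_contract true _).1; exact: unitI_ge0. Qed.

Lemma branch_dist i x y : `|ev (branch i x) - ev (branch i y)| <= `|ev x - ev y|.
Proof.
wlog xy : x y / ev x <= ev y.
  by move=> H; have [/H//|/ltW/H] := leP (ev x) (ev y); rewrite distrC (distrC (ev y)).
have [h1 h2] := branch_contract i xy.
have := powR_ge0 (ev (branch i y)) a.
rewrite distrC (distrC (ev x)) !ger0_norm ?subr_ge0//; nra.
Qed.

(** The image of branch 1 lies to the right of kappa, where the lift expands by at least 1 +
    kappa^a, which is 1 / kappa by [breakpointE]. *)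
Lemma branch1_dist x y :
  `|ev (branch true x) - ev (branch true y)| <= kappa * `|ev x - ev y|.
Proof.
wlog xy : x y / ev x <= ev y.
  by move=> H; have [/H//|/ltW/H] := leP (ev x) (ev y); rewrite distrC (distrC (ev y)).
have [h1 h2] := branch_contract true xy.
have : kappa `^ a <= ev (branch true y) `^ a.
  by apply: ge0_ler_powR; rewrite ?nnegrE ?unitI_ge0// breakpoint_le_branch1.
have k0 := breakpoint_gt0; have kE := breakpointE.
rewrite distrC (distrC (ev x)) !ger0_norm ?subr_ge0// => hk.
rewrite -(ler_pM2r (_ : 0 < 1 + kappa `^ a)) ?ltr_wpDr ?powR_ge0//.
apply: (@le_trans _ _ (ev y - ev x)); last by rewrite mulrAC kE mul1r.
by apply: le_trans h2; rewrite ler_wpM2l ?subr_ge0// lerD2l.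
Qed.

(* A single inverse branch shrinks an interval of length l by the factor
   1 + (l/2)^alpha at least, because its right end point is at least l/2. *)
Lemma branch_shrink i x y (e : R) : 0 <= e -> e <= `|ev x - ev y| ->
  `|ev (branch i x) - ev (branch i y)| * (1 + (e / 2) `^ a) <= `|ev x - ev y|.
Proof.
move=> e0; wlog xy : x y / ev x <= ev y.
  move=> H; have [/H//|/ltW/H] := leP (ev x) (ev y).
  by rewrite distrC (distrC (ev (branch i y))).
have [h1 h2] := branch_contract i xy.
rewrite (distrC (ev x)) (distrC (ev (branch i x))) !ger0_norm ?subr_ge0// => ed.
apply: le_trans h2; rewrite ler_wpM2l ?subr_ge0// lerD2l.
apply: ge0_ler_powR; rewrite ?nnegrE ?unitI_ge0 ?divr_ge0//.
apply: le_trans (branch_le i y); rewrite ler_wpM2r//.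
by have := unitI_ge0 x; lra.
Qed.

Definition wbranch w x : T := foldr branch x w.

(** No rate q^n holds uniformly near the indifferent fixed point. While an interval is longer than
    e, each branch shrinks it by the factor q; once shorter than e it remains so, since no branch
    expands. *)
Lemma wbranch_shrink (e : R) : 0 < e -> exists2 q, 0 < q < 1 &
  forall w x y, `|ev (wbranch w x) - ev (wbranch w y)| <= Num.max e (q ^+ size w).
Proof.
move=> e0; pose q := (1 + (e / 2) `^ a)^-1.
have p0 : 0 < (e / 2) `^ a by rewrite powR_gt0 ?divr_gt0.
have q0 : 0 < q by rewrite invr_gt0 ltr_wpDr ?powR_ge0.
exists q; first by rewrite q0 /q invf_lt1 ?ltrDl// ltr_wpDr ?powR_ge0.
move=> w x y; elim: w => [|i w IH] /=.
  by rewrite expr0 le_max unitI_dist_le1 orbT.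
set u := wbranch w x in IH *; set v := wbranch w y in IH *.
have [h|h] := leP e `|ev u - ev v|; last first.
  by rewrite le_max (le_trans (branch_dist _ _ _) (ltW h)).
have := branch_shrink i (ltW e0) h.
rewrite -ler_pdivlMr ?ltr_wpDr ?powR_ge0// -/q => /le_trans; apply.
move: IH; rewrite !le_max => /orP[h'|h'].
  have -> : `|ev u - ev v| = e by apply/eqP; rewrite eq_le h h'.
  by rewrite ler_piMr ?(ltW e0)// invf_le1 ?lerDl ?ltr_wpDr ?powR_ge0.
by apply/orP; right; rewrite exprSr ler_wpM2r// ltW.
Qed.

Definition word n x : seq bool := [seq digit (iter i f x) | i <- iota 0 n].

Lemma size_word n x : size (word n x) = n.
Proof. by rewrite size_map size_iota. Qed.

Lemma wordS n x : word n.+1 x = digit x :: word n (f x).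
Proof.
rewrite /word /= (iotaDl 1 0) -map_comp; congr cons; apply: eq_map => i /=.
by rewrite -iterS iterSr.
Qed.

Lemma wbranch_word n x : wbranch (word n x) (iter n f x) = x.
Proof.
elim: n x => [//|n IH] x; rewrite wordS iterSr /= IH.
exact: branch_digit.
Qed.

End branches.

(** * Measurability on the unit interval *)

Section unit_interval_measurability.
Context {R : realType}.
Local Notation T := (unitI R).
Local Notation ev := (@unitI_val R).

Lemma nbhs_unitI (x : T) (A : set T) : nbhs x A <->
  exists2 r : R, 0 < r & forall y : T, `|ev x - ev y| < r -> A y.
Proof.
split; first by move=> /nbhs_ballP[r r0 xA]; exists r.
by move=> [r r0 xA]; apply/nbhs_ballP; exists r.
Qed.

Lemma open_unitI (U : set T) : open U <->
  forall x, U x -> exists2 r : R, 0 < r & forall y : T, `|ev x - ev y| < r -> U y.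
Proof.
rewrite openE; split=> [oU x /oU|oU x /oU]; first by rewrite /interior => /nbhs_unitI.
by move=> h; apply/nbhs_unitI.
Qed.

Lemma open_measurable_unitI (U : set T) : open U -> measurable U.
Proof. by move=> oU; apply: sub_sigma_algebra. Qed.

Lemma continuous_measurable_unitI (g : T -> R) :
  (forall x (e : R), 0 < e ->
     exists2 r : R, 0 < r & forall y, `|ev x - ev y| < r -> `|g x - g y| < e) ->
  measurable_fun setT g.
Proof.
move=> cg; apply: (measurability _ (RGenOInfty.measurableE R)).
move=> _ [_ [a ->] <-]; rewrite setTI; apply: open_measurable_unitI.
apply/open_unitI => x /=; rewrite in_itv/= andbT => ax.
have [|r r0 h] := cg x (g x - a); first by rewrite subr_gt0.
exists r => // y /h; rewrite in_itv/= andbT => /(le_lt_trans (ler_norm _)); lra.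
Qed.

Lemma measurable_unitI_val : measurable_fun setT ev.
Proof. by apply: continuous_measurable_unitI => x e e0; exists e. Qed.

Lemma holder_continuous_measurable (g : R) (phi : T -> R) : 0 < g ->
  holder_continuous g phi -> measurable_fun setT phi.
Proof.
move=> g0 [M hM]; apply: continuous_measurable_unitI => x e e0.
have M1 : 0 < `|M| + 1 by rewrite ltr_wpDl.
exists ((e / (`|M| + 1)) `^ g^-1); first by rewrite powR_gt0 ?divr_gt0.
move=> y xy; apply: le_lt_trans (hM x y) _.
have h : `|ev x - ev y| `^ g < e / (`|M| + 1).
  have -> : e / (`|M| + 1) = ((e / (`|M| + 1)) `^ g^-1) `^ g.
    by rewrite -powRrM mulVf ?gt_eqF// powRr1// divr_ge0 ?ltW.
  by rewrite gt0_ltr_powR ?nnegrE ?powR_ge0.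
apply: (@le_lt_trans _ _ ((`|M| + 1) * `|ev x - ev y| `^ g)).
  by rewrite ler_wpM2r ?powR_ge0// (le_trans (ler_norm _))// lerDl.
by rewrite mulrC -ltr_pdivlMr.
Qed.

Lemma measurable_to_unitI d (S : measurableType d) (g : S -> T) :
  measurable_fun setT (ev \o g) -> measurable_fun setT g.
Proof.
move=> mg; apply: (measurability (@open T) (erefl _)) => _ [U oU <-].
(* The topology is induced from R: U is the trace of an open set V of R. *)
rewrite setTI; move: oU => [V oV VU].
rewrite (_ : g @^-1` U = (ev \o g) @^-1` V).
  by rewrite -[X in measurable X]setTI; apply: mg => //; exact: open_measurable.
by rewrite -VU.
Qed.

End unit_interval_measurability.

Section branch_measurability.
Context {R : realType} (alpha : {posnum R}).
Local Notation f := (intermittent_map alpha).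
Local Notation T := (unitI R).
Local Notation ev := (@unitI_val R).

Lemma measurable_branch i : measurable_fun setT (branch alpha i).
Proof.
apply: measurable_to_unitI; apply: continuous_measurable_unitI => x e e0.
by exists e => // y; apply: le_lt_trans; exact: branch_dist.
Qed.

Lemma measurable_lift_map : measurable_fun setT (fun x : T => lift_map alpha (ev x)).
Proof.
rewrite /lift_map; apply: measurable_funM; first exact: measurable_unitI_val.
apply: measurable_funD => //.
by apply: (measurableT_comp (measurable_powR _)); exact: measurable_unitI_val.
Qed.

Lemma measurable_digit : measurable_fun setT (digit alpha).
Proof. by apply: measurable_fun_ltr => //; exact: measurable_lift_map. Qed.

Lemma measurable_intermittent_map : measurable_fun setT f.
Proof.
apply: measurable_to_unitI.
rewrite (_ : _ \o _ = fun x : T =>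
  if digit alpha x then lift_map alpha (ev x) - 1 else lift_map alpha (ev x)).
  apply: measurable_fun_ifT; first exact: measurable_digit.
    by apply: measurable_funB => //; exact: measurable_lift_map.
  exact: measurable_lift_map.
apply/funext => x /=; have -> := lift_mapE alpha x.
by case: digit; rewrite /= ?addrK ?addr0.
Qed.

Lemma measurable_iter_map n : measurable_fun setT (iter n f).
Proof.
elim: n => [|n IH]; first exact: measurable_id.
by apply: (measurableT_comp measurable_intermittent_map); exact: IH.
Qed.

Lemma measurable_preimage d d' (S : measurableType d) (S' : measurableType d')
  (g : S -> S') A : measurable_fun setT g -> measurable A -> measurable (g @^-1` A).
Proof. by move=> mg mA; rewrite -[X in measurable X]setTI; exact: mg. Qed.

Lemma measurable_word n w : measurable [set x | word alpha n x = w].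
Proof.
elim: n w => [|n IH] w.
  case: w => [|i w].
    by rewrite (_ : [set _ | _] = setT)//; apply/seteqP; split.
  by rewrite (_ : [set _ | _] = set0)//; apply/seteqP; split.
case: w => [|i w].
  by rewrite (_ : [set _ | _] = set0)//; apply/seteqP; split=> // x; rewrite /= wordS.
rewrite (_ : [set _ | _] = digit alpha @^-1` [set i] `&` f @^-1` [set x | word alpha n x = w]).
  apply: measurableI; apply: measurable_preimage => //; first exact: measurable_digit.
  exact: measurable_intermittent_map.
by apply/seteqP; split=> x /=; rewrite wordS; [case=> -> ->|case=> -> ->].
Qed.

End branch_measurability.

(** * Shannon entropy *)

Section finite_random_variables.
Context d (T : measurableType d) (R : realType) (mu : probability T R).

Definition pmf (V : finType) (X : T -> V) (v : V) : R := fine (mu (X @^-1` [set v])).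

Definition simple_rv (V : finType) (X : T -> V) : Prop :=
  forall v, measurable (X @^-1` [set v]).

Definition shannon_entropy (V : finType) (X : T -> V) : R :=
  - \sum_v pmf X v * ln (pmf X v).

Implicit Types (U V : finType).

Lemma pmf_ge0 V (X : T -> V) v : 0 <= pmf X v.
Proof. by rewrite fine_ge0. Qed.

Lemma simple_rv_pred V (X : T -> V) (P : pred V) : simple_rv X ->
  measurable [set x | P (X x)].
Proof.
move=> mX; rewrite (_ : [set _ | _] = \big[setU/set0]_(v in P) (X @^-1` [set v])).
  by apply: bigsetU_measurable => v _; exact: mX.
rewrite -bigcup_pred; apply/seteqP; split=> [x Px|x [v Pv /= ->]//].
by exists (X x).
Qed.

Lemma simple_rv_comp U V (X : T -> V) (p : V -> U) : simple_rv X -> simple_rv (p \o X).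
Proof.
move=> mX u; rewrite (_ : _ @^-1` _ = [set x | (p (X x)) == u]).
  exact: (@simple_rv_pred _ X (fun v => p v == u)).
by apply/seteqP; split=> x /= /eqP.
Qed.

Lemma simple_rv_pair U V (X : T -> U) (Y : T -> V) : simple_rv X -> simple_rv Y ->
  simple_rv (fun x => (X x, Y x)).
Proof.
move=> mX mY [u v]; rewrite (_ : _ @^-1` _ = (X @^-1` [set u]) `&` (Y @^-1` [set v])).
  exact: measurableI.
by apply/seteqP; split=> x /= [-> ->].
Qed.

Lemma simple_rv_ffun n V (X : 'I_n -> T -> V) : (forall i, simple_rv (X i)) ->
  simple_rv (fun x => [ffun i => X i x]).
Proof.
move=> mX w.
rewrite (_ : _ @^-1` _ = \bigcap_(i in [set: 'I_n]) (X i @^-1` [set w i])).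
  by apply: fin_bigcap_measurable => // i _; exact: mX.
apply/seteqP; split=> x /=; first by move=> <- i _ /=; rewrite ffunE.
by move=> h; apply/ffunP => i; rewrite ffunE; exact: h.
Qed.

Lemma sum_pmf_pred V (X : T -> V) (P : pred V) : simple_rv X ->
  \sum_(v | P v) pmf X v = fine (mu [set x | P (X x)]).
Proof.
move=> mX; suff mu_seq (s : seq V) : uniq s ->
    fine (mu [set x | X x \in s]) = \sum_(v <- s) pmf X v.
  rewrite -big_enum -mu_seq ?enum_uniq//; congr (fine (mu _)).
  by apply/seteqP; split=> x /=; rewrite mem_enum.
elim: s => [_|v s IH /= /andP[vs us]].
  by rewrite big_nil (_ : [set _ | _] = set0) ?measure0//; apply/seteqP; split.
rewrite big_cons -IH// -fineD ?fin_num_measure//; last first.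
- exact: (@simple_rv_pred _ X (mem s)).
rewrite -measureU//; last 2 first.
- exact: (@simple_rv_pred _ X (mem s)).
- by apply/seteqP; split=> // x /= [xv]; rewrite xv (negPf vs).
congr (fine (mu _)); apply/seteqP; split=> x /=; rewrite inE.
  by move=> /orP[/eqP|]; [left|right].
by move=> [->|->]; rewrite ?eqxx ?orbT.
Qed.

Lemma sum_pmf V (X : T -> V) : simple_rv X -> \sum_v pmf X v = 1.
Proof.
move=> mX; rewrite (sum_pmf_pred xpredT mX) (_ : [set _ | _] = setT).
  by rewrite probability_setT.
by apply/seteqP; split.
Qed.

Lemma pmf_le1 V (X : T -> V) v : simple_rv X -> pmf X v <= 1.
Proof.
move=> mX; rewrite -(sum_pmf mX) (bigD1 v)//= lerDl.
by apply: sumr_ge0 => *; exact: pmf_ge0.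
Qed.

Lemma expectation_comp U V (X : T -> V) (p : V -> U) (G : U -> R) : simple_rv X ->
  \sum_v pmf X v * G (p v) = \sum_u pmf (p \o X) u * G u.
Proof.
move=> mX; rewrite (partition_big p xpredT)//=; apply: eq_bigr => u _.
rewrite (eq_bigr (fun v => pmf X v * G u)); last by move=> v /eqP ->.
rewrite -mulr_suml (sum_pmf_pred _ mX); congr (fine (mu _) * _).
by apply/seteqP; split=> x /= /eqP.
Qed.

(** Sum of p ln (q / p) <= q - p over the values. The weights q have total mass at most 1, so that
    upper bounds on entropy reduce to a choice of q. *)
Lemma gibbs_inequality V (X : T -> V) (q : V -> R) : simple_rv X ->
  (forall v, 0 <= q v) -> (forall v, pmf X v != 0 -> 0 < q v) -> \sum_v q v <= 1 ->
  shannon_entropy X <= - \sum_v pmf X v * ln (q v).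
Proof.
move=> mX q0 qp q1; rewrite lerN2 -subr_ge0 -sumrB.
apply: (@le_trans _ _ (\sum_v (pmf X v - q v))).
  by rewrite sumrB (sum_pmf mX) subr_ge0.
apply: ler_sum => v _.
have [->|p0] := eqVneq (pmf X v) 0; first by rewrite !mul0r subrr sub0r oppr_le0.
have pp : 0 < pmf X v by rewrite lt_neqAle eq_sym p0 pmf_ge0.
have /qp qv := p0.
rewrite -mulrBr -ler_pdivrMl// -lerN2 opprB -ln_div ?posrE//.
have := @le_ln1Dx R (q v / pmf X v - 1); rewrite [1 + _]addrC subrK => h.
rewrite (le_trans (h _))//; last first.
  by rewrite mulrBr mulVf// opprB [_^-1 * _]mulrC.
by rewrite ltrBrDr addNr divr_gt0.
Qed.

Lemma shannon_entropy_ge0 V (X : T -> V) : simple_rv X -> 0 <= shannon_entropy X.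
Proof.
move=> mX; rewrite oppr_ge0; apply: sumr_le0 => v _.
by rewrite mulr_ge0_le0 ?pmf_ge0// ln_le0// pmf_le1.
Qed.

Lemma pmf_comp_ge U V (X : T -> V) (p : V -> U) v : simple_rv X ->
  pmf X v <= pmf (p \o X) (p v).
Proof.
move=> mX; apply: fine_le; rewrite ?fin_num_measure//.
- exact: simple_rv_comp.
- apply: le_measure; rewrite ?inE//; first exact: simple_rv_comp.
  by move=> x /= ->.
Qed.

Lemma shannon_entropy_comp U V (X : T -> V) (p : V -> U) : simple_rv X ->
  shannon_entropy (p \o X) <= shannon_entropy X.
Proof.
move=> mX; rewrite lerN2 -(expectation_comp p (fun u => ln (pmf (p \o X) u)) mX).
apply: ler_sum => v _.
have [->|p0] := eqVneq (pmf X v) 0; first by rewrite !mul0r.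
have pp : 0 < pmf X v by rewrite lt_neqAle eq_sym p0 pmf_ge0.
have := pmf_comp_ge p v mX => h.
by rewrite ler_wpM2l ?pmf_ge0// ler_ln// posrE// (lt_le_trans pp).
Qed.

End finite_random_variables.

Section refinement.
Context d (T : measurableType d) (R : realType) (nu : probability T R).

Lemma refinement_entropyE (f : T -> T) k (a : T -> 'I_k) n :
  refinement_entropy nu f (fun i => a @^-1` [set i]) n =
  shannon_entropy nu (fun x => [ffun i : 'I_n => a (iter i f x)]).
Proof.
rewrite /refinement_entropy /shannon_entropy; congr (- _); apply: eq_bigr => w _.
suff -> : refinement_cell f (fun i => a @^-1` [set i]) w =
  (fun x => [ffun i : 'I_n => a (iter i f x)]) @^-1` [set w] by [].
apply/seteqP; split=> x /=.
  by move=> h; apply/ffunP => i; rewrite ffunE; exact: h i I.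
by move=> <- i _ /=; rewrite ffunE.
Qed.

End refinement.

(** * Means of bounded measurable functions *)

Section bounded_measurable.
Context d (T : measurableType d) (R : realType).
Implicit Types (g h : T -> R).

Definition bounded_measurable g : Prop :=
  measurable_fun setT g /\ exists M, forall x, `|g x| <= M.

Lemma bounded_measurable_cst c : bounded_measurable (fun=> c).
Proof. by split; [exact: measurable_cst|exists `|c|]. Qed.

Lemma bounded_measurableD g h : bounded_measurable g -> bounded_measurable h ->
  bounded_measurable (fun x => g x + h x).
Proof.
move=> [mg [M hM]] [mh [N hN]]; split; first exact: measurable_funD.
by exists (M + N) => x; rewrite (le_trans (ler_normD _ _))// lerD.
Qed.

Lemma bounded_measurableN g : bounded_measurable g -> bounded_measurable (fun x => - g x).
Proof.
move=> [mg [M hM]]; split; last by exists M => x; rewrite normrN.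
by apply: (measurableT_comp (@oppr_measurable _ _)).
Qed.

Lemma bounded_measurableB g h : bounded_measurable g -> bounded_measurable h ->
  bounded_measurable (fun x => g x - h x).
Proof. by move=> bg /bounded_measurableN; exact: bounded_measurableD. Qed.

Lemma bounded_measurableM g h : bounded_measurable g -> bounded_measurable h ->
  bounded_measurable (fun x => g x * h x).
Proof.
move=> [mg [M hM]] [mh [N hN]]; split; first exact: measurable_funM.
by exists (M * N) => x; rewrite normrM ler_pM.
Qed.

Lemma bounded_measurable_sum (I : Type) (s : seq I) (G : I -> T -> R) :
  (forall i, bounded_measurable (G i)) -> bounded_measurable (fun x => \sum_(i <- s) G i x).
Proof.
move=> bG; elim: s => [|i s IH].
  by under eq_fun do rewrite big_nil; exact: bounded_measurable_cst.
by under eq_fun do rewrite big_cons; exact: bounded_measurableD.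
Qed.

Lemma bounded_measurable_indic (A : set T) : measurable A ->
  bounded_measurable (\1_A : T -> R).
Proof.
move=> mA; split; first exact: measurable_indic.
by exists 1 => x; rewrite indicE; case: (_ \in _); rewrite ?normr1 ?normr0.
Qed.

Lemma bounded_measurable_comp d' (S : measurableType d') g (u : S -> T) :
  measurable_fun setT u -> bounded_measurable g ->
  measurable_fun setT (g \o u) /\ exists M, forall x, `|g (u x)| <= M.
Proof.
move=> mu [mg [M hM]]; split; last by exists M => x; exact: hM.
exact: measurableT_comp.
Qed.

Variable nu : probability T R.
Local Notation E g := (\int[nu]_x g x).

Lemma bounded_measurable_integrable g : bounded_measurable g ->
  nu.-integrable setT (EFin \o g).
Proof.
move=> [mg [M hM]]; apply: measurable_bounded_integrable => //.
  by rewrite -ge0_fin_numE// fin_num_measure.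
by exists M; split; [exact: num_real|move=> N /ltW MN x _; exact: le_trans MN].
Qed.

Lemma EFin_mean g : bounded_measurable g ->
  (\int[nu]_x (g x)%:E = (E g)%:E)%E.
Proof.
by move=> bg; rewrite /Rintegral fineK//; apply: integrable_fin_num => //;
  exact: bounded_measurable_integrable.
Qed.

Lemma mean_cst c : E (fun=> c) = c.
Proof. by rewrite Rintegral_cst// [X in fine X]probability_setT mulr1. Qed.

Lemma meanD g h : bounded_measurable g -> bounded_measurable h ->
  E (fun x => g x + h x) = E g + E h.
Proof. by move=> bg bh; apply: RintegralD => //; exact: bounded_measurable_integrable. Qed.

Lemma meanB g h : bounded_measurable g -> bounded_measurable h ->
  E (fun x => g x - h x) = E g - E h.
Proof. by move=> bg bh; apply: RintegralB => //; exact: bounded_measurable_integrable. Qed.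

Lemma meanZ c g : bounded_measurable g -> E (fun x => c * g x) = c * E g.
Proof. by move=> bg; apply: RintegralZl => //; exact: bounded_measurable_integrable. Qed.

Lemma mean_le g h : bounded_measurable g -> bounded_measurable h ->
  (forall x, g x <= h x) -> E g <= E h.
Proof.
by move=> bg bh gh; apply: le_Rintegral => //; exact: bounded_measurable_integrable.
Qed.

Lemma eq_mean g h : g =1 h -> E g = E h.
Proof. by move=> gh; apply: eq_Rintegral => x _; exact: gh. Qed.

Lemma mean_norm_le g M : bounded_measurable g -> (forall x, `|g x| <= M) -> `|E g| <= M.
Proof.
move=> bg hM; rewrite ler_norml -{1}(mean_cst (- M)) -{2}(mean_cst M).
have h x : - M <= g x <= M by rewrite -ler_norml.
apply/andP; split; apply: mean_le => //; do ?exact: bounded_measurable_cst.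
  by move=> x; case/andP: (h x).
by move=> x; case/andP: (h x).
Qed.

Lemma mean_indic (A : set T) : measurable A -> E (\1_A) = fine (nu A).
Proof. by move=> mA; rewrite /Rintegral integral_indic// setIT. Qed.

Lemma mean_sum (I : Type) (s : seq I) (G : I -> T -> R) :
  (forall i, bounded_measurable (G i)) ->
  E (fun x => \sum_(i <- s) G i x) = \sum_(i <- s) E (G i).
Proof.
move=> bG; elim: s => [|i s IH].
  by rewrite big_nil (eq_mean (h := fun=> 0)) ?mean_cst// => x; rewrite big_nil.
rewrite big_cons -IH -meanD//; last exact: bounded_measurable_sum.
by apply: eq_mean => x; rewrite big_cons.
Qed.

Lemma mean_simple_rv (V : finType) (X : T -> V) (G : V -> R) : simple_rv X ->
  \sum_v pmf nu X v * G v = E (fun x => G (X x)).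
Proof.
move=> mX; rewrite (eq_mean (h := fun x => \sum_v G v * \1_(X @^-1` [set v]) x)); last first.
  move=> x; rewrite (bigD1 (X x))//= indicE mem_set// mulr1 big1 ?addr0// => v vX.
  rewrite indicE memNset ?mulr0// => /= Xv; by rewrite Xv eqxx in vX.
rewrite mean_sum; last first.
  by move=> v; apply: bounded_measurableM; [exact: bounded_measurable_cst|exact: bounded_measurable_indic].
apply: eq_bigr => v _; rewrite meanZ; last exact: bounded_measurable_indic.
by rewrite mean_indic// mulrC.
Qed.

Lemma mean_comp (f : T -> T) g : measurable_fun setT f ->
  (forall A, measurable A -> nu (f @^-1` A) = nu A) ->
  bounded_measurable g -> E (fun x => g (f x)) = E g.
Proof.
move=> mf fnu bg; rewrite /Rintegral; congr fine.
rewrite [RHS](eq_measure_integral (pushforward nu f))//; last first.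
  by move=> A mA _; symmetry; exact: fnu.
rewrite integral_pushforward//.
- exact/measurable_EFinP/bg.1.
- rewrite preimage_setT.
  exact: (@bounded_measurable_integrable (g \o f) (bounded_measurable_comp mf bg)).
Qed.

End bounded_measurable.

(** * Generating partition *)

Section cylinder_approximation.
Context {R : realType} (alpha : {posnum R}).
Local Notation f := (intermittent_map alpha).
Local Notation T := (unitI R).
Local Notation ev := (@unitI_val R).
Local Notation word := (word alpha).
Variable nu : probability T R.

Lemma take_word m n x : (m <= n)%N -> take m (word n x) = word m x.
Proof. by move=> mn; rewrite /word -map_take take_iota (minn_idPl mn). Qed.

Lemma measurable_word_pred n (P : seq bool -> Prop) :
  measurable [set x | P (word n x)].
Proof.
elim: n P => [|n IH] P.
  have [p|p] := pselect (P [::]).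
    by rewrite (_ : [set _ | _] = setT)//; apply/seteqP; split.
  by rewrite (_ : [set _ | _] = set0)//; apply/seteqP; split.
rewrite (_ : [set _ | _] =
  (digit alpha @^-1` [set true] `&` f @^-1` [set x | P (true :: word n x)]) `|`
  (digit alpha @^-1` [set false] `&` f @^-1` [set x | P (false :: word n x)])).
  by apply: measurableU; apply: measurableI; apply: measurable_preimage => //;
    [exact: measurable_digit|exact: measurable_intermittent_map
    |exact: IH (fun w => P (_ :: w))
    |exact: measurable_digit|exact: measurable_intermittent_map
    |exact: IH (fun w => P (_ :: w))].
apply/seteqP; split=> x /=; rewrite wordS.
  by case: digit => h; [left|right].
by move=> [[-> h]|[-> h]].
Qed.

Definition word_error (D : set T) m (E : pred (seq bool)) : set T :=
  [set x | ~ (D x <-> E (word m x))].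

Lemma measurable_word_error D m E : measurable D -> measurable (word_error D m E).
Proof.
move=> mD; have mE := measurable_word_pred m E.
rewrite (_ : word_error _ _ _ = (D `\` [set x | E (word m x)]) `|`
    ([set x | E (word m x)] `\` D)).
  by apply: measurableU; apply: measurableD.
apply/seteqP; split=> x /=; last by move=> [[h1 h2] [/(_ h1)]|[h1 h2] [_ /(_ h1)]].
move=> h; have [Dx|nDx] := pselect (D x); [left|right]; split=> //.
  by move=> Ex; apply: h.
by apply: contrapT => nE; apply: h.
Qed.

Definition word_approximable (D : set T) := forall e : R, 0 < e ->
  exists m E, (nu (word_error D m E) <= e%:E)%E.

Lemma le_nu (A B : set T) : measurable A -> measurable B -> A `<=` B -> (nu A <= nu B)%E.
Proof. by move=> mA mB AB; apply: le_measure; rewrite ?inE. Qed.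

Lemma le_nuU (A B C : set T) (a b : R) : measurable A -> measurable B -> measurable C ->
  A `<=` B `|` C -> (nu B <= a%:E)%E -> (nu C <= b%:E)%E -> (nu A <= (a + b)%:E)%E.
Proof.
move=> mA mB mC AB Ba Cb; apply: (le_trans (le_nu mA (measurableU _ _ mB mC) AB)).
by rewrite EFinD (le_trans (measureU2 _ _ _))// leeD.
Qed.

Lemma word_approximableC D : word_approximable D -> word_approximable (~` D).
Proof.
move=> aD e /aD[m [E h]]; exists m, (fun w => ~~ E w).
rewrite (_ : word_error _ _ _ = word_error D m E)//.
apply/seteqP; split=> x /= h1 h2; apply: h1; split.
- by move=> nD; apply/negP => Ex; apply: nD; apply/h2.
- by move=> /negP nE Dx; apply/nE/h2.
- by move=> Dx; apply: contrapT => /negP nE; have /h2 : ~~ E (word m x) by [].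
- by move=> Ex; apply: contrapT => nD; have /h2 := nD; rewrite Ex.
Qed.

Lemma word_approximableU A B : measurable A -> measurable B ->
  word_approximable A -> word_approximable B -> word_approximable (A `|` B).
Proof.
move=> mA mB aA aB e e0.
have e20 : 0 < e / 2 by rewrite divr_gt0.
have [m [E h]] := aA _ e20; have [n [F k]] := aB _ e20.
exists (maxn m n), (fun w => E (take m w) || F (take n w)).
rewrite [e]splitr; apply: le_nuU h k; try exact: measurable_word_error.
  by apply: measurable_word_error; exact: measurableU.
move=> x; rewrite /word_error/= !take_word ?leq_maxl ?leq_maxr// => hx.
apply: contrapT => /not_orP[/contrapT hA /contrapT hB]; apply: hx.
split; first by move=> [/hA ->//|/hB ->]; rewrite orbT.
by move=> /orP[/hA|/hB]; [left|right].
Qed.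

Lemma word_approximable_bigcup (F : (set T)^nat) :
  (forall n, measurable (F n)) -> (forall m n, (m <= n)%N -> F m `<=` F n) ->
  (forall n, word_approximable (F n)) -> word_approximable (\bigcup_n F n).
Proof.
move=> mF ndF aF e e0.
have e20 : 0 < e / 2 by rewrite divr_gt0.
have mU : measurable (\bigcup_n F n) by exact: bigcup_measurable.
have cF : nu (F n) @[n --> \oo] --> nu (\bigcup_n F n).
  by apply: nondecreasing_cvg_mu => // m n mn; apply/subsetPset/ndF.
have [J hJ] : exists J, (nu ((\bigcup_n F n) `\` F J) <= (e / 2)%:E)%E.
  have /cvgrPdist_le /(_ _ e20) : fine (nu (F n)) @[n --> \oo] --> fine (nu (\bigcup_n F n)).
    by apply: fine_cvg; rewrite fineK ?fin_num_measure.
  move=> -[J _ /(_ J (leqnn _)) /= h].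
  exists J; rewrite measureD//; last by rewrite ltey_eq fin_num_measure.
  rewrite setIidr; last exact: (bigcup_sup (i := J)).
  rewrite -[X in (X - _)%E]fineK ?fin_num_measure//.
  rewrite -[X in (_ - X)%E]fineK ?fin_num_measure// -EFinB lee_fin.
  exact: le_trans (ler_norm _) h.
have [m [E h]] := aF J _ e20; exists m, E.
rewrite [e]splitr; apply: le_nuU hJ h; try exact: measurable_word_error.
  exact: measurableD.
move=> x hx; have [[n _ Fnx]|nU] := pselect ((\bigcup_n F n) x); last first.
  right=> hJ; apply: hx; split=> // /hJ FJ; exfalso; apply: nU; by exists J.
have [FJ|nFJ] := pselect (F J x); last by left; split=> //; exists n.
by right=> hJ; apply: hx; split=> [_|_]; [exact/hJ|exists J].
Qed.

(** Approximable sets form a sigma-algebra, and an open set is the increasing union of the cylinders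
    that it contains, because the cylinders around a point shrink to it. *)
Lemma measurable_word_approximable D : measurable D -> word_approximable D.
Proof.
move=> mD.
suff : @measurable _ T `<=` [set D | measurable D /\ word_approximable D].
  by move=> /(_ _ mD)[].
apply: smallest_sub.
  split=> /=.
  - split=> // e e0; exists 0%N, (fun=> false); rewrite (_ : word_error _ _ _ = set0).
      by rewrite measure0 lee_fin ltW.
    by apply/seteqP; split=> x //=; apply.
  - by move=> A [mA aA]; rewrite setTD; split; [exact: measurableC|exact: word_approximableC].
  - move=> F hF; split; first by apply: bigcup_measurable => n _; case: (hF n).
    rewrite -(bigcup_bigsetU_bigcup F); apply: word_approximable_bigcup.
    + by move=> n; apply: bigsetU_measurable => i _; case: (hF i).
    + by move=> m n mn; exact: (@subset_bigsetU _ F).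
    + move=> n; elim: n.+1 => {n} [|n IH].
        rewrite big_ord0 => e e0; exists 0%N, (fun=> false).
        rewrite (_ : word_error _ _ _ = set0) ?measure0 ?lee_fin ?ltW//.
        by apply/seteqP; split=> x //=; apply.
      rewrite big_ord_recr/=; apply: word_approximableU => //.
      * by apply: bigsetU_measurable => i _; case: (hF i).
      * by case: (hF n).
      * by case: (hF n).
move=> U oU; split; first exact: open_measurable_unitI.
pose P n := [set w | forall x, word n x = w -> U x].
rewrite (_ : U = \bigcup_n [set x | P n (word n x)]); last first.
  apply/seteqP; split=> [x Ux|x [n _ /= h]]; last exact: h.
  have [r r0 rU] := (open_unitI U).1 oU x Ux.
  (* Points with the same word of length n are within max (r / 2, q^n), which is less than r as soon
     as q^n < r. *)
  have [q /andP[q0 q1] hq] := wbranch_shrink alpha (divr_gt0 r0 (ltr0n R 2)).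
  have qr : `|q| < 1 by rewrite ger0_norm// ltW.
  have /cvgrPdist_lt /(_ _ r0) : (q ^+ n @[n --> \oo] --> 0) by exact: cvg_expr.
  move=> -[n _ /(_ n (leqnn _)) /=].
  rewrite sub0r normrN ger0_norm ?exprn_ge0 ?(ltW q0)// => qn.
  exists n => // y yx; apply: rU.
  rewrite -(wbranch_word alpha n x) -(wbranch_word alpha n y) yx.
  apply: le_lt_trans (hq _ _ _) _; rewrite size_word gt_max qn andbT.
  by rewrite ltr_pdivrMr// ltr_pMr// ltr1n.
apply: word_approximable_bigcup => n.
- exact: measurable_word_pred.
- move=> k nk x /= h y hy; apply: h.
  by rewrite -(take_word y nk) hy take_word.
- move=> e e0; exists n, (fun w => `[< P n w >]).
  rewrite (_ : word_error _ _ _ = set0) ?measure0 ?lee_fin ?ltW//.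
  by apply/seteqP; split=> x //=; apply; split=> /asboolP.
Qed.

(** Each cell is approximated within e / k by a set of words, and s returns a label whose set
    contains the given word. A wrong label at x means that x is misclassified for at least one of
    the k cells. *)
Lemma word_coding k (a : T -> 'I_k) (e : R) : 0 < e -> simple_rv a ->
  exists m (s : seq bool -> 'I_k),
    measurable [set x | a x != s (word m x)] /\
    (nu [set x | a x != s (word m x)] <= e%:E)%E.
Proof.
move=> e0 ma.
have k0 : (0 < k)%N by apply: leq_ltn_trans (ltn_ord (a (unitI0 R))).
have ek0 : 0 < e / k%:R by rewrite divr_gt0// ltr0n.
have /choice[mE hE] : forall j, exists mE : nat * pred (seq bool),
    (nu (word_error (a @^-1` [set j]) mE.1 mE.2) <= (e / k%:R)%:E)%E.
  move=> j; have [m [E h]] := measurable_word_approximable (ma j) ek0.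
  by exists (m, E).
pose m := \max_j (mE j).1.
pose s w := odflt (a (unitI0 R)) [pick j | (mE j).2 (take (mE j).1 w)].
have ms : measurable [set x | a x != s (word m x)].
  rewrite (_ : [set _ | _] = \bigcup_(j in [set: 'I_k])
      (a @^-1` [set j] `&` [set x | j != s (word m x)])).
    apply: fin_bigcup_measurable => // j _; apply: measurableI; first exact: ma.
    exact: (measurable_word_pred m (fun w => j != s w)).
  by apply/seteqP; split=> [x /= h|x [j _ [/= -> h]]//]; exists (a x).
exists m, s; split=> //.
pose bad := fun j => word_error (a @^-1` [set j]) (mE j).1 (mE j).2.
have mbad j : measurable (bad j) by exact: measurable_word_error.
apply: (@le_trans _ _ (nu (\big[setU/set0]_(j < k) bad j))).
  apply: le_nu => //; first exact: bigsetU_measurable.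
  move=> x /= /negP h; rewrite -bigcup_pred; apply: contrapT => nb; apply: h.
  have H j : a x = j <-> (mE j).2 (take (mE j).1 (word m x)).
    rewrite take_word; last exact: leq_bigmax.
    by apply: contrapT => nj; apply: nb; exists j.
  rewrite /s; case: pickP => [j /H ->//|/(_ (a x))].
  by have [/(_ erefl) ->] := H (a x).
apply: (@le_trans _ _ (\sum_(j < k) nu (bad j))%E); last first.
  apply: (@le_trans _ _ (\sum_(j < k) (e / k%:R)%:E)%E); first by apply: lee_sum => j _; exact: hE.
  by rewrite sumEFin sumr_const card_ord -(mulr_natr (e / _)) divfK// pnatr_eq0 -lt0n.
elim: (index_enum _) => [|j r IH]; first by rewrite !big_nil measure0.
rewrite !big_cons; apply: le_trans (leeD (lexx _) IH).
by apply: measureU2 => //; exact: bigsetU_measurable.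
Qed.

End cylinder_approximation.

(** * Comparison of an arbitrary finite partition with cylinders *)

Section partition_entropy_bound.
Context {R : realType} (alpha : {posnum R}).
Local Notation f := (intermittent_map alpha).
Local Notation T := (unitI R).
Local Notation word := (word alpha).
Variable nu : probability T R.

Definition cylinder n (x : T) : n.-tuple bool :=
  Tuple (introT eqP (size_word alpha n x)).

Lemma simple_cylinder n : simple_rv (cylinder n).
Proof.
move=> w; rewrite (_ : _ @^-1` _ = [set x | word n x = w]).
  exact: (measurable_word_pred alpha n (fun u => u = w)).
apply/seteqP; split=> x /= => [<-//|h]; exact: val_inj.
Qed.

Lemma subword_word m n i x : (i + m <= n)%N ->
  take m (drop i (word n x)) = word m (iter i f x).
Proof.
move=> imn; rewrite /word -map_drop -map_take drop_iota take_iota add0n.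
have /minn_idPl -> : (m <= n - i)%N by rewrite leq_subRL ?(leq_trans _ imn)// leq_addr.
rewrite -[i in LHS]addn0 iotaDl -map_comp; apply: eq_map => j /=.
by rewrite addnC iterD.
Qed.

Hypothesis nu_inv : invariant_probability alpha nu.

Lemma invariant_iter i A : measurable A -> nu (iter i f @^-1` A) = nu A.
Proof.
move=> mA; elim: i => [//|i IH].
rewrite (_ : _ @^-1` A = f @^-1` (iter i f @^-1` A)).
  rewrite nu_inv//; apply: measurable_preimage => //; exact: measurable_iter_map.
by apply/seteqP; split=> x /=; rewrite -iterS iterSr.
Qed.

(* Gibbs' inequality, for weights which guess the cell of each iterate from its
   word of length m: a wrong guess is rare, so that the cost of the error is small. *)
Lemma refinement_entropy_le_cylinder k (a : T -> 'I_k) (e : R) : 0 < e ->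
  simple_rv a -> exists m, forall n,
  shannon_entropy nu (fun x => [ffun i : 'I_n => a (iter i f x)]) <=
  shannon_entropy nu (cylinder (n + m)%N) + n%:R * e.
Proof.
move=> e0 ma.
have k0 : (0 < k)%N by apply: leq_ltn_trans (ltn_ord (a (unitI0 R))).
have kR : 1 <= k%:R :> R by rewrite ler1n.
(* A correct guess receives the conditional weight 1 - del and costs - ln (1 - del) = e / 2 per
   iterate; a wrong label receives del / k and costs c. With error probability at most (e / 2) / c
   the total is at most e per iterate. *)
pose del : R := 1 - expR (- (e / 2)).
have x1 : expR (- (e / 2)) < 1 by rewrite expR_lt1 oppr_lt0 divr_gt0.
have x0 : 0 < expR (- (e / 2)) by exact: expR_gt0.
have del0 : 0 < del by rewrite subr_gt0.
have del1 : del < 1 by rewrite /del; lra.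
have dk0 : 0 < del / k%:R by rewrite divr_gt0// ltr0n.
pose c : R := - ln (del / k%:R).
have c0 : 0 < c.
  rewrite oppr_gt0 ln_lt0// dk0/= ltr_pdivrMr ?ltr0n// mul1r.
  exact: lt_le_trans kR.
have [m [s [ms hs]]] := word_coding alpha nu (divr_gt0 (divr_gt0 e0 (ltr0n R 2)) c0) ma.
exists m => n.
set X := fun x : T => _; set N := (n + m)%N.
pose Z x := (X x, cylinder N x).
have mX : simple_rv X.
  apply: (@simple_rv_ffun _ _ n _ (fun i x => a (iter i f x))) => i v.
  by apply: (measurable_preimage _ (ma v)); exact: measurable_iter_map.
have mY := @simple_cylinder N.
have mZ : simple_rv Z by exact: simple_rv_pair.
pose r (j l : 'I_k) : R := if j == l then 1 - del else del / k%:R.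
pose sub i (y : N.-tuple bool) := s (take m (drop i y)).
pose q (v : {ffun 'I_n -> 'I_k} * N.-tuple bool) :=
  pmf nu (cylinder N) v.2 * \prod_(i < n) r (v.1 i) (sub i v.2).
have r0 j l : 0 < r j l by rewrite /r; case: ifP => // _; rewrite subr_gt0.
have rsum l : \sum_j r j l <= 1.
  rewrite (bigD1 l)//= /r eqxx.
  rewrite (eq_bigr (fun=> del / k%:R)); last by move=> j /negPf ->.
  rewrite sumr_const cardC1 card_ord -(mulr_natr (del / _)).
  rewrite -subn1 natrB// mulrBr mulr1 divfK ?pnatr_eq0 -?lt0n//.
  by rewrite addrA subrK gerBl ltW.
apply: (le_trans (shannon_entropy_comp nu fst mZ)).
have qsum : \sum_v q v <= 1.
  rewrite -(pair_bigA _ (fun x y => q (x, y)))/= exchange_big/=.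
  rewrite -[leRHS](sum_pmf nu mY); apply: ler_sum => y _.
  rewrite /q/= -mulr_sumr ler_piMr ?pmf_ge0//.
  rewrite -(bigA_distr_bigA (fun (i : 'I_n) j => r j (sub i y)))/=.
  apply: (@le_trans _ _ (\prod_(i < n) 1)); last by rewrite big1.
  apply: ler_prod => i _; rewrite rsum andbT sumr_ge0// => j _; exact: ltW.
have pY v : pmf nu Z v != 0 -> 0 < pmf nu (cylinder N) v.2.
  move=> pv; apply: lt_le_trans (pmf_comp_ge nu snd v mZ).
  by rewrite lt_neqAle eq_sym pv pmf_ge0.
apply: (le_trans (gibbs_inequality mZ _ _ qsum)).
- by move=> v; rewrite mulr_ge0 ?pmf_ge0// prodr_ge0// => i _; exact: ltW.
- by move=> v /pY h; rewrite mulr_gt0// prodr_gt0.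
rewrite (eq_bigr (fun v => pmf nu Z v * ln (pmf nu (cylinder N) (snd v)) +
    \sum_(i < n) pmf nu Z v * ln (r (v.1 i) (sub i v.2)))); last first.
  move=> v _; have [->|pv] := eqVneq (pmf nu Z v) 0.
    by rewrite !mul0r big1 ?addr0// => i _; rewrite mul0r.
  rewrite lnM ?posrE ?pY//; last exact: prodr_gt0.
  rewrite mulrDr -mulr_sumr; congr (_ + _ * _).
  elim: (index_enum _) => [|i u IH]; first by rewrite !big_nil ln1.
  by rewrite !big_cons lnM ?posrE ?prodr_gt0// IH.
rewrite big_split/= opprD; apply: lerD.
  by rewrite (expectation_comp nu snd (fun y => ln (pmf nu (cylinder N) y)) mZ).
rewrite exchange_big/= -sumrN.
have -> : n%:R * e = \sum_(i < n) e by rewrite sumr_const card_ord mulr_natl.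
apply: ler_sum => i _.
pose bad (v : {ffun 'I_n -> 'I_k} * N.-tuple bool) := v.1 i != sub i v.2.
have bnd (v : {ffun 'I_n -> 'I_k} * N.-tuple bool) : - ln (r (v.1 i) (sub i v.2)) <= e / 2 + c * (bad v)%:R.
  rewrite /r /bad; case: eqP => _ /=; last by rewrite mulr1 lerDr divr_ge0// ltW.
  by rewrite mulr0 addr0 opprB addrC subrK expRK opprK.
rewrite -sumrN; apply: (@le_trans _ _ (\sum_v pmf nu Z v * (e / 2 + c * (bad v)%:R))).
  by apply: ler_sum => v _; rewrite -mulrN ler_wpM2l ?pmf_ge0 ?bnd.
rewrite (eq_bigr (fun v => pmf nu Z v * (e / 2) + c * (pmf nu Z v * (bad v)%:R))); last first.
  by move=> v _; rewrite mulrDr (mulrCA _ c).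
rewrite big_split/= -mulr_suml (sum_pmf nu mZ) mul1r -mulr_sumr.
have -> : \sum_v pmf nu Z v * (bad v)%:R = \sum_(v | bad v) pmf nu Z v.
  rewrite [RHS]big_mkcond; apply: eq_bigr => v _.
  by case: (bad v); rewrite ?mulr1 ?mulr0.
rewrite (sum_pmf_pred nu bad mZ).
(* By invariance a wrong guess at time i is as unlikely as at time 0. *)
rewrite (_ : [set x | bad (Z x)] = iter i f @^-1` [set x | a x != s (word m x)]); last first.
  by apply/seteqP; split=> x /=; rewrite /bad /Z /X /= ffunE /sub /= subword_word// leq_add2r ltnW.
rewrite (invariant_iter i ms) [leRHS]splitr lerD2l mulrC -ler_pdivlMr//.
by rewrite -lee_fin fineK ?fin_num_measure.
Qed.

End partition_entropy_bound.

(** * Transfer operator and variational inequality *)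

Section transfer_operator.
Context {R : realType} (alpha : {posnum R}).
Local Notation f := (intermittent_map alpha).
Local Notation T := (unitI R).
Local Notation ev := (@unitI_val R).
Local Notation word := (word alpha).
Local Notation branch := (branch alpha).
Local Notation wbranch := (wbranch alpha).
Implicit Types (phi g h : T -> R).

(** At x = 0 the sum includes the breakpoint, which f maps to 1: the two ends of the interval are
    treated as one point of the circle, and the operator preserves continuity at 0. *)
Definition transfer phi g (x : T) : R :=
  \sum_(i : bool) expR (phi (branch i x)) * g (branch i x).

Lemma transferE phi g x : transfer phi g x =
  expR (phi (branch true x)) * g (branch true x) +
  expR (phi (branch false x)) * g (branch false x).
Proof. by rewrite /transfer big_bool. Qed.

(** Birkhoff sum along the pulled-back orbit from [wbranch w x] to x, with the end point x left out;
    see [branch_sum_word]. *)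
Fixpoint branch_sum phi (w : seq bool) (x : T) : R :=
  if w is i :: u then phi (wbranch w x) + branch_sum phi u x else 0.

Lemma branch_sum_word phi n x :
  branch_sum phi (word n x) (iter n f x) = \sum_(j < n) phi (iter j f x).
Proof.
elim: n x => [|n IH] x; first by rewrite big_ord0.
rewrite wordS iterSr big_ord_recl /= IH; congr (_ + _).
  by rewrite (wbranch_word alpha n (f x)) branch_digit.
by apply: eq_bigr => j _; rewrite -iterSr.
Qed.

Lemma big_tuple_cons n (F : seq bool -> R) :
  \sum_(w : n.+1.-tuple bool) F w = \sum_(i : bool) \sum_(w : n.-tuple bool) F (i :: w).
Proof.
rewrite pair_bigA (reindex (fun p : bool * n.-tuple bool => [tuple of p.1 :: p.2]))//=.
exists (fun w : n.+1.-tuple bool => (thead w, [tuple of behead w])).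
  move=> [i w] _ /=; rewrite theadE; congr (_, _).
  exact: val_inj.
by move=> w _; apply: val_inj; case: w => -[|i w].
Qed.

Lemma sum_words phi g n x :
  \sum_(w : n.-tuple bool) expR (branch_sum phi w x) * g (wbranch w x) =
  iter n (transfer phi) g x.
Proof.
elim: n g => [|n IH] g.
  rewrite (big_pred1 [tuple])/= ?expR0 ?mul1r// => w.
  by apply/esym/eqP; exact: tuple0.
rewrite (big_tuple_cons n (fun w => expR (branch_sum phi w x) * g (wbranch w x))).
rewrite iterSr -IH exchange_big/=; apply: eq_bigr => w _.
rewrite /transfer mulr_sumr; apply: eq_bigr => i _.
by rewrite expRD mulrA [_ * expR (branch_sum _ _ _)]mulrC.
Qed.

Lemma transfer_le phi g h : (forall x, g x <= h x) ->
  forall x, transfer phi g x <= transfer phi h x.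
Proof. by move=> gh x; apply: ler_sum => i _; rewrite ler_wpM2l ?expR_ge0. Qed.

Lemma transferZ phi c g x : transfer phi (fun y => c * g y) x = c * transfer phi g x.
Proof. by rewrite /transfer mulr_sumr; apply: eq_bigr => i _; rewrite mulrCA. Qed.

Lemma iter_transfer_le phi g h n : (forall x, g x <= h x) ->
  forall x, iter n (transfer phi) g x <= iter n (transfer phi) h x.
Proof. by move=> gh; elim: n => // n IH x /=; apply: transfer_le. Qed.

Lemma supersolution_growth phi h (z c C : R) : 0 < c -> 0 < z ->
  (forall x, c <= h x <= C) -> (forall x, transfer phi h x <= z * h x) ->
  forall n x, iter n (transfer phi) (fun=> 1) x <= C / c * z ^+ n.
Proof.
move=> c0 z0 hb hz n x.
have H m y : iter m (transfer phi) h y <= z ^+ m * h y.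
  elim: m y => [|m IH] y; first by rewrite mul1r.
  rewrite iterS; apply: le_trans (@transfer_le phi _ (fun y => z ^+ m * h y) IH y) _.
  by rewrite transferZ exprSr -mulrA ler_wpM2l// exprn_ge0// ltW.
apply: (@le_trans _ _ (iter n (transfer phi) (fun y => c^-1 * h y) x)).
  apply: iter_transfer_le => y; rewrite mulrC ler_pdivlMr// mul1r.
  by case/andP: (hb y).
have -> : iter n (transfer phi) (fun y => c^-1 * h y) x = c^-1 * iter n (transfer phi) h x.
  elim: n x => // n IH x /=; rewrite -transferZ; congr transfer.
  exact/funext.
rewrite mulrC ler_pdivrMr//; apply: (le_trans (H n x)).
rewrite [C / c * _]mulrC -mulrA divfK ?gt_eqF// ler_wpM2l ?exprn_ge0 ?(ltW z0)//.
by case/andP: (hb x).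
Qed.

Lemma max_powR_le (a b g : R) : 0 <= a -> 0 <= b -> 0 <= g ->
  Num.max a b `^ g <= a `^ g + b `^ g.
Proof.
by move=> a0 b0 g0; rewrite /Num.max; case: ifP => _; rewrite ?lerDl ?lerDr powR_ge0.
Qed.

Section distortion.
Variables (g : R) (phi : T -> R).
Hypotheses (g0 : 0 < g) (phi_holder : holder_continuous g phi).

Lemma branch_distortion (e : R) : 0 < e -> exists2 t, 0 < t < 1 & exists2 M, 0 < M &
  forall w x y, `|phi (wbranch w x) - phi (wbranch w y)| <= e + M * t ^+ size w.
Proof.
move=> e0; have [M0 hM0] := phi_holder.
pose M := `|M0| + 1; have M_gt0 : 0 < M by rewrite ltr_wpDl.
have hM x y : `|phi x - phi y| <= M * `|ev x - ev y| `^ g.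
  apply: (le_trans (hM0 x y)); rewrite ler_wpM2r ?powR_ge0//.
  by rewrite (le_trans (ler_norm _))// lerDl.
(* The solution of M r^g = e, so that intervals shorter than r contribute at most e. *)
pose r := (e / M) `^ g^-1; have r0 : 0 < r by rewrite powR_gt0// divr_gt0.
have rg : r `^ g = e / M by rewrite -powRrM mulVf ?gt_eqF// powRr1// ltW// divr_gt0.
have [q /andP[q0 q1] hq] := wbranch_shrink alpha r0.
have qg : q `^ g < 1 `^ g by rewrite gt0_ltr_powR ?nnegrE ?ler01 ?(ltW q0).
rewrite powR1 in qg; exists (q `^ g); first by rewrite powR_gt0.
exists M => // w x y; apply: (le_trans (hM _ _)).
have : `|ev (wbranch w x) - ev (wbranch w y)| `^ g <= e / M + (q `^ g) ^+ size w.
  apply: (@le_trans _ _ (Num.max r (q ^+ size w) `^ g)).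
    by apply: ge0_ler_powR; rewrite ?nnegrE ?(ltW g0)// ?le_max ?(ltW r0).
  apply: le_trans (max_powR_le (ltW r0) (exprn_ge0 _ (ltW q0)) (ltW g0)) _.
  by rewrite rg -(powR_mulrn _ (ltW q0)) -(powR_mulrn _ (powR_ge0 q g)) powRAC.
rewrite -(ler_pM2l M_gt0) => /le_trans; apply.
by rewrite mulrDr mulrCA divff ?gt_eqF// mulr1.
Qed.

(** Bounded distortion may fail near the indifferent fixed point. The additional linear term is
    harmless because its slope e is arbitrary and entropies are divided by the length of the
    words. *)
Lemma branch_sum_distortion (e : R) : 0 < e -> exists C : R, forall w x y,
  branch_sum phi w x - branch_sum phi w y <= e * (size w)%:R + C.
Proof.
move=> e0; have [t /andP[t0 t1] [M M0 hM]] := branch_distortion e0.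
pose K := M / (1 - t); have K0 : 0 <= K by rewrite divr_ge0 ?subr_ge0 ?ltW.
exists K => w x y.
suff h : branch_sum phi w x - branch_sum phi w y <=
    e * (size w)%:R + K * (1 - t ^+ size w).
  by apply: (le_trans h); rewrite lerD2l ler_piMr// gerBl exprn_ge0 ?ltW.
elim: w => [|i w IH] /=; first by rewrite expr0 !subrr !mulr0 addr0.
have := hM (i :: w) x y; rewrite ler_norml => /andP[_ h].
rewrite -natr1 /= in h *.
have KE : K * (1 - t) = M by rewrite divfK// subr_eq0 gt_eqF.
have tn : 0 <= t ^+ size w by rewrite exprn_ge0 ?ltW.
have : M * t ^+ (size w).+1 <= K * (t ^+ size w - t ^+ (size w).+1).
  have -> : K * (t ^+ size w - t ^+ (size w).+1) = M * t ^+ size w.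
    by rewrite exprS -KE; ring.
  by rewrite ler_wpM2l ?(ltW M0)// exprS ler_piMl// ltW.
lra.
Qed.


End distortion.
End transfer_operator.

Section linear_growth.
Context {R : realType}.
Implicit Types (u : nat -> R) (a : R).

Lemma near_inv_le (K e : R) : 0 < e -> \forall n \near \oo, K / n%:R <= e.
Proof.
move=> e0; near=> n.
have n0 : 0 < n%:R :> R by rewrite ltr0n; near: n; exact: nbhs_infty_gt.
rewrite ler_pdivrMr// -ler_pdivrMl//; apply: (le_trans (ler_norm _)).
by near: n; exact: nbhs_infty_ger.
Unshelve. all: by end_near. Qed.

Lemma near_linear_growth_le u a : (forall e, 0 < e -> exists K, forall n, u n <= n%:R * (a + e) + K) ->
  forall e, 0 < e -> \forall n \near \oo, u n / n%:R <= a + e.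
Proof.
move=> ua e e0; have [K hK] := ua _ (divr_gt0 e0 (ltr0n R 2)).
near=> n.
have n0 : 0 < n%:R :> R by rewrite ltr0n; near: n; exact: nbhs_infty_gt.
apply: (@le_trans _ _ (a + e / 2 + K / n%:R)).
  rewrite ler_pdivrMr// mulrDl divfK ?gt_eqF// mulrC; exact: hK.
have : K / n%:R <= e / 2 by near: n; apply: near_inv_le; rewrite divr_gt0.
lra.
Unshelve. all: by end_near. Qed.

Lemma limn_linear_growth_le u a : (forall n, 0 <= u n) ->
  (forall e, 0 < e -> exists K, forall n, u n <= n%:R * (a + e) + K) ->
  limn (fun n => u n / n%:R) <= a.
Proof.
move=> u0 /near_linear_growth_le ua.
apply/ler_addgt0Pr => e e0.
have [cu|du] := pselect (cvgn (fun n => u n / n%:R)).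
  by apply: limr_le => //; exact: ua.
(* Without convergence [limn] returns its default value 0, and 0 <= u n / n <= a + e for some n. *)
rewrite (dvgP du) -[point]/(0 : R).
have [n _ hn] := ua e e0; apply: le_trans (hn n (leqnn _)).
by rewrite divr_ge0.
Qed.

Lemma cvgn_linear_growth u a :
  (forall e, 0 < e -> exists K, forall n, u n <= n%:R * (a + e) + K) ->
  (forall e, 0 < e -> exists K, forall n, n%:R * (a - e) - K <= u n) ->
  u n / n%:R @[n --> \oo] --> a.
Proof.
move=> /near_linear_growth_le ua ub; apply/cvgrPdist_le => e e0.
have /near_linear_growth_le vb : forall e, 0 < e -> exists K, forall n, - u n <= n%:R * (- a + e) + K.
  move=> d /ub[K hK]; exists K => n; rewrite lerNl; apply: le_trans (hK n); lra.
near=> n.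
have h1 : u n / n%:R <= a + e by near: n; exact: ua.
have h2 : - u n / n%:R <= - a + e by near: n; exact: vb.
by rewrite ler_norml; apply/andP; split; rewrite mulNr in h2; lra.
Unshelve. all: by end_near. Qed.

End linear_growth.

(** * Free energy and the growth of the iterates of the transfer operator *)

Section variational_inequality.
Context {R : realType} (alpha : {posnum R}).
Local Notation f := (intermittent_map alpha).
Local Notation T := (unitI R).
Variables (g : R) (phi : T -> R) (nu : probability T R).
Hypotheses (g0 : 0 < g) (phi_holder : holder_continuous g phi)
  (nu_inv : invariant_probability alpha nu).
Local Notation mean h := (\int[nu]_x h x).

Lemma holder_bounded_measurable : bounded_measurable phi.
Proof.
split; first exact: holder_continuous_measurable phi_holder.
exact: holder_bounded (ltW g0) phi_holder.
Qed.

Lemma mean_iter h n : bounded_measurable h -> mean (fun x => h (iter n f x)) = mean h.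
Proof.
move=> bh; apply: (mean_comp (f := iter n f)) => //; first exact: measurable_iter_map.
by move=> A mA; exact: invariant_iter.
Qed.

Lemma mean_birkhoff n : mean (fun x => \sum_(j < n) phi (iter j f x)) = n%:R * mean phi.
Proof.
rewrite (@mean_sum _ _ _ nu _ _ (fun (j : 'I_n) x => phi (iter j f x))); last first.
  move=> j; apply: (bounded_measurable_comp (u := iter j f)).
    exact: measurable_iter_map.
  exact: holder_bounded_measurable.
rewrite (eq_bigr (fun=> mean phi)) ?sumr_const ?card_ord ?mulr_natl//.
by move=> j _; apply: mean_iter; exact: holder_bounded_measurable.
Qed.

Lemma bounded_measurable_simple_rv (V : finType) (X : T -> V) (G : V -> R) :
  simple_rv X -> bounded_measurable (fun x => G (X x)).
Proof.
move=> mX; split; last first.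
  exists (\sum_v `|G v|) => x; rewrite (bigD1 (X x))//= lerDl.
  by apply: sumr_ge0.
apply: (measurability _ (RGenOInfty.measurableE R)) => _ [_ [a ->] <-].
rewrite setTI (_ : _ @^-1` _ = [set x | a < G (X x)]).
  exact: (@simple_rv_pred _ _ _ X (fun v => a < G v)).
by apply/seteqP; split=> x /=; rewrite in_itv/= andbT.
Qed.

(** The distortion estimate replaces the end points f^n y by one base point x, and invariance turns
    the mean of the Birkhoff sum into n int phi. *)
Lemma mean_branch_sum (e : R) : 0 < e -> exists K, forall n x,
  `|\sum_w pmf nu (cylinder alpha n) w * branch_sum alpha phi w x - n%:R * mean phi| <=
  n%:R * e + K.
Proof.
move=> e0; have [K hK] := branch_sum_distortion alpha g0 phi_holder e0.
exists K => n x; have mX := @simple_cylinder _ alpha n.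
rewrite (mean_simple_rv nu (fun w : n.-tuple bool => branch_sum alpha phi w x) mX).
rewrite -mean_birkhoff.
have bG := bounded_measurable_simple_rv (fun w : n.-tuple bool => branch_sum alpha phi w x) mX.
have bS : bounded_measurable (fun x => \sum_(j < n) phi (iter j f x)).
  apply: bounded_measurable_sum => j; apply: (bounded_measurable_comp (u := iter j f)).
    exact: measurable_iter_map.
  exact: holder_bounded_measurable.
rewrite -meanB//; apply: mean_norm_le; first exact: bounded_measurableB.
move=> y; rewrite -branch_sum_word /=.
have h1 := hK (word alpha n y) x (iter n f y).
have h2 := hK (word alpha n y) (iter n f y) x.
rewrite size_word in h1 h2.
by rewrite ler_norml; apply/andP; split; lra.
Qed.

Variables (z C : R) (x0 : T).
Hypotheses (z0 : 0 < z) (C0 : 0 < C)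
  (growth : forall n, iter n (transfer alpha phi) (fun=> 1) x0 <= C * z ^+ n).

(** Gibbs' inequality for the weights e^(S_w) / (C z^n), with S_w the [branch_sum] of w at x0: their
    sum is L^n 1 (x0) / (C z^n) <= 1. *)
Lemma cylinder_entropy_le (e : R) : 0 < e -> exists K, forall n,
  shannon_entropy nu (cylinder alpha n) <= n%:R * (ln z - mean phi + e) + K.
Proof.
move=> e0; have [K hK] := mean_branch_sum e0.
exists (ln C + K) => n; have mX := @simple_cylinder _ alpha n.
pose q (w : n.-tuple bool) : R := expR (branch_sum alpha phi w x0) / (C * z ^+ n).
have Cz : 0 < C * z ^+ n by rewrite mulr_gt0// exprn_gt0.
have qs : \sum_w q w <= 1.
  rewrite -mulr_suml ler_pdivrMr// mul1r; apply: le_trans (growth n).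
  by rewrite -sum_words; apply: ler_sum => w _; rewrite mulr1.
have q_gt0 w : 0 < q w by rewrite divr_gt0// expR_gt0.
apply: le_trans (gibbs_inequality mX (fun w => ltW (q_gt0 w)) (fun w _ => q_gt0 w) qs) _.
rewrite (eq_bigr (fun w => pmf nu (cylinder alpha n) w * branch_sum alpha phi w x0 -
    pmf nu (cylinder alpha n) w * (ln C + n%:R * ln z))); last first.
  move=> w _; rewrite ln_div ?posrE ?expR_gt0// expRK mulrBr lnM ?posrE ?exprn_gt0//.
  by rewrite lnXn// mulr_natl.
rewrite sumrB -mulr_suml (sum_pmf nu mX) mul1r opprB.
have := hK n x0; rewrite ler_norml => /andP[h _].
lra.
Qed.

Lemma partition_entropy_le k (A : 'I_k -> set T) : finite_partition A ->
  partition_entropy nu f A <= ln z - mean phi.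
Proof.
move=> [mA tA cA].
have /choice[a ha] : forall x, exists i, A i x.
  by move=> x; have [i _ Aix] : (\bigcup_i A i) x by [rewrite cA]; exists i.
have aE i : a @^-1` [set i] = A i.
  apply/seteqP; split=> x /=; first by move=> <-.
  by move=> Aix; apply: (tA (a x) i) => //; exists x.
have ma : simple_rv a by move=> i; rewrite aE.
have AE : A = fun i => a @^-1` [set i] by apply/funext => i; rewrite aE.
have refE n : refinement_entropy nu f A n =
    shannon_entropy nu (fun x => [ffun i : 'I_n => a (iter i f x)]).
  by rewrite AE refinement_entropyE.
apply: limn_linear_growth_le => [n|e e0].
  rewrite refE; apply: shannon_entropy_ge0.
  apply: (@simple_rv_ffun _ _ n _ (fun i x => a (iter i f x))) => i v.
  by apply: (measurable_preimage _ (ma v)); exact: measurable_iter_map.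
have e2 : 0 < e / 2 by rewrite divr_gt0.
have [m hm] := refinement_entropy_le_cylinder nu_inv e2 ma.
have [K hK] := cylinder_entropy_le e2.
exists (K + m%:R * (ln z - mean phi + e / 2)) => n; rewrite refE.
apply: (le_trans (hm n)); have := hK (n + m)%N; rewrite natrD; lra.
Qed.

Lemma entropy_le : (entropy nu f <= (ln z - mean phi)%:E)%E.
Proof.
by apply: ge_ereal_sup => _ [k [A [pA ->]]]; rewrite lee_fin; exact: partition_entropy_le.
Qed.

End variational_inequality.

(** * Eigenfunctions of the transfer operator *)

Section banach_limits.
Context {R : realType}.
Implicit Types (u v : nat -> R).

Definition bounded_seq u : Prop := exists M, forall n, `|u n| <= M.

(** Shift invariance is not part of the definition. The functional stands in for compactness: a
    single limit acts at all points at once, so that linear equations and bounds pass to it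
    pointwise. *)
Definition banach_limit (Lim : (nat -> R) -> R) : Prop :=
  [/\ forall u v, bounded_seq u -> bounded_seq v -> Lim (fun n => u n + v n) = Lim u + Lim v,
      forall c u, bounded_seq u -> Lim (fun n => c * u n) = c * Lim u,
      forall u l, u n @[n --> \oo] --> l -> Lim u = l &
      forall u v, bounded_seq u -> bounded_seq v -> (forall n, u n <= v n) -> Lim u <= Lim v].

Lemma banach_limit_exists : exists Lim, banach_limit Lim.
Proof.
have [U [UU ooU]] := @ultraFilterLemma nat (nbhs \oo) _.
have cvU u : bounded_seq u -> cvg (u n @[n --> U]).
  move=> [M hM].
  have [|p [_ pF]] := @segment_compact R (- M) M (u n @[n --> U]) _.
    have E : u @^-1` `[- M, M]%classic = setT.
      by apply/seteqP; split=> // n _; rewrite /= in_itv/= -ler_norml hM.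
    suff : U (u @^-1` `[- M, M]%classic) by [].
    by rewrite E; exact: filterT.
  apply/cvg_ex; exists p => V Vp.
  have [//|nV] := in_ultra_setVsetC (u @^-1` V) UU.
  by have [y [nVy Vy]] := pF (~` V) V nV Vp.
exists (fun u => lim (u n @[n --> U])); split.
- by move=> u v bu bv; apply: limD; exact: cvU.
- by move=> c u bu; apply/cvg_lim => //; apply: cvgM; [exact: cvg_cst|exact: cvU].
- move=> u l ul; apply/cvg_lim => //; apply: cvg_trans ul.
  by move=> V /=; exact: ooU.
- move=> u v bu bv uv; apply: ler_lim; [exact: cvU|exact: cvU|].
  exact: filterE.
Qed.

End banach_limits.

Section real_inequalities.
Context {R : realType}.

Lemma powR_young (t x y : R) : 0 < t < 1 -> 0 <= x -> 0 <= y ->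
  x `^ (1 - t) * y `^ t <= (1 - t) * x + t * y.
Proof.
move=> /andP[t0 t1] x0 y0; have u0 : 0 < 1 - t by rewrite subr_gt0.
have := @conjugate_powR R (x `^ (1 - t)) (y `^ t) (1 - t)^-1 t^-1.
rewrite !powR_ge0 !invr_gt0 !invrK subrK => /(_ isT isT u0 t0 erefl).
rewrite -!powRrM !divff ?gt_eqF// !powRr1// => h.
by rewrite (le_trans h)// !(mulrC _ x) !(mulrC _ y).
Qed.

Lemma expR_dist_le (S a b : R) : a <= S -> b <= S ->
  `|expR a - expR b| <= expR S * `|a - b|.
Proof.
wlog ab : a b / b <= a.
  move=> H; have [/H//|/ltW/H h aS bS] := leP b a.
  by rewrite distrC (distrC a); exact: h.
move=> aS bS; rewrite !ger0_norm ?subr_ge0 ?ler_expR//.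
apply: (@le_trans _ _ (expR a * (a - b))); last by rewrite ler_wpM2r ?subr_ge0 ?ler_expR.
have -> : expR b = expR a * expR (b - a) by rewrite -expRD addrC subrK.
rewrite -{1}[expR a]mulr1 -mulrBr ler_wpM2l ?expR_ge0//.
have := expR_ge1Dx (b - a); lra.
Qed.

End real_inequalities.

(** * Supersolutions, the leading eigenvalue and its eigenfunction *)

Section eigenfunction.
Context {R : realType} (alpha : {posnum R}).
Local Notation f := (intermittent_map alpha).
Local Notation T := (unitI R).
Local Notation ev := (@unitI_val R).
Local Notation branch := (branch alpha).
Local Notation kappa := (ev (breakpoint alpha)).
Variables (g : R) (phi : T -> R).
Hypotheses (g0 : 0 < g) (phi_holder : holder_continuous g phi).
Local Notation L := (transfer alpha phi).
Local Notation dist x y := (`|ev x - ev y| `^ g).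
Implicit Types (x y : T) (h W : T -> R).

Lemma holder_pos_const (psi : T -> R) : holder_continuous g psi ->
  exists2 M, 0 < M & forall x y, `|psi x - psi y| <= M * dist x y.
Proof.
move=> [M0 hM0]; exists (`|M0| + 1); first by rewrite ltr_wpDl.
move=> x y; apply: (le_trans (hM0 x y)); rewrite ler_wpM2r ?powR_ge0//.
by rewrite (le_trans (ler_norm _))// lerDl.
Qed.

Lemma holder_dist_le1 x y : dist x y <= 1.
Proof. by rewrite powR_le1 ?(ltW g0)// normr_ge0 unitI_dist_le1. Qed.

Lemma holder_branch_dist i x y : dist (branch i x) (branch i y) <= dist x y.
Proof. by apply: ge0_ler_powR; rewrite ?nnegrE ?(ltW g0)// branch_dist. Qed.

Definition contraction_rate : R := kappa `^ g.

Lemma contraction_rate_gt0 : 0 < contraction_rate.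
Proof. by rewrite powR_gt0 ?breakpoint_gt0. Qed.

Lemma contraction_rate_lt1 : contraction_rate < 1.
Proof.
have k0 := ltW (breakpoint_gt0 alpha); have k1 := breakpoint_lt1 alpha.
have : kappa `^ g < 1 `^ g by rewrite gt0_ltr_powR ?nnegrE ?ler01.
by rewrite powR1.
Qed.

Lemma holder_branch1_dist x y :
  dist (branch true x) (branch true y) <= contraction_rate * dist x y.
Proof.
rewrite -powRM ?(ltW (breakpoint_gt0 _))//.
by apply: ge0_ler_powR; rewrite ?nnegrE ?(ltW g0)// ?mulr_ge0 ?(ltW (breakpoint_gt0 _))// branch1_dist.
Qed.

Lemma phi_bound : exists2 S, 0 < S & forall x, `|phi x| <= S.
Proof.
have [M hM] := holder_bounded (ltW g0) phi_holder.
exists (`|M| + 1) => [|x]; first by rewrite ltr_wpDl.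
by apply: (le_trans (hM x)); rewrite (le_trans (ler_norm _))// lerDl.
Qed.

Definition supersolution (z : R) h : Prop := exists c C,
  [/\ 0 < c, forall x, c <= h x <= C & forall x, L h x <= z * h x].

Definition supersolvable : set R := [set z | 0 < z /\ exists h, supersolution z h].

Lemma supersolvable_neq0 : supersolvable !=set0.
Proof.
have [S S0 hS] := phi_bound; exists (2 * expR S); split.
  by rewrite mulr_gt0 ?expR_gt0.
exists (fun=> 1), 1, 1; split=> // [x|x]; first by rewrite lexx.
rewrite transferE !mulr1; have H y : expR (phi y) <= expR S.
  by rewrite ler_expR (le_trans (ler_norm _)).
by have := H (branch true x); have := H (branch false x); lra.
Qed.

(** Stands for the spectral radius of L. Every supersolution bounds both this number and, after
    taking the exponential, every free energy from above. *)
Definition eigenvalue : R := inf supersolvable.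

Lemma supersolvable_lbound : has_inf supersolvable.
Proof. by split; [exact: supersolvable_neq0|exists 0 => z [/ltW]]. Qed.

Lemma eigenvalue_le z : supersolvable z -> eigenvalue <= z.
Proof. by move=> hz; apply: ge_inf => //; case: supersolvable_lbound. Qed.

Lemma supersolvable_lt z : eigenvalue < z -> exists2 z', supersolvable z' & z' < z.
Proof.
move=> hz; have [|z' hz' lt] := inf_adherent (eps := z - eigenvalue) _ supersolvable_lbound.
  by rewrite subr_gt0.
by exists z' => //; apply: lt_le_trans lt _; rewrite addrC subrK.
Qed.

Hypothesis eigenvalue_gt : expR (phi (unitI0 R)) < eigenvalue.
Local Notation lam := eigenvalue.

(** A Hoelder seminorm gains [contraction_rate] through branch 1 and nothing through branch 0; for
    that value of t this operator acts on the weights in [weighted_holder_transfer]. *)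
Definition damped (t : R) W x : R :=
  expR (phi (branch false x)) * W (branch false x) +
  t * (expR (phi (branch true x)) * W (branch true x)).

Lemma eigenvalue_gt0 : 0 < lam.
Proof. by apply: lt_trans eigenvalue_gt; exact: expR_gt0. Qed.

(** Along branch 0 alone the growth rate is e^(phi 0). Take W = max (r, x)^b and let y be the image
    of x. If y <= r, then e^(phi y) <= z and W does not increase from x to y. If y > r, then y <= q
    x, and the gain q^b compensates e^S / z. *)
Lemma fixed_point_supersolution z : expR (phi (unitI0 R)) < z ->
  exists W c, [/\ 0 < c, forall x, c <= W x <= 1 &
    forall x, expR (phi (branch false x)) * W (branch false x) <= z * W x].
Proof.
move=> hz; have z0 : 0 < z := lt_trans (expR_gt0 _) hz.
have [S S0 hS] := phi_bound; have [M M0 hM] := holder_pos_const phi_holder.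
have lz : 0 < ln z - phi (unitI0 R).
  by rewrite subr_gt0 -(expRK (phi _)) ltr_ln ?posrE ?expR_gt0.
pose r0 := ((ln z - phi (unitI0 R)) / M) `^ g^-1.
have r00 : 0 < r0 by rewrite powR_gt0// divr_gt0.
pose r : R := Num.min 1 r0.
have r_gt0 : 0 < r by rewrite lt_min ltr01.
have r_le1 : r <= 1 by rewrite ge_min lexx.
have small y : ev y <= r -> expR (phi y) <= z.
  move=> yr; rewrite -[leRHS]lnK ?posrE// ler_expR.
  have := hM y (unitI0 R); rewrite (_ : ev (unitI0 R) = 0)// subr0.
  rewrite (ger0_norm (unitI_ge0 y)) => h.
  have : M * ev y `^ g <= ln z - phi (unitI0 R).
    rewrite mulrC -ler_pdivlMr//.
    have -> : (ln z - phi (unitI0 R)) / M = r0 `^ g.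
      by rewrite -powRrM mulVf ?gt_eqF// powRr1// divr_ge0 ?ltW.
    apply: ge0_ler_powR; rewrite ?nnegrE ?(ltW g0) ?unitI_ge0 ?(ltW r00)//.
    by apply: (le_trans yr); rewrite ge_min lexx orbT.
  by have := le_trans (ler_norm _) h; lra.
pose q := (1 + r `^ alpha%:num)^-1.
have p0 : 0 < r `^ alpha%:num by rewrite powR_gt0.
have q0 : 0 < q by rewrite invr_gt0 ltr_wpDr ?(ltW p0).
have q1 : q < 1 by rewrite invf_lt1 ?ltrDl// ltr_wpDr ?(ltW p0).
have [b hb] : exists b, q ^+ b <= z / expR S.
  have /cvgrPdist_lt /(_ (z / expR S)) : q ^+ n @[n --> \oo] --> (0 : R).
    by apply: cvg_expr; rewrite ger0_norm// ltW.
  rewrite divr_gt0 ?expR_gt0// => /(_ isT)[n _ /(_ n (leqnn _)) /=].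
  rewrite sub0r normrN ger0_norm ?exprn_ge0 ?(ltW q0)// => h.
  by exists n; rewrite ltW.
pose W x := Num.max r (ev x) ^+ b.
exists W, (r ^+ b); split; first exact: exprn_gt0.
  move=> x; have m1 : Num.max r (ev x) <= 1 by rewrite ge_max r_le1 unitI_le1.
  have rm : r <= Num.max r (ev x) by rewrite le_max lexx.
  by rewrite lerXn2r ?nnegrE ?(ltW r_gt0) ?(le_trans (ltW r_gt0))//= exprn_ile1// (le_trans (ltW r_gt0)).
move=> x; set y := branch false x.
have yx : ev y <= ev x by exact: branch0_le.
have W0 u : 0 <= W u by rewrite exprn_ge0// le_max ltW.
have [yr|ry] := leP (ev y) r.
  apply: ler_pM; rewrite ?expR_ge0// ?small//.
  have m0 u : Num.max r (ev u) \in Num.nneg by rewrite nnegrE le_max (ltW r_gt0).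
  by rewrite /W lerXn2r ?m0// ge_max !le_max lexx yx orbT.
rewrite /W !max_r ?(ltW ry)//; last by rewrite (le_trans (ltW ry)).
have y_ge0 : 0 <= ev y by exact: unitI_ge0.
have yq : ev y <= q * ev x.
  have := branchP alpha false x; rewrite addr0 /lift_map => <-.
  rewrite mulrC -mulrA ler_peMr// ler_pdivlMr ?ltr_wpDr ?(ltW p0)// mul1r lerD2l.
  by apply: ge0_ler_powR; rewrite ?nnegrE ?(ltW r_gt0)// ltW.
apply: (@le_trans _ _ (expR S * (q * ev x) ^+ b)).
  apply: ler_pM; rewrite ?expR_ge0 ?exprn_ge0//.
    by rewrite ler_expR (le_trans (ler_norm _)).
  by rewrite lerXn2r ?nnegrE// mulr_ge0 ?unitI_ge0 ?(ltW q0).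
rewrite exprMn mulrA ler_wpM2r ?exprn_ge0 ?unitI_ge0//.
by rewrite mulrC -ler_pdivlMr ?expR_gt0.
Qed.

(* The growth rate of E_0 + t E_1, where E_i is the part of the transfer
   operator along the branch i, is log-convex in log t, hence it is strictly
   smaller than the growth rate [lam] of E_0 + E_1 as soon as t < 1. *)
Lemma damped_supersolution : exists W c C r,
  [/\ 0 < c, 0 < r < 1, forall x, c <= W x <= C &
   forall x, damped contraction_rate W x <= r * lam * W x].
Proof.
pose z0 := (expR (phi (unitI0 R)) + lam) / 2; pose z1 := (z0 + lam) / 2.
have e0 := eigenvalue_gt; have l0 := eigenvalue_gt0; have ep := expR_gt0 (phi (unitI0 R)).
have z0e : expR (phi (unitI0 R)) < z0 by rewrite /z0; lra.
have z01 : z0 < z1 by rewrite /z1 /z0; lra.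
have z1l : z1 < lam by rewrite /z1 /z0; lra.
have z1p : 0 < z1 by apply: lt_trans z01; apply: lt_trans z0e.
have [W0 [c0 [c0p W0b W0z]]] := fixed_point_supersolution z0e.
have [S S0 hS] := phi_bound.
have t0 := contraction_rate_gt0; have t1 := contraction_rate_lt1.
set t := contraction_rate in t0 t1 *.
(* So small that the contribution of branch 1 to W0, multiplied by tau, fits into the gap between z0
   and z1. *)
pose tau := Num.min (t / 2) ((z1 - z0) * c0 / expR S).
have tau0 : 0 < tau.
  by rewrite lt_min !divr_gt0 ?expR_gt0// mulr_gt0// subr_gt0.
have taut : tau < t by rewrite gt_min ltr_pdivrMr// ltr_pMr// ltr1n.
have tauS : tau * expR S <= (z1 - z0) * c0.
  by rewrite -ler_pdivlMr ?expR_gt0// ge_min lexx orbT.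
have W0p x : 0 < W0 x by have /andP[h _] := W0b x; exact: lt_le_trans h.
have W0t x : damped tau W0 x <= z1 * W0 x.
  have /andP[h1 _] := W0b x; have /andP[_ h2] := W0b (branch true x).
  have : tau * (expR (phi (branch true x)) * W0 (branch true x)) <= (z1 - z0) * W0 x.
    apply: (@le_trans _ _ ((z1 - z0) * c0)); last by rewrite ler_wpM2l// subr_ge0 ltW.
    apply: le_trans tauS; rewrite ler_wpM2l ?(ltW tau0)//.
    apply: (@le_trans _ _ (expR S * 1)); last by rewrite mulr1.
    apply: ler_pM; rewrite ?expR_ge0 ?(ltW (W0p _))//.
    by rewrite ler_expR (le_trans (ler_norm _)).
  have := W0z x; rewrite /damped; lra.
(* With t = tau^th, the damping t lies geometrically between 1, where h is a supersolution for some
   z' close to lam, and tau, where W0 is one for z1 < lam. The weight is h^(1 - th) W0^th. *)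
pose th := ln t / ln tau.
have lt0 : ln t < 0 by rewrite ln_lt0// t0.
have ltau0 : ln tau < 0 by rewrite ln_lt0// tau0 (lt_trans taut).
have lttau : ln tau < ln t by rewrite ltr_ln ?posrE.
have th0 : 0 < th by rewrite /th -mulrNN -invrN divr_gt0 ?oppr_gt0.
have th1 : th < 1 by rewrite /th -mulrNN -invrN ltr_pdivrMr ?oppr_gt0// mul1r ltrN2.
have tE : t = tau `^ th.
  by rewrite /powR gt_eqF// /th divfK ?lt_eqF// lnK.
pose u := z1 / lam.
have u0 : 0 < u by rewrite divr_gt0.
have u1 : u < 1 by rewrite ltr_pdivrMr// mul1r.
have lu0 : ln u < 0 by rewrite ln_lt0// u0.
(* This is u^(- th / 2) with u = z1 / lam: for z' < lam s one still has z'^(1 - th) z1^th < lam. *)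
pose s := expR (- (th / 2 * ln u)).
have s1 : 1 < s by rewrite expR_gt1 oppr_gt0 pmulr_rlt0// divr_gt0.
have [|z' [z'p [h [ch [Ch [ch0 hb hz]]]]] z's] := @supersolvable_lt (lam * s).
  by rewrite ltr_pMr.
have lz' : lam <= z' by apply: eigenvalue_le; split=> //; exists h, ch, Ch.
have hp x : 0 < h x by have /andP[k _] := hb x; exact: lt_le_trans k.
pose z := z' `^ (1 - th) * z1 `^ th.
have zp : 0 < z by rewrite mulr_gt0// powR_gt0.
have zl : z < lam.
  have lz's : ln z' < ln lam - th / 2 * ln u.
    rewrite -[X in _ < _ - X]opprK opprK -(expRK (- _)) -lnM ?posrE ?expR_gt0//.
    by rewrite ltr_ln ?posrE// mulr_gt0// expR_gt0.
  have lz1 : ln z1 = ln lam + ln u by rewrite /u ln_div ?posrE// addrC subrK.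
  rewrite -ltr_ln ?posrE// /z lnM ?posrE ?powR_gt0// !ln_powR lz1.
  have th1' : 0 < 1 - th by rewrite subr_gt0.
  have : (1 - th) * ln z' < (1 - th) * (ln lam - th / 2 * ln u) by rewrite ltr_pM2l.
  have : th * ln u < 0 by rewrite pmulr_rlt0.
  have : 0 <= - (th * (th * ln u)).
    by rewrite oppr_ge0 pmulr_rle0// pmulr_rle0// ltW.
  lra.
pose W x := h x `^ (1 - th) * W0 x `^ th.
have Ch0 : 0 < Ch.
  by have /andP[k1 k2] := hb (unitI0 R); apply: lt_le_trans ch0 (le_trans k1 k2).
exists W, (ch `^ (1 - th) * c0 `^ th), (Ch `^ (1 - th) * 1 `^ th), (z / lam); split.
- by rewrite mulr_gt0// powR_gt0.
- by rewrite divr_gt0//= ltr_pdivrMr// mul1r.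
- have th1' : 0 <= 1 - th by rewrite subr_ge0 ltW.
  move=> x; have /andP[k1 k2] := hb x; have /andP[k3 k4] := W0b x.
  by apply/andP; split; apply: ler_pM; rewrite ?powR_ge0//;
    apply: ge0_ler_powR; rewrite ?nnegrE ?(ltW th0) ?(ltW ch0) ?(ltW (hp _))
      ?(ltW Ch0) ?(ltW c0p) ?(ltW (W0p _)).
move=> x; rewrite divfK ?gt_eqF//.
pose A := z' * h x; pose B := z1 * W0 x.
have Ap : 0 < A by rewrite mulr_gt0.
have Bp : 0 < B by rewrite mulr_gt0.
have zW : z * W x = A `^ (1 - th) * B `^ th.
  rewrite /A /B (powRM _ (ltW z'p) (ltW (hp x))) (powRM _ (ltW z1p) (ltW (W0p x))).
  by rewrite /z /W mulrACA.
have ABp : 0 < A `^ (1 - th) * B `^ th by rewrite mulr_gt0// powR_gt0.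
(* Young's inequality for one branch. Summed over both branches, the two terms on the right are at
   most 1 - th and th by the supersolution inequalities of h and W0. *)
have term (y : T) (e sg : R) : 0 < e -> 0 < sg ->
    sg `^ th * (e * W y) <= A `^ (1 - th) * B `^ th *
      ((1 - th) * (e * h y / A) + th * (sg * (e * W0 y) / B)).
  move=> e_gt0 sgp; set X := e * h y / A; set Y := sg * (e * W0 y) / B.
  have X0 : 0 <= X by apply: ltW; rewrite /X divr_gt0// mulr_gt0.
  have Y0 : 0 <= Y by apply: ltW; rewrite /Y divr_gt0// !mulr_gt0.
  have -> : sg `^ th * (e * W y) = A `^ (1 - th) * B `^ th * (X `^ (1 - th) * Y `^ th).
    rewrite mulrACA -(powRM _ (ltW Ap) X0) -(powRM _ (ltW Bp) Y0).
    rewrite [A * _]mulrC /X divfK ?gt_eqF// [B * _]mulrC /Y divfK ?gt_eqF//.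
    have eW0 : 0 <= e * W0 y by rewrite mulr_ge0 ?(ltW e_gt0) ?(ltW (W0p _)).
    rewrite (powRM _ (ltW e_gt0) (ltW (hp y))) (powRM _ (ltW sgp) eW0).
    rewrite (powRM _ (ltW e_gt0) (ltW (W0p y))) /W.
    have eE : e `^ (1 - th) * e `^ th = e.
      by rewrite -powRD ?subrK ?powRr1 ?(ltW e_gt0)// gt_eqF// implybT.
    by rewrite -{1}eE; ring.
  by rewrite ler_wpM2l ?(ltW ABp)// powR_young// th0.
have := term (branch false x) _ 1 (expR_gt0 (phi (branch false x))) ltr01.
rewrite powR1 /= !mul1r => b0.
have b1 := term (branch true x) _ tau (expR_gt0 (phi (branch true x))) tau0.
rewrite zW /damped tE; apply: le_trans (lerD b0 b1) _.
rewrite -mulrDr ler_piMr ?(ltW ABp)//.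
have h1 : L h x / A <= 1 by rewrite ler_pdivrMr// mul1r; exact: hz.
have h2 : damped tau W0 x / B <= 1 by rewrite ler_pdivrMr// mul1r; exact: W0t.
rewrite transferE mulrDl in h1; rewrite /damped mulrDl in h2.
have : (1 - th) * (expR (phi (branch true x)) * h (branch true x) / A +
  expR (phi (branch false x)) * h (branch false x) / A) <= (1 - th) * 1.
  by rewrite ler_wpM2l// subr_ge0 ltW.
have : th * (expR (phi (branch false x)) * W0 (branch false x) / B +
   tau * (expR (phi (branch true x)) * W0 (branch true x)) / B) <= th * 1.
  by rewrite ler_wpM2l// ltW.
lra.
Qed.

Definition weighted_holder W (A : R) (F : T -> R) : Prop :=
  forall x y, `|F x - F y| <= A * W x * dist x y.

(** A Lasota-Yorke inequality. The differences of F pass through branch 1 with the factor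
    [contraction_rate], which replaces W by its damped image; the variation of e^phi on the two
    branches costs the term with N. *)
Lemma weighted_holder_transfer W c r A N F S M :
  0 < c -> (forall x, c <= W x) ->
  (forall x, damped contraction_rate W x <= r * lam * W x) ->
  (forall x, `|phi x| <= S) -> 0 < M -> (forall x y, `|phi x - phi y| <= M * dist x y) ->
  0 <= A -> (forall x, `|F x| <= N) -> weighted_holder W A F ->
  weighted_holder W (r * lam * A + 2 * (expR S * M / c) * N) (L F).
Proof.
move=> c0 Wc Wr hS M0 hM A0 FN FA x y.
have W0 u : 0 < W u by exact: lt_le_trans (Wc u).
have N0 : 0 <= N by apply: le_trans (FN x).
have d0 : 0 <= dist x y by exact: powR_ge0.
have phiS u : phi u <= S by rewrite (le_trans (ler_norm _)).
have key i (k : R) : dist (branch i x) (branch i y) <= k * dist x y ->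
    `|expR (phi (branch i x)) * F (branch i x) - expR (phi (branch i y)) * F (branch i y)| <=
    A * (k * (expR (phi (branch i x)) * W (branch i x))) * dist x y +
    expR S * M * N * dist x y.
  move=> hk.
  have -> : expR (phi (branch i x)) * F (branch i x) - expR (phi (branch i y)) * F (branch i y) =
    expR (phi (branch i x)) * (F (branch i x) - F (branch i y)) +
    (expR (phi (branch i x)) - expR (phi (branch i y))) * F (branch i y) by ring.
  apply: (le_trans (ler_normD _ _)); rewrite !normrM (ger0_norm (expR_ge0 _)); apply: lerD.
    rewrite (_ : A * _ * _ = expR (phi (branch i x)) * (A * W (branch i x) * (k * dist x y))); last by ring.
    rewrite ler_wpM2l ?expR_ge0//; apply: (le_trans (FA _ _)).
    by rewrite ler_wpM2l// mulr_ge0// ltW.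
  rewrite (_ : expR S * M * N * dist x y = expR S * (M * dist x y) * N); last by ring.
  apply: ler_pM => //; apply: (le_trans (expR_dist_le (phiS _) (phiS _))).
  rewrite ler_wpM2l ?expR_ge0//; apply: (le_trans (hM _ _)).
  by rewrite ler_wpM2l ?(ltW M0)// holder_branch_dist.
have k0 := key false 1; rewrite !mul1r in k0.
have {}k0 := k0 (holder_branch_dist false x y).
have k1 := key true contraction_rate (holder_branch1_dist x y).
rewrite !transferE opprD addrACA.
apply: (le_trans (ler_normD _ _)); apply: (le_trans (lerD k1 k0)).
have h1 : A * damped contraction_rate W x * dist x y <= A * (r * lam * W x) * dist x y.
  by rewrite ler_wpM2r// ler_wpM2l.
have h2 : expR S * M * N * dist x y <= expR S * M / c * N * W x * dist x y.
  rewrite ler_wpM2r// -[expR S * M / c * N * W x]mulrA [_ / c]mulrC -!mulrA ler_pdivlMl// mulrC.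
  by rewrite !mulrA -!mulrA ler_wpM2l ?expR_ge0// ler_wpM2l ?(ltW M0)// ler_wpM2l.
rewrite /damped in h1; lra.
Qed.

(** * The series of z^-n L^n 1 for z > lam *)

Section resolvent.
Variable z : R.
Hypothesis z_gt : lam < z.

Fixpoint resolvent_seq (n : nat) : T -> R :=
  if n is m.+1 then fun x => 1 + z^-1 * L (resolvent_seq m) x else fun=> 1.

Let z_gt0 : 0 < z. Proof. exact: lt_trans eigenvalue_gt0 z_gt. Qed.

Lemma resolvent_seq_ge1 n x : 1 <= resolvent_seq n x.
Proof.
elim: n x => // n IH x /=; rewrite lerDl mulr_ge0 ?invr_ge0 ?(ltW z_gt0)//.
apply: sumr_ge0 => i _; rewrite mulr_ge0 ?expR_ge0//.
by apply: le_trans (IH _).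
Qed.

Lemma resolvent_seq_nd n x : resolvent_seq n x <= resolvent_seq n.+1 x.
Proof.
elim: n x => [|n IH] x; first exact: (resolvent_seq_ge1 1).
rewrite [leLHS]/= [leRHS]/= lerD2l ler_wpM2l ?invr_ge0 ?(ltW z_gt0)//.
exact: transfer_le.
Qed.

(** For a supersolution h at some z' < z, the function K h majorizes every term of the recursion,
    since 1 + (z' / z) K h <= K h when K h (1 - z' / z) >= 1. *)
Lemma resolvent_seq_bounded : exists B, forall n x, resolvent_seq n x <= B.
Proof.
have [z' [z'0 [h [c [C [c0 hb hz]]]]] z'z] := supersolvable_lt z_gt.
have q1 : z' / z < 1 by rewrite ltr_pdivrMr// mul1r.
have K0 : 0 < (c * (1 - z' / z))^-1 by rewrite invr_gt0 mulr_gt0// subr_gt0.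
set K := _^-1 in K0.
have KE : K * c * (1 - z' / z) = 1.
  by rewrite -mulrA mulVf// gt_eqF// mulr_gt0// subr_gt0.
have hK n x : resolvent_seq n x <= K * h x.
  elim: n x => [|n IH] x /=.
    rewrite -KE -mulrA ler_pM2l//.
    have /andP[ch _] := hb x; apply: le_trans ch.
    by rewrite ler_piMr ?(ltW c0)// gerBl divr_ge0 ?ltW.
  apply: (@le_trans _ _ (1 + z^-1 * (K * (z' * h x)))).
    rewrite lerD2l ler_wpM2l ?invr_ge0 ?(ltW z_gt0)//.
    apply: (le_trans (@transfer_le _ alpha phi _ (fun y => K * h y) IH x)); rewrite transferZ.
    by rewrite ler_wpM2l ?(ltW K0).
  have /andP[ch _] := hb x.
  have : 1 <= K * h x * (1 - z' / z).
    by rewrite -[leLHS]KE ler_wpM2r ?subr_ge0 ?(ltW q1)// ler_wpM2l// ltW.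
  rewrite mulrBr mulr1 => h1.
  have -> : z^-1 * (K * (z' * h x)) = K * h x * (z' / z) by ring.
  lra.
exists (K * C) => n x; apply: (le_trans (hK n x)).
by rewrite ler_wpM2l ?(ltW K0)//; case/andP: (hb x).
Qed.

Definition resolvent (x : T) : R := sup (range (resolvent_seq ^~ x)).

Lemma resolvent_cvg x : resolvent_seq n x @[n --> \oo] --> resolvent x.
Proof.
apply: nondecreasing_cvgn; first by apply/nondecreasing_seqP => n; exact: resolvent_seq_nd.
have [B hB] := resolvent_seq_bounded; exists B => _ [n _ <-]; exact: hB.
Qed.

Lemma resolvent_ge_seq n x : resolvent_seq n x <= resolvent x.
Proof.
apply: ub_le_sup; last by exists n.
have [B hB] := resolvent_seq_bounded; exists B => _ [m _ <-]; exact: hB.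
Qed.

Lemma resolventE x : resolvent x = 1 + z^-1 * L resolvent x.
Proof.
have h1 : resolvent_seq n.+1 x @[n --> \oo] --> resolvent x.
  by rewrite (cvg_shiftS (fun n => resolvent_seq n x)); exact: resolvent_cvg.
apply: (cvg_unique _ h1) => //=; apply: cvgD; first exact: cvg_cst.
apply: cvgM; first exact: cvg_cst.
rewrite (_ : (fun n => _) = fun n => expR (phi (branch true x)) * resolvent_seq n (branch true x) +
  expR (phi (branch false x)) * resolvent_seq n (branch false x)); last first.
  by apply/funext => n; rewrite transferE.
rewrite transferE; apply: cvgD; apply: cvgM; [exact: cvg_cst|exact: resolvent_cvg|exact: cvg_cst|exact: resolvent_cvg].
Qed.

Lemma resolvent_bounded : exists B, forall x, resolvent x <= B.
Proof.
have [B hB] := resolvent_seq_bounded; exists B => x.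
by apply: ge_sup; [exists (resolvent_seq 0 x), 0%N|move=> _ [n _ <-]].
Qed.

Lemma resolvent_ge1 x : 1 <= resolvent x.
Proof. exact: le_trans (resolvent_ge_seq 0 x). Qed.

Definition resolvent_sup : R := sup (range resolvent).

Lemma resolvent_le_sup x : resolvent x <= resolvent_sup.
Proof.
have [B hB] := resolvent_bounded.
by apply: ub_le_sup; [exists B => _ [y _ <-]|exists x].
Qed.

Lemma resolvent_sup_ge1 : 1 <= resolvent_sup.
Proof. exact: le_trans (resolvent_ge1 (unitI0 R)) (resolvent_le_sup _). Qed.

Lemma resolvent_sup_approx : exists x, resolvent_sup / 2 <= resolvent x.
Proof.
have s1 := resolvent_sup_ge1.
have hs : has_sup (range resolvent).
  split; first by exists (resolvent (unitI0 R)), (unitI0 R).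
  by have [B hB] := resolvent_bounded; exists B => _ [y _ <-].
have [|_ [x _ <-] h] := sup_adherent (eps := resolvent_sup / 2) _ hs.
  by rewrite divr_gt0// (lt_le_trans ltr01).
by exists x; rewrite -/resolvent_sup in h; lra.
Qed.

(** Let B be the supremum of the resolvent Q. Then L Q = z (Q - 1) <= z (1 - 1 / B) Q, so that Q is
    itself a supersolution. Consequently B tends to infinity as z decreases to lam. *)
Lemma resolvent_blowup : lam <= z * (1 - resolvent_sup^-1).
Proof.
have s1 := resolvent_sup_ge1; have s0 : 0 < resolvent_sup by apply: lt_le_trans s1.
have LE x : L resolvent x = z * (resolvent x - 1).
  by rewrite [in RHS]resolventE addrC addKr mulrA divff ?gt_eqF// mul1r.
have Lz x : L resolvent x <= z * (1 - resolvent_sup^-1) * resolvent x.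
  rewrite LE -mulrA ler_wpM2l ?(ltW z_gt0)// mulrBl mul1r lerB//.
  by rewrite mulrC ler_pdivrMr// mul1r resolvent_le_sup.
have zp : 0 < z * (1 - resolvent_sup^-1).
  have h := Lz (unitI0 R).
  have : 0 < L resolvent (unitI0 R).
    have rp u : 0 < resolvent u by apply: lt_le_trans (resolvent_ge1 u).
    by rewrite transferE addr_gt0// mulr_gt0 ?expR_gt0.
  move=> /lt_le_trans /(_ h); rewrite pmulr_lgt0//.
  exact: lt_le_trans (resolvent_ge1 _).
apply: eigenvalue_le; split=> //.
exists resolvent, 1, resolvent_sup; split=> // x.
by rewrite resolvent_ge1 resolvent_le_sup.
Qed.

(** The constant A is the solution of r lam A + K B = lam A, with B the supremum of the resolvent,
    and is preserved by the recursion. It depends on z only through B, which disappears after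
    normalization. *)
Lemma resolvent_holder W c C r S M :
  0 < c -> (forall x, c <= W x <= C) -> 0 < r < 1 ->
  (forall x, damped contraction_rate W x <= r * lam * W x) ->
  (forall x, `|phi x| <= S) -> 0 < M -> (forall x y, `|phi x - phi y| <= M * dist x y) ->
  forall x y, `|resolvent x - resolvent y| <=
    2 * (expR S * M / c) / (lam * (1 - r)) * C * resolvent_sup * dist x y.
Proof.
move=> c0 Wb /andP[r0 r1] Wr hS M0 hM.
have l0 := eigenvalue_gt0; have s0 : 0 < resolvent_sup := lt_le_trans ltr01 resolvent_sup_ge1.
set K := 2 * (expR S * M / c).
have K0 : 0 < K by rewrite /K mulr_gt0// divr_gt0// mulr_gt0// expR_gt0.
have lr0 : 0 < lam * (1 - r) by rewrite mulr_gt0// subr_gt0.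
pose A := K / (lam * (1 - r)) * resolvent_sup.
have A0 : 0 <= A by rewrite mulr_ge0 ?divr_ge0 ?(ltW K0) ?(ltW lr0) ?(ltW s0).
have Wc x : c <= W x by case/andP: (Wb x).
have W0 x : 0 < W x by exact: lt_le_trans (Wc x).
have hA n : weighted_holder W A (resolvent_seq n).
  elim: n => [|n IH] x y.
    by rewrite /= subrr normr0 mulr_ge0 ?powR_ge0// mulr_ge0// ltW.
  have hN u : `|resolvent_seq n u| <= resolvent_sup.
    rewrite ger0_norm; last exact: le_trans ler01 (resolvent_seq_ge1 n u).
    exact: le_trans (resolvent_ge_seq n u) (resolvent_le_sup u).
  have := weighted_holder_transfer c0 Wc Wr hS M0 hM A0 hN IH x y.
  rewrite -/K => h /=.
  rewrite opprD addrACA subrr add0r -mulrBr normrM ger0_norm ?invr_ge0 ?(ltW z_gt0)//.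
  rewrite ler_pdivrMl//; apply: (le_trans h).
  rewrite (_ : z * (A * W x * dist x y) = z * A * W x * dist x y); last by ring.
  rewrite ler_wpM2r ?powR_ge0// ler_wpM2r ?(ltW (W0 _))//.
  have AE : A * (lam * (1 - r)) = K * resolvent_sup.
    by rewrite /A mulrAC divfK// gt_eqF.
  have : lam * A <= z * A by rewrite ler_wpM2r// ltW.
  lra.
move=> x y.
have h1 : `|resolvent_seq n x - resolvent_seq n y| @[n --> \oo] --> `|resolvent x - resolvent y|.
  by apply: cvg_norm; apply: cvgB; exact: resolvent_cvg.
rewrite -(cvg_lim (@Rhausdorff R) h1); apply: limr_le; first exact: cvgP h1.
apply: nearW => n; apply: (le_trans (hA n x y)); rewrite ler_wpM2r ?powR_ge0//.
rewrite -[leRHS]mulrA [C * _]mulrC mulrA -/A ler_wpM2l//.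
by case/andP: (Wb x).
Qed.

End resolvent.

(** A Harnack inequality: at each step keep one branch in the bound of the resolvent Q from below by
    z^-1 L Q, where e^phi >= e^(- S). *)
Lemma iter_resolvent_lower z (z_gt : lam < z) S n x w :
  (forall x, `|phi x| <= S) -> size w = n ->
  (z * expR S) ^- n * resolvent z (wbranch alpha w x) <= resolvent z x.
Proof.
move=> hS <-; have z0 : 0 < z := lt_trans eigenvalue_gt0 z_gt.
have zS : 0 < z * expR S by rewrite mulr_gt0 ?expR_gt0.
have step i u : (z * expR S)^-1 * resolvent z (branch i u) <= resolvent z u.
  have r0 v : 0 < resolvent z v by apply: lt_le_trans (resolvent_ge1 z_gt v).
  have h v : (expR S)^-1 * resolvent z v <= expR (phi v) * resolvent z v.
    rewrite ler_wpM2r ?(ltW (r0 v))// -expRN ler_expR lerNl.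
    by apply: le_trans (hS v); rewrite -normrN ler_norm.
  rewrite [leRHS](resolventE z_gt) transferE invfM -mulrA.
  apply: (@le_trans _ _ (z^-1 * (expR (phi (branch true u)) * resolvent z (branch true u) +
    expR (phi (branch false u)) * resolvent z (branch false u)))); last by rewrite lerDr.
  rewrite ler_wpM2l ?invr_ge0 ?(ltW z0)//; apply: (le_trans (h _)).
  by case: i; rewrite ?lerDl ?lerDr mulr_ge0 ?expR_ge0 ?(ltW (r0 _)).
elim: w x => [|i w IH] x /=; first by rewrite expr0 invr1 mul1r.
apply: le_trans (IH x); rewrite exprSr invfM -mulrA ler_wpM2l ?step//.
by rewrite invr_ge0 exprn_ge0 ?(ltW zS).
Qed.

(* A limit of the normalized resolvents sum_n z^-n L^n 1 as z decreases to lam,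
   which are uniformly Hoelder for the weight given by [damped_supersolution]. *)
Theorem eigenfunction_exists : exists h c, [/\ 0 < c, forall x, c <= h x <= 1,
  holder_continuous g h & forall x, L h x = lam * h x].
Proof.
have [W [cW [CW [r [cW0 hr Wb Wr]]]]] := damped_supersolution.
have [S S0 hS] := phi_bound; have [M M0 hM] := holder_pos_const phi_holder.
have l0 := eigenvalue_gt0.
pose K := 2 * (expR S * M / cW) / (lam * (1 - r)) * CW.
pose z (j : nat) : R := lam * (1 + j.+1%:R^-1).
have zl j : lam < z j by rewrite ltr_pMr// ltrDl invr_gt0 ltr0n.
have z2 j : z j <= lam * 2.
  have : j.+1%:R^-1 <= 1 :> R by rewrite invf_le1 ?ltr0n ?ler1n.
  move=> j1; rewrite /z ler_pM2l//; apply: (@le_trans _ _ (1 + 1)); last by lra.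
  by rewrite lerD2l.
have z0 j : 0 < z j := lt_trans l0 (zl j).
pose B j := resolvent_sup (z j).
have B1 j : 1 <= B j := resolvent_sup_ge1 (zl j).
have B0 j : 0 < B j := lt_le_trans ltr01 (B1 j).
pose h j x := (B j)^-1 * resolvent (z j) x.
have hle1 j x : h j x <= 1 by rewrite ler_pdivrMl// mulr1 resolvent_le_sup.
have hhold j x y : `|h j x - h j y| <= K * dist x y.
  rewrite -mulrBr normrM ger0_norm ?invr_ge0 ?(ltW (B0 j))// ler_pdivrMl//.
  apply: (le_trans (resolvent_holder (zl j) cW0 Wb hr Wr hS M0 hM x y)).
  by rewrite -/(B j) -/K mulrA [B j * K]mulrC.
have K0 : 0 <= K.
  have := hhold 0%N (unitI0 R) (unitI1 : T).
  move=> /(le_trans (normr_ge0 _)); rewrite pmulr_lge0// powR_gt0//.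
  by rewrite unitI_dist_gt0// unitI0_neq1.
(* After n branches the image of the interval is so short that every normalized resolvent varies on
   it by at most 1/4. *)
have [n hn] : exists n, forall w x y, size w = n ->
    K * dist (wbranch alpha w x) (wbranch alpha w y) <= 4^-1.
  pose e := (8^-1 / (K + 1)) `^ g^-1.
  have K1 : 0 < K + 1 by rewrite ltr_wpDl.
  have e0 : 0 < e by rewrite powR_gt0// divr_gt0.
  have eg : e `^ g = 8^-1 / (K + 1) by rewrite -powRrM mulVf ?gt_eqF// powRr1// divr_ge0 ?(ltW K1).
  have [q /andP[q0 q1] hq] := wbranch_shrink alpha e0.
  have /cvgrPdist_lt /(_ e e0) : q ^+ n @[n --> \oo] --> (0 : R).
    by apply: cvg_expr; rewrite ger0_norm// ltW.
  move=> [n _ /(_ n (leqnn _)) /=].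
  rewrite sub0r normrN ger0_norm ?exprn_ge0 ?(ltW q0)// => qe.
  exists n => w x y sw.
  have : dist (wbranch alpha w x) (wbranch alpha w y) <= 8^-1 / (K + 1).
    rewrite -eg; apply: ge0_ler_powR; rewrite ?nnegrE ?(ltW g0) ?(ltW e0)//.
    by apply: (le_trans (hq w x y)); rewrite sw ge_max lexx ltW.
  move=> h1; apply: (@le_trans _ _ ((K + 1) * (8^-1 / (K + 1)))).
    by apply: ler_pM; rewrite ?powR_ge0// lerDl.
  rewrite mulrC divfK ?gt_eqF//; lra.
pose c := (lam * 2 * expR S) ^- n * 4^-1.
have c0 : 0 < c by rewrite mulr_gt0// invr_gt0 exprn_gt0// !mulr_gt0 ?expR_gt0.
have hc j x : c <= h j x.
  (* The normalized resolvent is at least 1/2 at x1, hence at least 1/4 at every [wbranch w x] for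
     the word w of x1, and the Harnack inequality carries this to x. *)
  have [x1 hx1] := resolvent_sup_approx (zl j).
  have hh : 2^-1 <= h j x1 by rewrite ler_pdivlMl// mulrC mulrC.
  pose w := word alpha n x1.
  have sw : size w = n by exact: size_word.
  have d1 : 4^-1 <= h j (wbranch alpha w x).
    have := hhold j (wbranch alpha w x) x1.
    have := hn w x (iter n f x1) sw; rewrite {2}/w wbranch_word => k1 k2.
    have := le_trans k2 k1; rewrite ler_norml => /andP[k3 _].
    lra.
  have := iter_resolvent_lower (zl j) x hS sw.
  rewrite -(ler_pM2l (_ : 0 < (B j)^-1)) ?invr_gt0// -/(h j x) mulrCA => h1.
  apply: le_trans h1; rewrite /c; apply: ler_pM => //.
    by rewrite invr_ge0 exprn_ge0// !mulr_ge0 ?expR_ge0// ltW.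
  rewrite lef_pV2 ?posrE ?exprn_gt0 ?mulr_gt0 ?expR_gt0//.
  by apply: lerXn2r; rewrite ?nnegrE ?mulr_ge0 ?expR_ge0 ?(ltW (z0 _)) ?(ltW l0)// ler_wpM2r ?expR_ge0.
have [Lim [LimD LimM Limc Limle]] := @banach_limit_exists R.
have bh x : bounded_seq (h ^~ x).
  by exists 1 => j; rewrite ger0_norm ?hle1// (le_trans (ltW c0)).
have bcst k : bounded_seq (fun=> k : R) by exists `|k|.
have LimC k : Lim (fun=> k) = k by apply: Limc; exact: cvg_cst.
have bM (k : R) (u : nat -> R) : bounded_seq u -> bounded_seq (fun n => k * u n).
  by move=> [N hN]; exists (`|k| * N) => m; rewrite normrM ler_wpM2l.
have bD (u v : nat -> R) : bounded_seq u -> bounded_seq v -> bounded_seq (fun n => u n + v n).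
  move=> [N hN] [N' hN']; exists (N + N') => m.
  by rewrite (le_trans (ler_normD _ _))// lerD.
pose H x := Lim (h ^~ x).
exists H, c; split=> //.
- move=> x; apply/andP; split.
    by rewrite -[leLHS]LimC; apply: Limle => // j.
  by rewrite -[leRHS]LimC; apply: Limle => // j.
- exists K => x y.
  have one u v : H u - H v <= K * dist u v.
    rewrite lerBlDr -[K * dist u v]LimC -LimD//; apply: Limle => //; first exact: bD.
    move=> j; have := hhold j u v; rewrite ler_norml => /andP[_]; lra.
  by rewrite ler_norml; have := one x y; have := one y x; rewrite distrC => ? ?; apply/andP; split; lra.
- move=> x; apply/eqP; rewrite -subr_eq0; apply/eqP.
  have -> : L H x - lam * H x = Lim (fun j => L (h j) x + - lam * h j x).
    rewrite LimD; [|by under eq_fun do rewrite transferE; apply: bD; apply: bM|exact: bM].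
    have -> : Lim (fun j => - lam * h j x) = - (lam * H x) by rewrite LimM// mulNr.
    congr (_ + _); rewrite transferE.
    under [in RHS]eq_fun do rewrite transferE.
    by rewrite LimD; [|exact: bM|exact: bM]; rewrite !LimM.
  (* Here z j tends to lam and 1 / B j to 0, which leaves the eigenvalue equation. *)
  have Lh j : L (h j) x = z j * (h j x - (B j)^-1).
    rewrite /h transferZ mulrBr.
    have -> : L (resolvent (z j)) x = z j * (resolvent (z j) x - 1).
      by rewrite [in RHS](resolventE (zl j)) addrC addKr mulrA divff ?gt_eqF// mul1r.
    by ring.
  apply: Limc.
  have Bz j : (B j)^-1 <= 1 - lam / z j.
    have := resolvent_blowup (zl j); rewrite -/(B j) => k.
    rewrite lerBrDr addrC -lerBrDr ler_pdivrMr//.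
    by rewrite mulrC.
  have zlim : z j @[j --> \oo] --> lam.
    have lE : lam = lam * (1 + 0) by rewrite addr0 mulr1.
    rewrite [X in _ --> X]lE.
    apply: cvgM; first exact: cvg_cst.
    apply: cvgD; first exact: cvg_cst.
    by have := @cvg_harmonic R.
  have Blim : (B j)^-1 @[j --> \oo] --> (0 : R).
    apply: (@squeeze_cvgr _ _ _ _ (fun=> 0 : R) (fun j => 1 - lam / z j)).
    - by apply: nearW => j; rewrite invr_ge0 (ltW (B0 j)) Bz.
    - exact: cvg_cst.
    - have lE : 0 = 1 - lam / lam by rewrite divff ?subrr// gt_eqF.
      rewrite [X in _ --> X]lE.
      apply: cvgB; first exact: cvg_cst.
      by apply: cvgM; [exact: cvg_cst|apply: cvgV => //; rewrite gt_eqF].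
  apply: norm_cvg0.
  apply: (@squeeze_cvgr _ _ _ _ (fun=> 0 : R) (fun j => (z j - lam) + z j * (B j)^-1)).
  + apply: nearW => j; rewrite normr_ge0/= Lh.
    have -> : z j * (h j x - (B j)^-1) + - lam * h j x = (z j - lam) * h j x - z j * (B j)^-1 by ring.
    apply: (le_trans (ler_normB _ _)); apply: lerD.
      rewrite [leLHS]normrM (ger0_norm (_ : 0 <= z j - lam)) ?subr_ge0 ?(ltW (zl j))//.
      rewrite ler_piMr ?subr_ge0 ?(ltW (zl j))// ger0_norm ?hle1//.
      exact: le_trans (ltW c0) (hc j x).
    by rewrite ger0_norm// mulr_ge0 ?(ltW (z0 j))// invr_ge0 (ltW (B0 j)).
  + exact: cvg_cst.
  + have lE : 0 = (lam - lam) + lam * 0 by rewrite subrr mulr0 addr0.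
    rewrite [X in _ --> X]lE.
    apply: cvgD; first by apply: cvgB; [exact: zlim|exact: cvg_cst].
    by apply: cvgM.
Qed.

End eigenfunction.

(** * Contraction of the normalized operator *)

Section markov_operator.
Context {R : realType} (alpha : {posnum R}).
Local Notation T := (unitI R).
Local Notation ev := (@unitI_val R).
Local Notation branch := (branch alpha).
Variables (g : R) (p : bool -> T -> R) (pmin D : R).
Hypotheses (g0 : 0 < g) (pmin0 : 0 < pmin) (D0 : 0 < D).
Hypotheses (p_ge : forall i x, pmin <= p i x)
  (p_sum : forall x, p true x + p false x = 1)
  (p_holder : forall x y, `|p true x - p true y| <= D * `|ev x - ev y| `^ g).
Local Notation dist x y := (`|ev x - ev y| `^ g).
Local Notation theta := (contraction_rate alpha g).
Implicit Types (F : T -> R).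

Definition markov F (x : T) : R :=
  p true x * F (branch true x) + p false x * F (branch false x).

(** For two measures of equal mass w, the difference of the integrals is an average of the
    differences a_i - b_j over the product coupling. *)
Lemma coupling_bound (w O u1 u0 v1 v0 a1 a0 b1 b0 : R) :
  0 <= u1 -> 0 <= u0 -> 0 <= v1 -> 0 <= v0 -> u1 + u0 = w -> v1 + v0 = w ->
  `|a1 - b1| <= O -> `|a1 - b0| <= O -> `|a0 - b1| <= O -> `|a0 - b0| <= O ->
  `|u1 * a1 + u0 * a0 - (v1 * b1 + v0 * b0)| <= w * O.
Proof.
move=> u1p u0p v1p v0p uw vw h11 h10 h01 h00.
have w0 : 0 <= w by rewrite -uw addr_ge0.
have [w_gt0|wle] := ltP 0 w; last first.
  have wE : w = 0 by apply/eqP; rewrite eq_le wle w0.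
  have [-> -> -> ->] : [/\ u1 = 0, u0 = 0, v1 = 0 & v0 = 0] by split; lra.
  by rewrite !mul0r !addr0 subrr normr0 wE mul0r.
have E : w * (u1 * a1 + u0 * a0 - (v1 * b1 + v0 * b0)) =
    u1 * v1 * (a1 - b1) + u1 * v0 * (a1 - b0) + u0 * v1 * (a0 - b1) + u0 * v0 * (a0 - b0).
  have -> : v0 = w - v1 by lra.
  have -> : u0 = w - u1 by lra.
  by ring.
rewrite -(ler_pM2l w_gt0) -{1}(ger0_norm w0) -normrM E.
have t (k b : R) : 0 <= k -> `|b| <= O -> `|k * b| <= k * O.
  by move=> k0 bO; rewrite normrM (ger0_norm k0) ler_wpM2l.
apply: (@le_trans _ _ (u1 * v1 * O + u1 * v0 * O + u0 * v1 * O + u0 * v0 * O)).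
  do 3?[apply: (le_trans (ler_normD _ _)); apply: lerD].
  - by apply: t; rewrite ?mulr_ge0.
  - by apply: t; rewrite ?mulr_ge0.
  - by apply: t; rewrite ?mulr_ge0.
  - by apply: t; rewrite ?mulr_ge0.
have -> : v0 = w - v1 by lra.
have -> : u0 = w - u1 by lra.
by rewrite le_eqVlt; apply/predU1P; left; ring.
Qed.

Lemma p_ge0 i x : 0 <= p i x.
Proof. exact: le_trans (ltW pmin0) (p_ge i x). Qed.

Lemma pmin_lt1 : pmin < 1.
Proof.
have := p_ge true (unitI0 R); have := p_ge false (unitI0 R); have := p_sum (unitI0 R).
have := pmin0; lra.
Qed.

Lemma markov_osc F O : (forall x y, `|F x - F y| <= O) ->
  forall x y, `|markov F x - markov F y| <= O.
Proof.
move=> FO x y; rewrite -[leRHS]mul1r.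
by apply: coupling_bound; rewrite ?p_ge0 ?p_sum.
Qed.

Lemma iter_markov_osc F O n : (forall x y, `|F x - F y| <= O) ->
  forall x y, `|iter n markov F x - iter n markov F y| <= O.
Proof. by move=> FO; elim: n => //= n IH; exact: markov_osc. Qed.

(** Doeblin's argument: with weight pmin^k the trajectories from x and y take branch 1 together k
    times; the oscillation bound handles the rest. *)
Lemma iter_markov_minorization F O k : (forall x y, `|F x - F y| <= O) -> forall x y,
  `|iter k markov F x - iter k markov F y| <=
  (1 - pmin ^+ k) * O + pmin ^+ k * `|F (iter k (branch true) x) - F (iter k (branch true) y)|.
Proof.
move=> FO; elim: k => [|k IH] x y; first by rewrite expr0 subrr mul0r add0r mul1r.
have GO := iter_markov_osc k FO.
rewrite [iter k.+1 markov F]/=; set G := iter k markov F in IH GO *.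
have -> : markov G x - markov G y = pmin * (G (branch true x) - G (branch true y)) +
  ((p true x - pmin) * G (branch true x) + p false x * G (branch false x) -
   ((p true y - pmin) * G (branch true y) + p false y * G (branch false y))).
  by rewrite /markov; ring.
apply: (le_trans (ler_normD _ _)); rewrite normrM (ger0_norm (ltW pmin0)).
apply: (@le_trans _ _ (pmin * ((1 - pmin ^+ k) * O + pmin ^+ k *
    `|F (iter k (branch true) (branch true x)) - F (iter k (branch true) (branch true y))|)
    + (1 - pmin) * O)).
  apply: lerD; first by rewrite ler_wpM2l ?(ltW pmin0).
  by apply: coupling_bound; rewrite ?subr_ge0 ?p_ge ?p_ge0//;
    have := p_sum x; have := p_sum y; lra.
by rewrite -!iterSr exprS; rewrite le_eqVlt; apply/predU1P; left; ring.
Qed.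

(** Average contraction: branch 1 has probability at least pmin and contracts by theta, while branch
    0 does not expand. *)
Definition holder_rate : R := 1 - pmin * (1 - theta).

Lemma holder_rate_bounds : 0 < holder_rate < 1.
Proof.
have t0 := contraction_rate_gt0 alpha g; have t1 := contraction_rate_lt1 alpha g0.
have := pmin0; have := pmin_lt1; rewrite /holder_rate => h1 h2.
by apply/andP; split; nra.
Qed.

Lemma markov_holder F O A : 0 <= A -> (forall x y, `|F x - F y| <= O) ->
  (forall x y, `|F x - F y| <= A * dist x y) ->
  forall x y, `|markov F x - markov F y| <= (holder_rate * A + D * O) * dist x y.
Proof.
move=> A0 FO FA x y.
have d0 : 0 <= dist x y by exact: powR_ge0.
have t0 := contraction_rate_gt0 alpha g; have t1 := contraction_rate_lt1 alpha g0.
have -> : markov F x - markov F y = p true x * (F (branch true x) - F (branch true y)) +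
    p false x * (F (branch false x) - F (branch false y)) +
    (p true x - p true y) * (F (branch true y) - F (branch false y)).
  have -> : p false x = 1 - p true x by have := p_sum x; lra.
  rewrite /markov; have -> : p false y = 1 - p true y by have := p_sum y; lra.
  have -> : p false x = 1 - p true x by have := p_sum x; lra.
  by ring.
have h1 : `|p true x * (F (branch true x) - F (branch true y))| <= p true x * (theta * (A * dist x y)).
  rewrite normrM (ger0_norm (p_ge0 _ _)) ler_wpM2l ?p_ge0//.
  apply: (le_trans (FA _ _)); rewrite mulrCA ler_wpM2l//; exact: holder_branch1_dist.
have h0 : `|p false x * (F (branch false x) - F (branch false y))| <= p false x * (A * dist x y).
  rewrite normrM (ger0_norm (p_ge0 _ _)) ler_wpM2l ?p_ge0//.
  apply: (le_trans (FA _ _)); rewrite ler_wpM2l//; exact: holder_branch_dist.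
have h2 : `|(p true x - p true y) * (F (branch true y) - F (branch false y))| <= D * dist x y * O.
  by rewrite normrM; apply: ler_pM.
apply: (le_trans (ler_normD _ _)); apply: (le_trans (lerD (ler_normD _ _) (lexx _))).
apply: (le_trans (lerD (lerD h1 h0) h2)).
have Ad : 0 <= A * dist x y by rewrite mulr_ge0.
have : (1 - theta) * (A * dist x y) * pmin <= (1 - theta) * (A * dist x y) * p true x.
  by rewrite ler_wpM2l ?p_ge// mulr_ge0// subr_ge0 ltW.
have -> : p false x = 1 - p true x by have := p_sum x; lra.
rewrite /holder_rate; lra.
Qed.

Lemma iter_markov_holder F O A n : 0 <= A -> 0 <= O -> (forall x y, `|F x - F y| <= O) ->
  (forall x y, `|F x - F y| <= A * dist x y) ->
  forall x y, `|iter n markov F x - iter n markov F y| <=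
    (holder_rate ^+ n * A + D / (1 - holder_rate) * O) * dist x y.
Proof.
have /andP[r0 r1] := holder_rate_bounds.
move=> A0 O0 FO FA; have D'0 : 0 <= D / (1 - holder_rate) * O.
  by rewrite mulr_ge0// divr_ge0 ?(ltW D0)// subr_ge0 ltW.
elim: n => [|n IH] x y.
  apply: (le_trans (FA x y)); rewrite ler_wpM2r ?powR_ge0//.
  by rewrite expr0 mul1r lerDl.
have An : 0 <= holder_rate ^+ n * A + D / (1 - holder_rate) * O.
  by rewrite addr_ge0// mulr_ge0// exprn_ge0// ltW.
apply: (le_trans (markov_holder An (iter_markov_osc n FO) IH x y)).
rewrite ler_wpM2r ?powR_ge0//.
have E : D / (1 - holder_rate) * (1 - holder_rate) = D by rewrite divfK// subr_eq0 gt_eqF.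
rewrite exprS -[X in _ + X * O <= _]E; rewrite le_eqVlt; apply/predU1P; left; ring.
Qed.

(* The norm osc + b * |.|_g is contracted by a power of the operator: the
   minorization reduces the oscillation, up to a small part of the Hoelder
   seminorm, and the Hoelder seminorm itself is contracted on average. *)
Theorem markov_contraction : exists C rho : R, [/\ 0 < C, 0 < rho < 1 &
  forall F O A n, 0 <= O -> 0 <= A -> (forall x y, `|F x - F y| <= O) ->
  (forall x y, `|F x - F y| <= A * dist x y) ->
  forall x y, `|iter n markov F x - iter n markov F y| <= C * rho ^+ n * (O + A)].
Proof.
have /andP[r0 r1] := holder_rate_bounds; set r := holder_rate in r0 r1.
have t0 := contraction_rate_gt0 alpha g; have t1 := contraction_rate_lt1 alpha g0.
have half_cancel (u v : R) : u != 0 -> v / (2 * u) * u = v / 2.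
  by move=> un; field.
pose D' := D / (1 - r).
have D'0 : 0 < D' by rewrite divr_gt0// subr_gt0.
(* With b = del / (2 D') below, k steps multiply the part b A of the norm by 2 D' theta^k + r^k and
   the part O by 1 - del + b D' = 1 - del / 2. *)
have [k k0 hk] : exists2 k, (0 < k)%N & 2 * D' * theta ^+ k + r ^+ k <= 2^-1.
  have : 2 * D' * theta ^+ k + r ^+ k @[k --> \oo] --> 2 * D' * 0 + (0 : R).
    apply: cvgD; first apply: cvgM; first exact: cvg_cst.
      by apply: cvg_expr; rewrite ger0_norm// ltW.
    by apply: cvg_expr; rewrite ger0_norm// ltW.
  rewrite mulr0 addr0 => /cvgrPdist_le /(_ 2^-1); rewrite invr_gt0 ltr0n => /(_ isT).
  move=> [k _ /(_ k.+1 (leqnSn k)) /=]; rewrite sub0r normrN => h.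
  by exists k.+1 => //; apply: le_trans h; exact: ler_norm.
pose del := pmin ^+ k.
have del0 : 0 < del by rewrite exprn_gt0.
have del1 : del <= 1 by rewrite exprn_ile1 ?(ltW pmin0)// ltW// pmin_lt1.
pose b := del / (2 * D').
have b0 : 0 < b by rewrite divr_gt0// mulr_gt0.
pose rho1 := Num.max (1 - del / 2) 2^-1.
have rho10 : 0 < rho1 by rewrite lt_max invr_gt0 ltr0n orbT.
have rho11 : rho1 < 1.
  rewrite gt_max; apply/andP; split; last by rewrite invf_lt1 ?ltr1n.
  by rewrite gtrBl divr_gt0.
have iter_dist x y : dist (iter k (branch true) x) (iter k (branch true) y) <= theta ^+ k.
  have : dist (iter k (branch true) x) (iter k (branch true) y) <= theta ^+ k * dist x y.
    elim: (k) x y => [|m IH] x y; first by rewrite mul1r.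
    rewrite !iterS exprS; apply: (le_trans (holder_branch1_dist alpha g0 _ _)).
    by rewrite -mulrA ler_wpM2l ?(ltW t0).
  move=> /le_trans; apply; rewrite ler_piMr ?exprn_ge0 ?(ltW t0)//.
  exact: holder_dist_le1.
have step F O A : 0 <= O -> 0 <= A -> (forall x y, `|F x - F y| <= O) ->
    (forall x y, `|F x - F y| <= A * dist x y) -> exists O1 A1,
    [/\ 0 <= O1, 0 <= A1, O1 + b * A1 <= rho1 * (O + b * A),
      forall x y, `|iter k markov F x - iter k markov F y| <= O1 &
      forall x y, `|iter k markov F x - iter k markov F y| <= A1 * dist x y].
  move=> O0 A0 FO FA.
  exists ((1 - del) * O + del * (A * theta ^+ k)), (r ^+ k * A + D' * O); split.
  - by rewrite addr_ge0// mulr_ge0 ?subr_ge0 ?(ltW del0)// mulr_ge0// exprn_ge0 ?(ltW t0).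
  - by rewrite addr_ge0// mulr_ge0 ?exprn_ge0 ?(ltW r0) ?(ltW D'0).
  - have D'n : D' != 0 by rewrite gt_eqF.
    have bD : b * D' = del / 2 by exact: half_cancel.
    have delE : del = 2 * D' * b by rewrite -mulrA [D' * b]mulrC bD mulrC divfK.
    have -> : (1 - del) * O + del * (A * theta ^+ k) + b * (r ^+ k * A + D' * O) =
      (1 - del + b * D') * O + (del * theta ^+ k + b * r ^+ k) * A by ring.
    rewrite bD; have e1 : (1 - del + del / 2) * O <= rho1 * O.
      rewrite ler_wpM2r//; have -> : 1 - del + del / 2 = 1 - del / 2 by lra.
      by rewrite le_max lexx.
    have e2 : (del * theta ^+ k + b * r ^+ k) * A <= rho1 * (b * A).
      have -> : (del * theta ^+ k + b * r ^+ k) * A =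
        (2 * D' * theta ^+ k + r ^+ k) * (b * A) by rewrite delE; ring.
      apply: ler_wpM2r; first by rewrite mulr_ge0 ?(ltW b0).
      by apply: (le_trans hk); rewrite le_max lexx orbT.
    by rewrite mulrDr; exact: lerD.
  - move=> x y; apply: (le_trans (iter_markov_minorization k FO x y)).
    rewrite lerD2l ler_wpM2l ?(ltW del0)//; apply: (le_trans (FA _ _)).
    by rewrite ler_wpM2l.
  - exact: iter_markov_holder.
have iterstep j F O A : 0 <= O -> 0 <= A -> (forall x y, `|F x - F y| <= O) ->
    (forall x y, `|F x - F y| <= A * dist x y) ->
    forall x y, `|iter (j * k) markov F x - iter (j * k) markov F y| <= rho1 ^+ j * (O + b * A).
  elim: j F O A => [|j IH] F O A O0 A0 FO FA x y.
    by rewrite mul1r; apply: (le_trans (FO x y)); rewrite lerDl mulr_ge0 ?(ltW b0).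
  have [Q1 [A1 [Q10 A10 h1 h2 h3]]] := step F O A O0 A0 FO FA.
  rewrite mulSn addnC iterD; apply: (le_trans (IH _ Q1 A1 Q10 A10 h2 h3 x y)).
  by rewrite exprSr -mulrA ler_wpM2l// exprn_ge0 ?(ltW rho10).
pose rho := rho1 `^ (k%:R^-1).
have k0R : 0 < k%:R :> R by rewrite ltr0n.
have rho_k : rho ^+ k = rho1.
  rewrite -powR_mulrn ?powR_ge0// -powRrM mulVf ?gt_eqF// powRr1 ?(ltW rho10)//.
have rho0 : 0 < rho by rewrite powR_gt0.
have rho_lt1 : rho < 1.
  rewrite ltNge; apply/negP => h; move: rho11; rewrite -rho_k ltNge.
  by rewrite exprn_ege1.
(* The factor 1 / rho1 pays for the fewer than k steps left after dividing n by k. *)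
exists ((1 + b) / rho1), rho; split.
- by rewrite divr_gt0// addr_gt0.
- by rewrite rho0.
move=> F O A n O0 A0 FO FA x y.
have -> : iter n markov F = iter (n %% k) markov (iter (n %/ k * k) markov F).
  by rewrite -iterD addnC -divn_eq.
have h := iterstep (n %/ k)%N F O A O0 A0 FO FA.
apply: (le_trans (iter_markov_osc (n %% k) h x y)).
have hn : rho1 ^+ (n %/ k).+1 <= rho ^+ n.
  rewrite -rho_k -exprM; apply: ler_wiXn2l; rewrite ?(ltW rho0) ?(ltW rho_lt1)//.
  by rewrite mulnC ltnW// ltn_ceil.
have hN : O + b * A <= (1 + b) * (O + A).
  by rewrite mulrDl mul1r mulrDr; have := mulr_ge0 (ltW b0) O0; lra.
apply: (@le_trans _ _ (rho1 ^+ (n %/ k) * ((1 + b) * (O + A)))).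
  by rewrite ler_wpM2l// exprn_ge0 ?(ltW rho10).
have -> : (1 + b) / rho1 * rho ^+ n * (O + A) = rho1^-1 * rho ^+ n * ((1 + b) * (O + A)) by ring.
rewrite ler_wpM2r; first by [].
  by rewrite mulr_ge0 ?addr_ge0 ?(ltW b0).
by rewrite ler_pdivlMl// -exprS.
Qed.

End markov_operator.

(** * Riesz representation on the unit interval *)

Section lattice_operations.
Context {R : realDomainType}.
Implicit Types c u v : R.

Lemma maxr_dist c u v : `|Num.max c u - Num.max c v| <= `|u - v|.
Proof.
wlog vu : u v / v <= u.
  by move=> H; have [/H//|/ltW/H] := leP v u; rewrite distrC (distrC v).
have h : Num.max c v <= Num.max c u by rewrite ge_max !le_max lexx/= vu orbT.
rewrite !ger0_norm ?subr_ge0// lerBlDr ge_max; apply/andP; split.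
  by rewrite ler_wpDl ?subr_ge0// le_max lexx.
by rewrite -lerBlDl opprB addrC subrK le_max lexx orbT.
Qed.

Lemma minr_dist c u v : `|Num.min c u - Num.min c v| <= `|u - v|.
Proof.
have E w : Num.min c w = - Num.max (- c) (- w) by rewrite oppr_max !opprK.
by rewrite !E -opprD normrN (le_trans (maxr_dist _ _ _))// -opprD normrN.
Qed.

End lattice_operations.

Section riesz_representation.
Context {R : realType}.
Local Notation T := (unitI R).
Local Notation ev := (@unitI_val R).
Variable Lam : (T -> R) -> R.
Hypotheses (LamD : forall F G, bounded_measurable F -> bounded_measurable G ->
    Lam (fun x => F x + G x) = Lam F + Lam G)
  (LamZ : forall c F, bounded_measurable F -> Lam (fun x => c * F x) = c * Lam F)
  (Lam_le : forall F G, bounded_measurable F -> bounded_measurable G ->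
    (forall x, F x <= G x) -> Lam F <= Lam G)
  (LamC : forall c, Lam (fun=> c) = c).

(** Lipschitz majorant of the indicator of [0, t] that vanishes beyond t + e. *)
Definition ramp (t e : R) (x : T) : R := Num.min 1 (Num.max 0 ((t + e - ev x) / e)).

Lemma ramp_ge0 t e x : 0 <= ramp t e x.
Proof. by rewrite le_min ler01 le_max lexx. Qed.

Lemma ramp_le1 t e x : ramp t e x <= 1.
Proof. by rewrite ge_min lexx. Qed.

Lemma ramp_eq1 t e x : 0 < e -> ev x <= t -> ramp t e x = 1.
Proof.
move=> e0 xt; apply: min_l; rewrite le_max; apply/orP; right.
by rewrite ler_pdivlMr// mul1r; lra.
Qed.

Lemma ramp_eq0 t e x : 0 < e -> t + e <= ev x -> ramp t e x = 0.
Proof.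
move=> e0 xt; rewrite /ramp max_l ?min_r ?ler01//.
by rewrite pmulr_lle0 ?invr_gt0//; lra.
Qed.

Lemma bounded_measurable_ramp t e : bounded_measurable (ramp t e).
Proof.
split; last by exists 1 => x; rewrite ger0_norm ?ramp_ge0 ?ramp_le1.
apply: measurable_minr; first exact: measurable_cst.
apply: measurable_maxr; first exact: measurable_cst.
apply: measurable_funM; last exact: measurable_cst.
by apply: measurable_funB; [exact: measurable_cst|exact: measurable_unitI_val].
Qed.

Lemma ramp_le t t' e e' : 0 < e -> 0 < e' -> t + e <= t' ->
  forall x, ramp t e x <= ramp t' e' x.
Proof.
move=> e0 e'0 tt' x; have [h|h] := leP (ev x) t'.
  by rewrite [leRHS]ramp_eq1// ramp_le1.
by rewrite ramp_eq0 ?ramp_ge0//; exact: le_trans (ltW h).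
Qed.

(** Both ramps end at t + e. The estimate gives the right continuity of [riesz_cdf]. *)
Lemma ramp_shift t e d x : 0 < d -> d < e -> ramp (t + d) (e - d) x <= ramp t e x + d / e.
Proof.
move=> d0 de; have e0 : 0 < e by exact: lt_trans de.
have ed0 : 0 < e - d by rewrite subr_gt0.
have de0 : 0 <= d / e by rewrite divr_ge0 ?ltW.
have [h|h] := leP (t + e) (ev x).
  by rewrite ramp_eq0 ?addr_ge0 ?ramp_ge0//; lra.
rewrite /ramp (_ : t + d + (e - d) = t + e); last by ring.
set s := t + e - ev x; have s0 : 0 < s by rewrite subr_gt0.
rewrite !max_r ?divr_ge0 ?(ltW s0) ?(ltW ed0) ?(ltW e0)//.
have key : Num.min 1 (s / (e - d)) <= s / e + d / e.
  have [h1|h1] := leP s (e - d).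
    rewrite ge_min; apply/orP; right; rewrite -mulrDl ler_pdivrMr// mulrAC ler_pdivlMr//.
    have : 0 <= d * (e - d - s) by rewrite mulr_ge0 ?(ltW d0)//; lra.
    lra.
  rewrite ge_min; apply/orP; left; rewrite -mulrDl ler_pdivlMr// mul1r; lra.
have [h2|h2] := leP 1 (s / e); last exact: key.
by apply: (@le_trans _ _ 1); rewrite ?ge_min ?lexx// lerDl.
Qed.

Definition riesz_cdf (t : R) : R := inf [set Lam (ramp t e) | e in [set e | 0 < e]].

Let has_inf_cdf t : has_inf [set Lam (ramp t e) | e in [set e : R | 0 < e]].
Proof.
split; first by exists (Lam (ramp t 1)), 1 => //=.
exists 0 => _ [e _ <-]; rewrite -(LamC 0); apply: Lam_le.
- exact: bounded_measurable_cst.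
- exact: bounded_measurable_ramp.
- by move=> x; exact: ramp_ge0.
Qed.

Lemma riesz_cdf_le t e : 0 < e -> riesz_cdf t <= Lam (ramp t e).
Proof. by move=> e0; apply: ge_inf; [case: (has_inf_cdf t)|exists e]. Qed.

Lemma riesz_cdf_ge t u : (forall e, 0 < e -> u <= Lam (ramp t e)) -> u <= riesz_cdf t.
Proof.
move=> h; apply: lb_le_inf; first by case: (has_inf_cdf t).
by move=> _ [e /= e0 <-]; exact: h.
Qed.

Lemma Lam_ramp_le t t' e : 0 < e -> t + e <= t' -> Lam (ramp t e) <= riesz_cdf t'.
Proof.
move=> e0 tt'; apply: riesz_cdf_ge => e' e'0; apply: Lam_le.
- exact: bounded_measurable_ramp.
- exact: bounded_measurable_ramp.
- exact: ramp_le.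
Qed.

Lemma riesz_cdf_ge0 t : 0 <= riesz_cdf t.
Proof.
apply: riesz_cdf_ge => e e0; rewrite -(LamC 0); apply: Lam_le.
- exact: bounded_measurable_cst.
- exact: bounded_measurable_ramp.
- by move=> x; exact: ramp_ge0.
Qed.

Lemma riesz_cdf_lt0 t : t < 0 -> riesz_cdf t = 0.
Proof.
move=> t0; apply/eqP; rewrite eq_le riesz_cdf_ge0 andbT.
have t2 : 0 < - t by rewrite oppr_gt0.
apply: (le_trans (riesz_cdf_le t t2)); rewrite -[leRHS](LamC 0); apply: Lam_le.
- exact: bounded_measurable_ramp.
- exact: bounded_measurable_cst.
- by move=> x; rewrite ramp_eq0// subrr unitI_ge0.
Qed.

Lemma riesz_cdf_ge1 t : 1 <= t -> riesz_cdf t = 1.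
Proof.
move=> t1; have E e : 0 < e -> Lam (ramp t e) = 1.
  move=> e0; rewrite -[RHS](LamC 1); congr Lam; apply/funext => x.
  by rewrite ramp_eq1// (le_trans (unitI_le1 x)).
apply/eqP; rewrite eq_le; apply/andP; split.
  by rewrite -(E 1)//; apply: riesz_cdf_le.
by apply: riesz_cdf_ge => e /E ->.
Qed.

Lemma riesz_cdf_nd : nondecreasing riesz_cdf.
Proof.
move=> t t' tt'; apply: riesz_cdf_ge => e e0.
apply: (le_trans (riesz_cdf_le t e0)); apply: Lam_le.
- exact: bounded_measurable_ramp.
- exact: bounded_measurable_ramp.
- move=> x; rewrite /ramp le_min ge_min lexx/= ge_min; apply/orP; right.
  rewrite ge_max le_max lexx/= le_max; apply/orP; right.
  by rewrite ler_wpM2r ?invr_ge0 ?(ltW e0)//; lra.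
Qed.

Lemma riesz_cdf_rc : right_continuous riesz_cdf.
Proof.
move=> t; apply/cvgrPdist_le => d d0.
have d2 : 0 < d / 2 by rewrite divr_gt0.
have [_ [e /= e0 <-] he] := inf_adherent (eps := d / 2) d2 (has_inf_cdf t).
rewrite -/(riesz_cdf t) in he.
pose r : R := Num.min (e / 2) (d / 2 * e).
have r0 : 0 < r by rewrite lt_min divr_gt0// mulr_gt0.
near=> t'.
have tt' : t < t' by near: t'; exact: nbhs_right_gt.
have t'r : t' < t + r by near: t'; apply: nbhs_right_lt; rewrite ltrDl.
pose s := t' - t; have s0 : 0 < s by rewrite subr_gt0.
have sr : s < r by rewrite /s; lra.
have se : s < e by apply: (lt_le_trans sr); rewrite ge_min ler_pdivrMr// ler_peMr ?(ltW e0)// ler1n.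
have sde : s / e <= d / 2.
  rewrite ler_pdivrMr// ltW//; apply: (lt_le_trans sr).
  by rewrite ge_min lexx orbT.
rewrite ler0_norm ?subr_le0 ?riesz_cdf_nd ?(ltW tt')// opprB lerBlDr.
have : riesz_cdf t' <= Lam (ramp t e) + s / e.
  have -> : t' = t + s by rewrite /s; ring.
  apply: (le_trans (riesz_cdf_le (t + s) (_ : 0 < e - s))); first by rewrite subr_gt0.
  rewrite -[X in _ <= _ + X](LamC (s / e)) -LamD; [|exact: bounded_measurable_ramp|exact: bounded_measurable_cst].
  apply: Lam_le.
  - exact: bounded_measurable_ramp.
  - by apply: bounded_measurableD; [exact: bounded_measurable_ramp|exact: bounded_measurable_cst].
  - by move=> x; exact: ramp_shift.
lra.
Unshelve. all: by end_near. Qed.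

#[local] HB.instance Definition _ := isCumulative.Build R _ R riesz_cdf
  riesz_cdf_nd riesz_cdf_rc.

Let cdfNy : riesz_cdf @ -oo --> (0 : R).
Proof.
apply: cvg_near_cst; near=> t; apply: riesz_cdf_lt0.
by near: t; exact: nbhs_ninfty_lt.
Unshelve. all: by end_near. Qed.

Let cdfy : riesz_cdf @ +oo --> (1 : R).
Proof.
apply: cvg_near_cst; near=> t; apply: riesz_cdf_ge1.
by near: t; exact: nbhs_pinfty_ge.
Unshelve. all: by end_near. Qed.

#[local] HB.instance Definition _ := isCumulativeBounded.Build R 0 1 riesz_cdf cdfNy cdfy.

Let clampR (t : R) : R := Num.max 0 (Num.min 1 t).

Let clampR_subproof (t : R) : clampR t \in `[0, 1]%classic.
Proof.
rewrite inE/= in_itv/= /clampR le_max lexx/= ge_max ler01/=.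
by rewrite ge_min lexx.
Qed.

Definition clamp (t : R) : T := exist _ (clampR t) (clampR_subproof t).

Lemma clamp_id t : 0 <= t <= 1 -> ev (clamp t) = t.
Proof.
move=> /andP[t0 t1]; rewrite /unitI_val/= /clampR min_r// max_r//.
Qed.

Lemma measurable_clamp : measurable_fun setT clamp.
Proof.
apply: measurable_to_unitI; rewrite (_ : _ \o _ = clampR)//.
apply: measurable_maxr; first exact: measurable_cst.
by apply: measurable_minr; first exact: measurable_cst.
Qed.

(** The Lebesgue-Stieltjes measure of [riesz_cdf] lives on R; its image under [clamp] lives on the
    unit interval and has the same distribution function. *)
Lemma riesz_measure_exists : exists nu : probability T R,
  forall t, nu [set x | ev x <= t] = (riesz_cdf t)%:E.
Proof.
pose P := lebesgue_stieltjes_measure riesz_cdf.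
have mX : measurable_fun [set: measurableTypeR R] (clamp : measurableTypeR R -> T).
  exact: measurable_clamp.
pose X : {mfun measurableTypeR R >-> T} :=
  HB.pack (clamp : measurableTypeR R -> T) (isMeasurableFun.Build _ _ _ _ _ mX).
exists (distribution P X) => t.
have cdfP u : P `]-oo, u]%classic = (riesz_cdf u)%:E.
  exact: (cdf_lebesgue_stieltjes_id riesz_cdf u).
suff : P (clamp @^-1` [set x | ev x <= t]) = (riesz_cdf t)%:E by [].
have [t0|t0] := ltP t 0.
  rewrite riesz_cdf_lt0// (_ : _ @^-1` _ = set0); first exact: measure0.
  apply/seteqP; split=> // u /= h; have := unitI_ge0 (clamp u).
  by move=> /le_trans /(_ h); rewrite leNgt t0.
have [t1|t1] := leP 1 t.
  rewrite riesz_cdf_ge1// (_ : _ @^-1` _ = setT); first exact: probability_setT.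
  by apply/seteqP; split=> // u _ /=; exact: le_trans (unitI_le1 _) t1.
rewrite -cdfP; congr (P _); apply/seteqP; split=> u /=; rewrite in_itv/=.
  by rewrite /unitI_val/= /clampR ge_max ge_min => /andP[_ /orP[|//]]; rewrite leNgt t1.
by move=> ut; rewrite /unitI_val/= /clampR ge_max ge_min ut orbT t0.
Qed.

(** The functional Phi is arbitrary because the lemma is applied both to [Lam] and to the integral
    against nu: each is within 2 w of the same Riemann-Stieltjes sum. *)
Lemma riesz_approx (G : T -> R) (w : R) N : (0 < N)%N -> bounded_measurable G ->
  (forall x y, `|ev x - ev y| <= N%:R^-1 -> `|G x - G y| <= w) ->
  forall Phi : (T -> R) -> R,
  (forall F H, bounded_measurable F -> bounded_measurable H ->
    Phi (fun x => F x + H x) = Phi F + Phi H) ->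
  (forall c F, bounded_measurable F -> Phi (fun x => c * F x) = c * Phi F) ->
  (forall F H, bounded_measurable F -> bounded_measurable H ->
    (forall x, F x <= H x) -> Phi F <= Phi H) ->
  (forall c, Phi (fun=> c) = c) ->
  (forall k : nat, riesz_cdf (k%:R / N%:R) <= Phi (ramp (k%:R / N%:R) N%:R^-1) <=
      riesz_cdf (k.+1%:R / N%:R)) ->
  `|Phi G - (G (clamp 1) - \sum_(k < N) riesz_cdf (k%:R / N%:R) *
     (G (clamp (k.+1%:R / N%:R)) - G (clamp (k%:R / N%:R))))| <= 2 * w.
Proof.
move=> N0 bG hG Phi PhiD PhiZ Phile PhiC hPhi.
have NR : 0 < N%:R :> R by rewrite ltr0n.
pose tt k : R := k%:R / N%:R.
pose gk k := G (clamp (tt k)).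
have tN : tt N = 1 by rewrite /tt divff// gt_eqF.
have evt k : (k <= N)%N -> ev (clamp (tt k)) = tt k.
  move=> kN; apply: clamp_id; rewrite divr_ge0//= ler_pdivrMr// mul1r ler_nat//.
have tS k : tt k.+1 = tt k + N%:R^-1 by rewrite /tt -natr1 mulrDl mul1r.
have dg k : (k < N)%N -> `|gk k.+1 - gk k| <= w.
  move=> kN; apply: hG; rewrite (evt _ kN) (evt _ (ltnW kN)) tS addrC addKr.
  by rewrite ger0_norm// invr_ge0 (ltW NR).
have w0 : 0 <= w by apply: le_trans (dg 0%N N0).
(* Piecewise linear interpolation of G at the multiples of 1 / N, written with ramps. *)
pose S x := gk N - \sum_(k < N) (gk k.+1 - gk k) * ramp (tt k) N%:R^-1 x.
have bsum : bounded_measurable (fun x => \sum_(k < N) (gk k.+1 - gk k) * ramp (tt k) N%:R^-1 x).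
  apply: (@bounded_measurable_sum _ _ _ _ _ (fun (k : 'I_N) x => (gk k.+1 - gk k) * ramp (tt k) N%:R^-1 x)).
  by move=> k; apply: bounded_measurableM; [exact: bounded_measurable_cst|exact: bounded_measurable_ramp].
have bS : bounded_measurable S.
  by apply: bounded_measurableB => //; exact: bounded_measurable_cst.
have N1 : 0 < N%:R^-1 :> R by rewrite invr_gt0.
have SG x : `|G x - S x| <= w.
  have [m mN /andP[m1 m2]] : exists2 m, (m < N)%N & tt m <= ev x <= tt m.+1.
    have [x1|x1] := leP 1 (ev x).
      exists N.-1; rewrite prednK// tN (unitI_le1 x) andbT.
      by apply: le_trans x1; rewrite -tN /tt ler_wpM2r ?(ltW N1)// ler_nat leq_pred.
    pose m := Num.trunc (ev x * N%:R).
    have xN0 : 0 <= ev x * N%:R by rewrite mulr_ge0 ?unitI_ge0.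
    have /andP[k1 k2] : m%:R <= ev x * N%:R < m.+1%:R by rewrite Num.Theory.trunc_itv.
    exists m.
      by rewrite -(ltr_nat R); apply: (le_lt_trans k1); rewrite -[ltRHS]mul1r ltr_pM2r.
    by rewrite /tt ler_pdivrMr// k1 ler_pdivlMr// ltW.
  have -> : S x = gk m.+1 - (gk m.+1 - gk m) * ramp (tt m) N%:R^-1 x.
    have ttle i j : (i <= j)%N -> tt i <= tt j.
      by move=> ij; rewrite /tt ler_wpM2r ?(ltW N1)// ler_nat.
    rewrite /S -(big_mkord xpredT (fun k => (gk k.+1 - gk k) * ramp (tt k) N%:R^-1 x)).
    rewrite (@big_cat_nat _ _ _ m.+1)//= big_nat_recr//=.
    rewrite big_nat_cond big1 ?add0r; last first.
      move=> k /andP[/andP[_ km] _]; rewrite ramp_eq0 ?mulr0// -tS.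
      exact: le_trans (ttle _ _ km) m1.
    rewrite (eq_big_nat _ _ (F2 := fun k => gk k.+1 - gk k)); last first.
      move=> k /andP[mk _]; rewrite ramp_eq1 ?mulr1//.
      exact: le_trans m2 (ttle _ _ mk).
    by rewrite telescope_sumr//; ring.
  have [r0 r1] := (ramp_ge0 (tt m) N%:R^-1 x, ramp_le1 (tt m) N%:R^-1 x).
  set r := ramp _ _ _ in r0 r1 *.
  have hb : `|G x - gk m.+1| <= w.
    apply: hG; rewrite evt// ler0_norm ?subr_le0// opprB; move: m1 m2; rewrite tS; lra.
  have ha : `|G x - gk m| <= w.
    apply: hG; rewrite evt ?(ltnW mN)// ger0_norm ?subr_ge0//; move: m1 m2; rewrite tS; lra.
  move: ha hb; rewrite !ler_norml => /andP[a1 a2] /andP[b1 b2].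
  apply/andP; split; nra.
have PhiN F : bounded_measurable F -> Phi (fun x => - F x) = - Phi F.
  move=> bF; have -> : (fun x => - F x) = (fun x => -1 * F x).
    by apply/funext => x; rewrite mulN1r.
  by rewrite PhiZ// mulN1r.
have PhiS : Phi S = gk N - \sum_(k < N) (gk k.+1 - gk k) * Phi (ramp (tt k) N%:R^-1).
  rewrite PhiD; [|exact: bounded_measurable_cst|exact: bounded_measurableN].
  rewrite PhiC PhiN//; congr (_ - _).
  elim: (index_enum _) => [|k s IH].
    by rewrite big_nil -[RHS](PhiC 0); congr Phi; apply/funext => x; rewrite big_nil.
  rewrite big_cons -IH -PhiZ; last exact: bounded_measurable_ramp.
  rewrite -PhiD.
  - by congr Phi; apply/funext => x; rewrite big_cons.
  - by apply: bounded_measurableM; [exact: bounded_measurable_cst|exact: bounded_measurable_ramp].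
  - apply: (@bounded_measurable_sum _ _ _ _ _ (fun (k : 'I_N) x => (gk k.+1 - gk k) * ramp (tt k) N%:R^-1 x)).
    by move=> i; apply: bounded_measurableM; [exact: bounded_measurable_cst|exact: bounded_measurable_ramp].
have e1 : `|Phi G - Phi S| <= w.
  have key F H : bounded_measurable F -> bounded_measurable H -> (forall x, `|F x - H x| <= w) ->
      Phi F - Phi H <= w.
    move=> bF bH FH; rewrite lerBlDl -{1}(PhiC w) -PhiD//; last exact: bounded_measurable_cst.
    apply: Phile => //; first by apply: bounded_measurableD => //; exact: bounded_measurable_cst.
    by move=> x; have := FH x; rewrite ler_norml => /andP[_]; lra.
  have k1 := key G S bG bS SG.
  have k2 : Phi S - Phi G <= w by apply: key => // x; rewrite distrC.
  by rewrite ler_norml; apply/andP; split; lra.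
(* The value of Phi at each ramp lies between consecutive values of [riesz_cdf], so that the errors
   telescope. *)
have e2 : `|Phi S - (gk N - \sum_(k < N) riesz_cdf (tt k) * (gk k.+1 - gk k))| <= w.
  have abc (a b c : R) : a - b - (a - c) = c - b by ring.
  rewrite PhiS abc -sumrB.
  apply: (le_trans (ler_norm_sum _ _ _)).
  apply: (@le_trans _ _ (\sum_(k < N) w * (riesz_cdf (tt k.+1) - riesz_cdf (tt k)))).
    apply: ler_sum => k _; rewrite mulrC -mulrBr normrM; apply: ler_pM => //; first exact: dg.
    have /andP[c1 c2] := hPhi k; rewrite -/(tt k) -/(tt k.+1) in c1 c2.
    by rewrite ler0_norm ?subr_le0// opprB lerB.
  rewrite -mulr_sumr -(big_mkord xpredT (fun k => riesz_cdf (tt k.+1) - riesz_cdf (tt k))).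
  rewrite telescope_sumr// tN riesz_cdf_ge1// ler_piMr// gerBl; exact: riesz_cdf_ge0.
have gN : G (clamp 1) = gk N by rewrite /gk tN.
have -> : Phi G - (G (clamp 1) - \sum_(k < N) riesz_cdf (k%:R / N%:R) *
     (G (clamp (k.+1%:R / N%:R)) - G (clamp (k%:R / N%:R)))) =
  (Phi G - Phi S) + (Phi S - (gk N - \sum_(k < N) riesz_cdf (tt k) * (gk k.+1 - gk k))) by rewrite gN /gk /tt; ring.
apply: (le_trans (ler_normD _ _)); lra.
Qed.

Definition uniformly_continuous_unitI (G : T -> R) : Prop := forall e : R, 0 < e ->
  exists2 N, (0 < N)%N & forall x y, `|ev x - ev y| <= N%:R^-1 -> `|G x - G y| <= e.

Theorem riesz_representation : exists nu : probability T R, forall G,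
  bounded_measurable G -> uniformly_continuous_unitI G -> \int[nu]_x G x = Lam G.
Proof.
have [nu hnu] := riesz_measure_exists; exists nu => G bG uG.
apply/eqP; rewrite -subr_eq0 -normr_le0; apply/ler_addgt0Pr => e e0; rewrite add0r.
have [N N0 hN] := uG _ (divr_gt0 e0 (ltr0n R 4)).
have NR : 0 < N%:R :> R by rewrite ltr0n.
have N1 : 0 < N%:R^-1 :> R by rewrite invr_gt0.
have tS k : (k.+1%:R / N%:R : R) = k%:R / N%:R + N%:R^-1 by rewrite -natr1 mulrDl mul1r.
have h1 := riesz_approx N0 bG hN LamD LamZ Lam_le LamC.
have h2 := riesz_approx N0 bG hN (meanD nu) (meanZ nu) (mean_le nu) (mean_cst nu).
have mA t : measurable [set x : T | ev x <= t].
  rewrite (_ : [set _ | _] = ev @^-1` `]-oo, t]%classic).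
    by apply: measurable_preimage => //; exact: measurable_unitI_val.
  by apply/seteqP; split=> x /=; rewrite in_itv.
have cdfE t : riesz_cdf t = \int[nu]_x \1_([set x : T | ev x <= t]) x.
  by rewrite mean_indic// hnu.
have {}h1 : forall k : nat, riesz_cdf (k%:R / N%:R) <= Lam (ramp (k%:R / N%:R) N%:R^-1) <=
    riesz_cdf (k.+1%:R / N%:R).
  by move=> k; rewrite riesz_cdf_le//= Lam_ramp_le// tS.
have {}h2 : forall k : nat, riesz_cdf (k%:R / N%:R) <= \int[nu]_x ramp (k%:R / N%:R) N%:R^-1 x <=
    riesz_cdf (k.+1%:R / N%:R).
  move=> k; rewrite !cdfE; apply/andP; split; apply: mean_le;
    do ?[exact: bounded_measurable_ramp|exact: bounded_measurable_indic] => x.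
    rewrite indicE; case: (boolP (_ \in _)) => [|_]; last exact: ramp_ge0.
    by rewrite inE/= => xt; rewrite ramp_eq1.
  rewrite indicE; case: (boolP (_ \in _)) => [_|]; first exact: ramp_le1.
  by rewrite notin_setE/= => /negP; rewrite -ltNge => xt; rewrite ramp_eq0// -tS ltW.
have := riesz_approx N0 bG hN LamD LamZ Lam_le LamC h1.
have := riesz_approx N0 bG hN (meanD nu) (meanZ nu) (mean_le nu) (mean_cst nu) h2.
set c := G (clamp 1) - _; rewrite !ler_norml => /andP[a1 a2] /andP[b1 b2].
by apply/andP; split; lra.
Qed.

End riesz_representation.

(** * Stationary measures *)

Section dominated_mean.
Context d (T : measurableType d) (R : realType) (nu : probability T R).

Lemma mean_cvg (F_ : nat -> T -> R) (F : T -> R) (M : R) :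
  (forall n, bounded_measurable (F_ n)) -> bounded_measurable F ->
  (forall n x, `|F_ n x| <= M) -> (forall x, F_ n x @[n --> \oo] --> F x) ->
  \int[nu]_x F_ n x @[n --> \oo] --> \int[nu]_x F x.
Proof.
move=> bF_ bF FM FF.
have cE x : setT x -> EFin (F_ n x) @[n --> \oo] --> (F x)%:E.
  by move=> _; apply: cvg_EFin; [exact: nearW|exact: FF].
have [_ _ h] := @dominated_convergence _ T R nu setT measurableT
  (fun n => EFin \o F_ n) (EFin \o F) (cst M%:E)
  (fun n => (measurable_EFinP _ _).2 (bF_ n).1) ((measurable_EFinP _ _).2 bF.1)
  (aeW _ cE)
  (bounded_measurable_integrable nu (bounded_measurable_cst _ M))
  (aeW _ (fun x n _ => FM n x)).
apply: fine_cvg; rewrite -EFin_mean//.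
Qed.

End dominated_mean.

Section unitI_generators.
Context {R : realType}.
Local Notation T := (unitI R).
Local Notation ev := (@unitI_val R).

Definition initial_segment (t : R) : set T := [set x | ev x <= t].

Lemma measurable_initial_segment t : measurable (initial_segment t).
Proof.
rewrite (_ : initial_segment t = ev @^-1` `]-oo, t]%classic).
  by apply: measurable_preimage => //; exact: measurable_unitI_val.
by apply/seteqP; split=> x /=; rewrite in_itv.
Qed.

Lemma measurable_unitI_generated :
  @measurable _ T = <<s range initial_segment >>.
Proof.
apply/seteqP; split; last first.
  apply: smallest_sub; first exact: sigma_algebra_measurable.
  by move=> _ [t _ <-]; exact: measurable_initial_segment.
apply: smallest_sub; first exact: smallest_sigma_algebra.
move=> U oU.
have -> : U = ev @^-1` [set t | exists2 x, U x & ev x = t].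
  by apply/seteqP; split=> x /=; [move=> Ux; exists x|move=> [y Uy /unitI_val_inj <-]].
(* The largest open subset of R whose trace lies in U. *)
pose V : set R := \bigcup_(I in [set I : set R | open I /\ ev @^-1` I `<=` U]) I.
have -> : ev @^-1` [set t | exists2 x, U x & ev x = t] = ev @^-1` V.
  apply/seteqP; split=> x /=.
    move=> [y Uy yx]; have [r r0 rU] := (open_unitI U).1 oU y Uy.
    exists (ball (ev x) r); last exact: ballxx.
    split; first exact: ball_open.
    by move=> z; rewrite /= /ball/= -yx; exact: rU.
  by move=> [I [_ IU] Ix]; exists x => //; exact: IU.
have mV : measurable V by apply: open_measurable; apply: bigcup_open => I [].
have : @measurable _ R `<=` [set B | <<s range initial_segment >> (ev @^-1` B)].
  rewrite [X in X `<=` _](RGenOInfty.measurableE R); apply: smallest_sub.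
    split=> /=.
    - by rewrite preimage_set0; exact: sigma_algebra0.
    - by move=> B hB; rewrite setTD preimage_setC; apply: sigma_algebraC.
    - by move=> F hF; rewrite preimage_bigcup; exact: sigma_algebra_bigcup.
  move=> _ [t ->] /=.
  rewrite (_ : _ @^-1` _ = ~` initial_segment t).
    by apply: sigma_algebraC; apply: sub_sigma_algebra; exists t.
  by apply/seteqP; split=> x /=; rewrite in_itv/= andbT ltNge => /negP.
exact.
Qed.

End unitI_generators.

Section stationary_measure.
Context {R : realType} (alpha : {posnum R}).
Local Notation T := (unitI R).
Local Notation f := (intermittent_map alpha).
Local Notation ev := (@unitI_val R).
Local Notation branch := (branch alpha).
Variables (g : R) (p : bool -> T -> R) (pmin D : R).
Hypotheses (g0 : 0 < g) (g1 : g <= 1) (pmin0 : 0 < pmin) (D0 : 0 < D).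
Hypotheses (p_ge : forall i x, pmin <= p i x)
  (p_sum : forall x, p true x + p false x = 1)
  (p_holder : forall x y, `|p true x - p true y| <= D * `|ev x - ev y| `^ g).
Local Notation dist x y := (`|ev x - ev y| `^ g).
Local Notation P := (markov alpha p).
Implicit Types (F G : T -> R).

Lemma dist_le_holder x y : `|ev x - ev y| <= dist x y.
Proof.
have [->|xy] := eqVneq x y; first by rewrite subrr normr0 powR_ge0.
have d0 := unitI_dist_gt0 xy; have d1 := unitI_dist_le1 x y.
rewrite -[leLHS]powRr1 ?(ltW d0)//; apply: ger_powR => //.
by rewrite d0 d1.
Qed.

Lemma bounded_measurable_p i : bounded_measurable (p i).
Proof.
have bt : bounded_measurable (p true).
  split; first by apply: (holder_continuous_measurable g0); exists D.
  exists 1 => x; rewrite ger0_norm; last exact: le_trans (ltW pmin0) (p_ge _ _).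
  by have := p_sum x; have := le_trans (ltW pmin0) (p_ge false x); lra.
case: i => //; rewrite (_ : p false = fun x => 1 - p true x).
  by apply: bounded_measurableB => //; exact: bounded_measurable_cst.
by apply/funext => x; have := p_sum x; lra.
Qed.

Lemma bounded_measurable_branch i F : bounded_measurable F ->
  bounded_measurable (fun x => F (branch i x)).
Proof. by apply: bounded_measurable_comp; exact: measurable_branch. Qed.

Lemma bounded_measurable_markov F : bounded_measurable F -> bounded_measurable (P F).
Proof.
by move=> bF; apply: bounded_measurableD; apply: bounded_measurableM;
  do ?exact: bounded_measurable_p; exact: bounded_measurable_branch.
Qed.

Lemma bounded_measurable_iter_markov n F : bounded_measurable F ->
  bounded_measurable (iter n P F).
Proof. by move=> bF; elim: n => //= n; exact: bounded_measurable_markov. Qed.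

Lemma markov_cst c x : P (fun=> c) x = c.
Proof. by rewrite /markov -mulrDl p_sum mul1r. Qed.

Lemma markovD F G x : P (fun y => F y + G y) x = P F x + P G x.
Proof. by rewrite /markov; ring. Qed.

Lemma markovZ c F x : P (fun y => c * F y) x = c * P F x.
Proof. by rewrite /markov; ring. Qed.

Lemma markov_le F G : (forall x, F x <= G x) -> forall x, P F x <= P G x.
Proof.
move=> FG x; have h i := le_trans (ltW pmin0) (p_ge i x).
by apply: lerD; apply: ler_wpM2l.
Qed.

Lemma iter_markovD n F G x : iter n P (fun y => F y + G y) x = iter n P F x + iter n P G x.
Proof.
elim: n x => // n IH x /=; rewrite -markovD; congr (P _ _); exact/funext.
Qed.

Lemma iter_markovZ n c F x : iter n P (fun y => c * F y) x = c * iter n P F x.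
Proof.
elim: n x => // n IH x /=; rewrite -markovZ; congr (P _ _); exact/funext.
Qed.

Lemma iter_markov_cst n c x : iter n P (fun=> c) x = c.
Proof.
elim: n x => // n IH x /=; rewrite -[RHS](markov_cst c x); congr (P _ _); exact/funext.
Qed.

Lemma iter_markov_le n F G : (forall x, F x <= G x) -> forall x, iter n P F x <= iter n P G x.
Proof. by move=> FG; elim: n => //= n IH; exact: markov_le. Qed.

Lemma iter_markov_bounded F M n x : (forall x, `|F x| <= M) -> `|iter n P F x| <= M.
Proof.
move=> FM; rewrite ler_norml -{1}(iter_markov_cst n (- M) x) -{2}(iter_markov_cst n M x).
apply/andP; split; apply: iter_markov_le => y; have := FM y; rewrite ler_norml => /andP[] //.
Qed.

Lemma holder_osc F : holder_continuous g F -> exists2 A, 0 <= A &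
  (forall x y, `|F x - F y| <= A) /\ (forall x y, `|F x - F y| <= A * dist x y).
Proof.
move=> /(holder_pos_const)[A A0 hA]; exists A; first exact: ltW.
split=> // x y; apply: (le_trans (hA x y)).
by rewrite ler_piMr ?(ltW A0)// holder_dist_le1.
Qed.

Lemma holder_continuous_markov F : holder_continuous g F -> holder_continuous g (P F).
Proof.
move=> /holder_osc[A A0 [FA FA']].
exists (holder_rate alpha g pmin * A + D * A) => x y.
exact: (markov_holder alpha g0 pmin0 p_ge p_sum p_holder A0 FA FA').
Qed.

Lemma holder_uniformly_continuous F : holder_continuous g F -> uniformly_continuous_unitI F.
Proof.
move=> /(holder_pos_const)[A A0 hA] e e0.
have r0 : 0 < (e / A) `^ g^-1 by rewrite powR_gt0// divr_gt0.
have [N hN] : exists N : nat, ((e / A) `^ g^-1)^-1 < N%:R.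
  by exists (Num.trunc ((e / A) `^ g^-1)^-1).+1; rewrite Num.Theory.truncnS_gt.
have N0 : 0 < N%:R :> R by apply: lt_trans hN; rewrite invr_gt0.
exists N; first by rewrite -(ltr0n R).
move=> x y xy; apply: (le_trans (hA x y)); rewrite mulrC -ler_pdivlMr//.
have -> : e / A = ((e / A) `^ g^-1) `^ g.
  by rewrite -powRrM mulVf ?gt_eqF// powRr1// divr_ge0 ?ltW.
apply: ge0_ler_powR; rewrite ?nnegrE ?(ltW g0) ?(ltW r0)//.
by apply: (le_trans xy); rewrite -[leRHS]invrK lef_pV2 ?posrE ?invr_gt0// ltW.
Qed.

(** The measure represents the limit functional of P^n F at 0. Invariance under P comes from
    [markov_contraction], by which P^(n+1) F - P^n F tends to 0 for Hoelder F, rather than from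
    shift invariance of the limit. *)
Lemma stationary_holder_measure_exists : exists nu : probability T R, forall F,
  holder_continuous g F -> \int[nu]_x P F x = \int[nu]_x F x.
Proof.
have [Lim [LimD LimM Limc Limle]] := @banach_limit_exists R.
pose Lam F := Lim (fun n => iter n P F (unitI0 R)).
have bseq F : bounded_measurable F -> bounded_seq (fun n => iter n P F (unitI0 R)).
  by move=> [_ [M hM]]; exists M => n; exact: iter_markov_bounded.
have LamD F G : bounded_measurable F -> bounded_measurable G ->
    Lam (fun x => F x + G x) = Lam F + Lam G.
  move=> bF bG; rewrite /Lam -LimD; [|exact: bseq|exact: bseq].
  by congr Lim; apply/funext => n; exact: iter_markovD.
have LamZ c F : bounded_measurable F -> Lam (fun x => c * F x) = c * Lam F.
  move=> bF; rewrite /Lam -LimM; last exact: bseq.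
  by congr Lim; apply/funext => n; exact: iter_markovZ.
have Lam_le F G : bounded_measurable F -> bounded_measurable G ->
    (forall x, F x <= G x) -> Lam F <= Lam G.
  move=> bF bG FG; apply: Limle; [exact: bseq|exact: bseq|].
  by move=> n; exact: iter_markov_le.
have LamC c : Lam (fun=> c) = c.
  rewrite /Lam; apply: Limc; under eq_fun do rewrite iter_markov_cst.
  exact: cvg_cst.
have [nu hnu] := riesz_representation LamD LamZ Lam_le LamC.
exists nu => F hF.
have hbm G : holder_continuous g G -> bounded_measurable G.
  by move=> hG; exact: (holder_bounded_measurable (g := g)).
have hPF := holder_continuous_markov hF.
rewrite !hnu; do ?[exact: hbm|exact: holder_uniformly_continuous].
apply/eqP; rewrite -subr_eq0; apply/eqP.
have -> : Lam (P F) - Lam F = Lam (fun x => P F x + -1 * F x).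
  rewrite LamD; [|exact: hbm|apply: bounded_measurableM; [exact: bounded_measurable_cst|exact: hbm]].
  by rewrite LamZ ?mulN1r//; exact: hbm.
have [C [rho [C0 /andP[rho0 rho1] hC]]] :=
  markov_contraction alpha g0 pmin0 D0 p_ge p_sum p_holder.
have [A A0 [FA FA']] := holder_osc hF.
apply: Limc; apply: norm_cvg0.
apply: (@squeeze_cvgr _ _ _ _ (fun=> 0 : R) (fun n => C * rho ^+ n * (A + A))).
- apply: nearW => n; rewrite normr_ge0/= iter_markovD iter_markovZ mulN1r -iterSr /=.
  have := hC F A A n A0 A0 FA FA' => h.
  set G := iter n P F in h *.
  have -> : P G (unitI0 R) - G (unitI0 R) =
    p true (unitI0 R) * (G (branch true (unitI0 R)) - G (unitI0 R)) +
    p false (unitI0 R) * (G (branch false (unitI0 R)) - G (unitI0 R)).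
    have -> : p false (unitI0 R) = 1 - p true (unitI0 R) by have := p_sum (unitI0 R); lra.
    rewrite /markov; have -> : p false (unitI0 R) = 1 - p true (unitI0 R) by have := p_sum (unitI0 R); lra.
    by ring.
  have pp i : 0 <= p i (unitI0 R) := le_trans (ltW pmin0) (p_ge i _).
  apply: (le_trans (ler_normD _ _)); rewrite !normrM !(ger0_norm (pp _)).
  rewrite -[leRHS]mul1r -(p_sum (unitI0 R)) mulrDl.
  by apply: lerD; apply: ler_wpM2l.
- exact: cvg_cst.
- have lE : 0 = C * 0 * (A + A) by rewrite mulr0 mul0r.
  rewrite [X in _ --> X]lE; apply: cvgM; last exact: cvg_cst.
  apply: cvgM; first exact: cvg_cst.
  by apply: cvg_expr; rewrite ger0_norm// ltW.
Qed.

Variable nu : probability T R.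
Hypothesis nu_holder : forall F, holder_continuous g F -> \int[nu]_x P F x = \int[nu]_x F x.
Local Notation E F := (\int[nu]_x F x).

Lemma ramp_holder_continuous t e : 0 < e -> holder_continuous g (ramp t e).
Proof.
move=> e0; exists e^-1 => x y.
apply: (@le_trans _ _ (e^-1 * `|ev x - ev y|)); last first.
  by rewrite ler_wpM2l ?invr_ge0 ?(ltW e0)// dist_le_holder.
rewrite /ramp; set a := (t + e - ev x) / e; set b := (t + e - ev y) / e.
have -> : e^-1 * `|ev x - ev y| = `|a - b|.
  have -> : a - b = e^-1 * (ev y - ev x) by rewrite /a /b; ring.
  by rewrite normrM ger0_norm ?invr_ge0 ?(ltW e0)// distrC.
exact: le_trans (minr_dist _ _ _) (maxr_dist _ _ _).
Qed.

Let invariant_set (A : set T) := E (P (\1_A)) = E (\1_A).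

Lemma stationary_initial_segment t : invariant_set (initial_segment t).
Proof.
pose F n := ramp t (n.+1%:R^-1 : R).
have n0 n : 0 < n.+1%:R^-1 :> R by rewrite invr_gt0.
have Fcvg x : F n x @[n --> \oo] --> (\1_(initial_segment t) x : R).
  rewrite indicE; case: (boolP (x \in _)).
    rewrite inE /initial_segment/= => xt; apply: cvg_near_cst.
    by apply: nearW => n; rewrite /F ramp_eq1.
  rewrite notin_setE /initial_segment/= => /negP; rewrite -ltNge => xt.
  apply: cvg_near_cst; near=> n; rewrite /F ramp_eq0//.
  have : n.+1%:R^-1 <= ev x - t.
    near: n; have := @cvg_harmonic R.
    have xt0 : 0 < ev x - t by rewrite subr_gt0.
    move=> /cvgrPdist_le /(_ _ xt0); apply: filterS => n /=.
    by rewrite sub0r normrN ger0_norm.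
  by rewrite lerBrDl.
have bF n : bounded_measurable (F n) by exact: bounded_measurable_ramp.
have b1 : bounded_measurable (\1_(initial_segment t) : T -> R).
  by apply: bounded_measurable_indic; exact: measurable_initial_segment.
have F1 n x : `|F n x| <= 1 by rewrite ger0_norm ?ramp_ge0 ?ramp_le1.
have c1 : E (F n) @[n --> \oo] --> E (\1_(initial_segment t)).
  exact: (@mean_cvg _ _ _ nu F _ 1).
have c2 : E (P (F n)) @[n --> \oo] --> E (P (\1_(initial_segment t))).
  apply: (@mean_cvg _ _ _ nu (fun n => P (F n)) _ 1).
  - by move=> n; exact: bounded_measurable_markov.
  - exact: bounded_measurable_markov.
  - by move=> n x; exact: (iter_markov_bounded 1).
  - move=> x; apply: cvgD; apply: cvgM; do ?exact: cvg_cst; exact: Fcvg.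
have c3 : E (P (F n)) @[n --> \oo] --> E (\1_(initial_segment t)).
  rewrite (_ : (fun n => _) = fun n => E (F n)); first exact: c1.
  by apply/funext => n; apply: nu_holder; exact: ramp_holder_continuous.
exact: (cvg_unique _ c2 c3).
Unshelve. all: by end_near. Qed.

(** Initial segments are limits of ramps, to which the Hoelder identity applies, and are stable
    under intersection; Dynkin's lemma then reaches all Borel sets. *)
Lemma stationary_set (A : set T) : measurable A -> invariant_set A.
Proof.
move: A; suff h : measurable `<=` invariant_set by move=> A; exact: h.
move=> A; rewrite measurable_unitI_generated; apply: (@dynkin_induction _ T (range initial_segment)) => {A}.
- exact: measurable_unitI_generated.
- move=> _ _ [s _ <-] [t _ <-]; exists (Num.min s t) => //.
  by apply/seteqP; split=> x; rewrite /initial_segment/= le_min => /andP.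
- rewrite /invariant_set; apply: eq_mean => x.
  by rewrite indicE in_setT /markov !indicE !in_setT !mulr1 p_sum.
- by move=> _ [t _ <-]; exact: stationary_initial_segment.
- move=> A mA hA; rewrite /invariant_set.
  have AE x : \1_(~` A) x = 1 - \1_A x :> R.
    by rewrite !indicE in_setC; case: (x \in A); rewrite ?subrr ?subr0.
  have bA : bounded_measurable (\1_A : T -> R) by exact: bounded_measurable_indic.
  rewrite (eq_mean nu (h := fun x => 1 - P (\1_A) x)); last first.
    move=> x; rewrite /markov !AE; have := p_sum x.
    have -> : p false x = 1 - p true x by have := p_sum x; lra.
    by move=> _; ring.
  rewrite meanB; [|exact: bounded_measurable_cst|exact: bounded_measurable_markov].
  rewrite hA -meanB//; last exact: bounded_measurable_cst.
  by apply: eq_mean => x; rewrite AE.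
- move=> F mF tF hF; rewrite /invariant_set.
  pose S n (x : T) : R := \sum_(k < n) \1_(F k) x.
  have bS n : bounded_measurable (S n).
    apply: (@bounded_measurable_sum _ _ _ _ _ (fun (k : 'I_n) x => \1_(F k) x)).
    by move=> k; exact: bounded_measurable_indic.
  have SE n x : S n x = \1_(\bigcup_(k < n) F k) x.
    rewrite /S; elim: n => [|n IH].
      by rewrite big_ord0 bigcup_mkord big_ord0 indic0.
    rewrite big_ord_recr/= IH !bigcup_mkord big_ord_recr/= -bigcup_mkord !indicE in_setU.
    have [xF|] := boolP (x \in F n); last by rewrite addr0 orbF.
    rewrite orbT; case: (boolP (x \in \bigcup_(k < n) F k)) => [/set_mem[k /= kn Fkx]|_]; last by rewrite add0r.
    exfalso; move: xF; rewrite inE => Fnx; have kE := tF k n I I (ex_intro _ x (conj Fkx Fnx)).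
    by rewrite kE ltnn in kn.
  have Scvg x : S n x @[n --> \oo] --> (\1_(\bigcup_k F k) x : R).
    rewrite indicE; case: (boolP (x \in _)) => [/[!inE] -[k _ Fkx]|].
      apply: cvg_near_cst; near=> n; rewrite SE indicE mem_set//; exists k => //=.
      by near: n; exact: nbhs_infty_gt.
    rewrite notin_setE => nF; apply: cvg_near_cst; apply: nearW => n.
    rewrite SE indicE memNset// => -[k _ Fkx]; by apply: nF; exists k.
  have S1 n x : `|S n x| <= 1.
    by rewrite SE indicE; case: (_ \in _); rewrite ?normr1 ?normr0.
  have bU : bounded_measurable (\1_(\bigcup_k F k) : T -> R).
    by apply: bounded_measurable_indic; exact: bigcup_measurable.
  have c1 := @mean_cvg _ _ _ nu S _ 1 bS bU S1 Scvg.
  have c2 : E (P (S n)) @[n --> \oo] --> E (P (\1_(\bigcup_k F k))).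
    apply: (@mean_cvg _ _ _ nu (fun n => P (S n)) _ 1).
    - by move=> n; exact: bounded_measurable_markov.
    - exact: bounded_measurable_markov.
    - by move=> n x; exact: (iter_markov_bounded 1).
    - move=> x; apply: cvgD; apply: cvgM; do ?exact: cvg_cst; exact: Scvg.
  have hS n : E (P (S n)) = E (S n).
    elim: n => [|n IHn].
      by apply: eq_mean => x; rewrite /markov /S !big_ord0; ring.
    have SS x : S n.+1 x = S n x + \1_(F n) x by rewrite /S big_ord_recr.
    rewrite (eq_mean nu (h := fun x => P (S n) x + P (\1_(F n)) x)); last first.
      by move=> x; rewrite -markovD /markov !SS.
    have bFn : bounded_measurable (\1_(F n) : T -> R) by exact: bounded_measurable_indic.
    rewrite (eq_mean nu SS) [LHS]meanD ?[RHS]meanD ?IHn ?hF//; exact: bounded_measurable_markov.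
  have c3 : E (P (S n)) @[n --> \oo] --> E (\1_(\bigcup_k F k)).
    rewrite (_ : (fun n => _) = fun n => E (S n)); first exact: c1.
    by apply/funext => n; exact: hS.
  exact: (cvg_unique _ c2 c3).
Unshelve. all: by end_near. Qed.


Lemma stationary_mean_ge0 F : bounded_measurable F -> (forall x, 0 <= F x) -> E (P F) = E F.
Proof.
move=> bF F0; have [mF [M hM]] := bF.
apply/eqP; rewrite -subr_eq0 -normr_le0; apply/ler_addgt0Pr => d d0; rewrite add0r.
have e0 : 0 < d / 2 by rewrite divr_gt0.
set e := d / 2 in e0.
have mA (c : R) : measurable [set x | c <= F x].
  rewrite (_ : [set _ | _] = F @^-1` `[c, +oo[%classic); first exact: measurable_preimage.
  by apply/seteqP; split=> x /=; rewrite in_itv/= andbT.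
have ind c : bounded_measurable (\1_[set x | c <= F x] : T -> R).
  by apply: bounded_measurable_indic; exact: mA.
(* Superlevel sets at multiples of e: once m e exceeds the bound of F, this sum is within e of F
   uniformly. *)
pose S m (x : T) : R := \sum_(k < m) e * \1_[set x | k.+1%:R * e <= F x] x.
have SS m x : S m.+1 x = S m x + e * \1_[set x | m.+1%:R * e <= F x] x.
  by rewrite /S big_ord_recr.
have bS m : bounded_measurable (S m).
  elim: m => [|m IH].
    rewrite (_ : S 0%N = fun=> 0); first exact: bounded_measurable_cst.
    by apply/funext => x; rewrite /S big_ord0.
  rewrite (funext (SS m)); apply: bounded_measurableD => //.
  by apply: bounded_measurableM => //; exact: bounded_measurable_cst.
have hS m : E (P (S m)) = E (S m).
  elim: m => [|m IH].
    by apply: eq_mean => x; rewrite /markov /S !big_ord0; ring.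
  rewrite (eq_mean nu (h := fun x => P (S m) x + e * P (\1_[set x | m.+1%:R * e <= F x]) x)); last first.
    by move=> x; rewrite -markovZ -markovD /markov !SS.
  rewrite (eq_mean nu (SS m)) [LHS]meanD ?[RHS]meanD ?meanZ ?IH ?stationary_set//;
    do ?[exact: bounded_measurable_cst|exact: bS|exact: ind|exact: mA
      |apply: bounded_measurable_markov|apply: bounded_measurableM].
have approx m x : (m%:R * e <= F x -> S m x = m%:R * e) /\
    (F x < m%:R * e -> F x - e <= S m x <= F x).
  elim: m => [|m [IH1 IH2]].
    by rewrite /S big_ord0 mul0r; split=> //; have := F0 x => ? ?; lra.
  have mE : m.+1%:R * e = m%:R * e + e by rewrite -natr1 mulrDl mul1r.
  rewrite SS indicE; have [h|h] := boolP (x \in _).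
    have h' : m.+1%:R * e <= F x by move: h; rewrite inE.
    by split=> [_|]; [rewrite IH1 ?mE ?mulr1//; lra|rewrite ltNge h'].
  have h' : F x < m.+1%:R * e by move: h; rewrite notin_setE /= => /negP; rewrite -ltNge.
  rewrite mulr0 addr0; split=> [|_]; first by rewrite leNgt h'.
  by have [k|k] := leP (m%:R * e) (F x); [rewrite IH1//; lra|exact: IH2].
have [m hm] : exists m : nat, M < m%:R * e.
  exists (Num.trunc (M / e)).+1; rewrite -ltr_pdivrMr//.
  exact: Num.Theory.truncnS_gt.
have FS x : `|F x - S m x| <= e.
  have := (approx m x).2 (le_lt_trans (le_trans (ler_norm _) (hM x)) hm).
  by move=> /andP[? ?]; rewrite ler_norml; apply/andP; split; lra.
have bFS : bounded_measurable (fun x => F x - S m x) by exact: bounded_measurableB.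
have -> : E (P F) - E F = E (P (fun x => F x - S m x)) - E (fun x => F x - S m x).
  rewrite (eq_mean nu (g := P (fun x => F x - S m x)) (h := fun x => P F x - P (S m) x)); last first.
    by move=> x; rewrite /markov; ring.
  rewrite [X in _ = X - _]meanB ?[X in _ = _ - X]meanB ?hS//; do ?exact: bounded_measurable_markov.
  by ring.
have -> : d = e + e by rewrite /e; field.
apply: (le_trans (ler_normB _ _)); apply: lerD.
  by apply: mean_norm_le => [|x]; [exact: bounded_measurable_markov|exact: (iter_markov_bounded 1)].
exact: mean_norm_le.
Qed.

Lemma stationary_mean F : bounded_measurable F -> E (P F) = E F.
Proof.
move=> bF; have [_ [M hM]] := bF.
have bFM : bounded_measurable (fun x => F x + M).
  by apply: bounded_measurableD => //; exact: bounded_measurable_cst.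
have := stationary_mean_ge0 bFM; rewrite (eq_mean nu (h := fun x => P F x + M)); last first.
  by move=> x; rewrite -{2}(markov_cst M x) -markovD.
rewrite [LHS]meanD ?[RHS]meanD//; do ?[exact: bounded_measurable_cst|exact: bounded_measurable_markov].
move=> h; apply: (addIr _ (h _)) => x.
by have := hM x; rewrite ler_norml -lerBlDr sub0r => /andP[].
Qed.

Lemma branch_eq0 i x : (branch i x == unitI0 R) = ~~ i && (x == unitI0 R).
Proof.
apply/idP/idP => [h|]; last by case: i => //= /eqP ->; rewrite branch0_0.
apply/andP; split; last by apply: contraLR h; exact: branch_neq0.
apply: contraL h => ->; apply/eqP => h.
have := lt_le_trans (breakpoint_gt0 alpha) (breakpoint_le_branch1 alpha x).
by rewrite h ltxx.
Qed.

Lemma measurable_set1_unitI (x : T) : measurable [set x].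
Proof.
rewrite (_ : [set x] = ev @^-1` [set ev x]).
  by apply: measurable_preimage => //; exact: measurable_unitI_val.
by apply/seteqP; split=> y /=; [move=> ->|move/unitI_val_inj].
Qed.

(** Branch 0 fixes 0 and branch 1 never reaches it, so that P multiplies the indicator of 0 by its
    branch-0 weight at 0, which is less than 1. This removes the only point at which f o y_i may
    differ from the identity. *)
Lemma mean_indic0 : E (\1_[set unitI0 R]) = 0.
Proof.
have m0 := measurable_set1_unitI (unitI0 R).
have b0 : bounded_measurable (\1_[set unitI0 R] : T -> R) by exact: bounded_measurable_indic.
have i0 i x : (\1_[set unitI0 R] (branch i x) : R) = (~~ i)%:R * \1_[set unitI0 R] x.
  have e y : (\1_[set unitI0 R] y : R) = (y == unitI0 R)%:R.
    by rewrite indicE; congr (nat_of_bool _)%:R; apply/idP/eqP; rewrite inE.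
  by rewrite !e branch_eq0; case: i; case: (x == _); rewrite /= ?mul0r ?mul1r.
have := stationary_mean b0.
rewrite (eq_mean nu (h := fun x => p false (unitI0 R) * \1_[set unitI0 R] x)); last first.
  move=> x; rewrite /markov !i0 /= mul0r mulr0 add0r mul1r indicE.
  by have [/set_mem ->//|_] := boolP (x \in _); rewrite !mulr0.
rewrite meanZ// => h; apply/eqP; move/eqP: h; rewrite -subr_eq0.
rewrite -[X in _ - X]mul1r -mulrBl mulf_eq0 => /orP[|//].
rewrite subr_eq0 => /eqP pf1; have := p_sum (unitI0 R); have := p_ge true (unitI0 R).
by move: pmin0; rewrite pf1; lra.
Qed.

Lemma eq_mean_neq0 F G : bounded_measurable F -> bounded_measurable G ->
  (forall x, x != unitI0 R -> F x = G x) -> E F = E G.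
Proof.
move=> bF bG FG; have m0 := measurable_set1_unitI (unitI0 R).
have b0 : bounded_measurable (\1_[set unitI0 R] : T -> R) by exact: bounded_measurable_indic.
have -> : F = fun x => G x + (F (unitI0 R) - G (unitI0 R)) * \1_[set unitI0 R] x.
  apply/funext => x; rewrite indicE; have [/set_mem ->|] := boolP (x \in _).
    by rewrite mulr1 addrC subrK.
  by rewrite notin_setE /= => /eqP x0; rewrite mulr0 addr0 FG.
rewrite meanD ?meanZ ?mean_indic0 ?mulr0 ?addr0//.
by apply: bounded_measurableM => //; exact: bounded_measurable_cst.
Qed.

Lemma stationary_duality_step (F G : T -> R) : bounded_measurable F -> bounded_measurable G ->
  E (fun x => F (f x) * G x) = E (fun x => F x * P G x).
Proof.
move=> bF bG.
have bFf : bounded_measurable (fun x => F (f x)).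
  by apply: (bounded_measurable_comp (u := f)) => //; exact: measurable_intermittent_map.
have bFfG : bounded_measurable (fun x => F (f x) * G x) by exact: bounded_measurableM.
rewrite -(stationary_mean bFfG); apply: eq_mean_neq0.
- exact: bounded_measurable_markov.
- by apply: bounded_measurableM => //; exact: bounded_measurable_markov.
- by move=> x x0; rewrite /markov !branchK//; ring.
Qed.

Lemma stationary_duality n (F G : T -> R) : bounded_measurable F -> bounded_measurable G ->
  E (fun x => F (iter n f x) * G x) = E (fun x => F x * iter n P G x).
Proof.
elim: n F G => // n IH F G bF bG.
rewrite iterSr -IH//; last exact: bounded_measurable_markov.
rewrite -stationary_duality_step//; last first.
  by apply: (bounded_measurable_comp (u := iter n f)) => //; exact: measurable_iter_map.
by apply: eq_mean => x; rewrite iterSr.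
Qed.

Lemma stationary_invariant : invariant_probability alpha nu.
Proof.
move=> A mA; have mfA : measurable (f @^-1` A).
  by apply: measurable_preimage => //; exact: measurable_intermittent_map.
have b1 (B : set T) : measurable B -> bounded_measurable (\1_B : T -> R).
  by move=> mB; exact: bounded_measurable_indic.
have h := stationary_duality_step (b1 A mA) (bounded_measurable_cst _ 1).
rewrite -[LHS]fineK ?fin_num_measure// -[RHS]fineK ?fin_num_measure// -!mean_indic//.
congr EFin.
transitivity (E (fun x => \1_A (f x) * 1 : R)).
  by apply: eq_mean => x; rewrite mulr1.
by rewrite h; apply: eq_mean => x; rewrite markov_cst mulr1.
Qed.

Lemma stationary_iter_mean n F : bounded_measurable F -> E (iter n P F) = E F.
Proof.
move=> bF; elim: n => //= n IH; rewrite stationary_mean//.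
exact: bounded_measurable_iter_markov.
Qed.

(** By duality the correlation is the integral of F (P^n G - int G), and P^n G is uniformly close to
    its mean; no regularity of F is involved. *)
Lemma stationary_mixing : exponentially_mixing alpha nu.
Proof.
have [C [rho [C0 rho01 hC]]] := markov_contraction alpha g0 pmin0 D0 p_ge p_sum p_holder.
exists (2 * C), rho; split=> //; first by rewrite mulr_gt0.
move=> F G n mF [M [_ hM]] hG.
have FM : exists M, forall x, `|F x| <= M by exists (M + 1) => x; apply: hM => //; rewrite ltrDl.
have bF : bounded_measurable F by [].
have bG : bounded_measurable G by apply: (holder_bounded_measurable (g := 1)).
set A := holder_seminorm 1 G; pose S := sup_norm F.
have hA x y : `|G x - G y| <= A * `|ev x - ev y|.
  by have := le_holder_seminorm x y hG; rewrite powRr1.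
have A0 : 0 <= A.
  have := hA unitI1 (unitI0 R); rewrite /= subr0 normr1 mulr1.
  exact: le_trans.
have GO x y : `|G x - G y| <= A.
  by apply: (le_trans (hA x y)); rewrite ler_piMr ?unitI_dist_le1.
have GA x y : `|G x - G y| <= A * dist x y.
  by apply: (le_trans (hA x y)); rewrite ler_wpM2l ?dist_le_holder.
have key x : `|iter n P G x - E G| <= 2 * C * A * rho ^+ n.
  rewrite -(stationary_iter_mean n bG) -(mean_cst nu (iter n P G x)) -meanB; first last.
  - exact: bounded_measurable_iter_markov.
  - exact: bounded_measurable_cst.
  apply: mean_norm_le.
    by apply: bounded_measurableB; [exact: bounded_measurable_cst|exact: bounded_measurable_iter_markov].
  move=> y; apply: (le_trans (hC G A A n A0 A0 GO GA x y)).
  by rewrite le_eqVlt; apply/predU1P; left; ring.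
have bK : bounded_measurable (fun x => iter n P G x - E G).
  by apply: bounded_measurableB; [exact: bounded_measurable_iter_markov|exact: bounded_measurable_cst].
rewrite stationary_duality// [E F * _]mulrC -meanZ// -meanB; first last.
- by apply: bounded_measurableM => //; exact: bounded_measurable_cst.
- by apply: bounded_measurableM => //; exact: bounded_measurable_iter_markov.
apply: mean_norm_le.
  by apply: bounded_measurableB; apply: bounded_measurableM => //;
    [exact: bounded_measurable_iter_markov|exact: bounded_measurable_cst].
move=> x; rewrite [E G * _]mulrC -mulrBr normrM.
apply: (@le_trans _ _ (S * (2 * C * A * rho ^+ n))).
  by apply: ler_pM => //; exact: le_sup_norm.
by rewrite le_eqVlt; apply/predU1P; left; rewrite /S; ring.
Qed.

Lemma bounded_measurable_word (w : seq bool) n :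
  bounded_measurable (\1_[set x : T | word alpha n x = w] : T -> R).
Proof. by apply: bounded_measurable_indic; exact: measurable_word. Qed.

(** One application of stationarity peels the first digit off a cylinder. *)
Lemma mean_word_cons i w F : bounded_measurable F ->
  E (fun x => \1_[set x | word alpha (size w).+1 x = i :: w] x * F x) =
  E (fun x => \1_[set x | word alpha (size w) x = w] x * (p i x * F (branch i x))).
Proof.
move=> bF; have b1 := bounded_measurable_word.
rewrite -stationary_mean; last exact: bounded_measurableM.
apply: eq_mean_neq0.
- by apply: bounded_measurable_markov; exact: bounded_measurableM.
- apply: bounded_measurableM => //; apply: bounded_measurableM.
    exact: bounded_measurable_p.
  exact: bounded_measurable_branch.
move=> x x0; rewrite /markov !indicE.
have cE j : (branch j x \in [set x | word alpha (size w).+1 x = i :: w]) =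
    (j == i) && (x \in [set x | word alpha (size w) x = w]).
  apply/idP/andP => [/set_mem/=|[/eqP -> /set_mem/= xw]].
    by rewrite wordS digit_branch// branchK// => -[-> h]; split=> //; rewrite inE.
  by rewrite inE /= wordS digit_branch// branchK// xw.
by rewrite !cE; case: (i); rewrite /= ?mul0r ?mulr0 ?addr0 ?add0r; ring.
Qed.

End stationary_measure.

(** * Equilibrium states *)

Section holder_operations.
Context {R : realType}.
Local Notation T := (unitI R).
Local Notation ev := (@unitI_val R).
Variable g : R.
Local Notation dist x y := (`|ev x - ev y| `^ g).

Lemma holder_quotient (u v : T -> R) (U V B c : R) (x y : T) : 0 < c -> 0 <= V ->
  `|u x - u y| <= U * dist x y -> `|v x - v y| <= V * dist x y ->
  `|u y| <= B -> c <= v x -> c <= v y ->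
  `|u x / v x - u y / v y| <= (U / c + B * V / c ^+ 2) * dist x y.
Proof.
move=> c0 V0 hu hv hB cx cy; have vx0 := lt_le_trans c0 cx; have vy0 := lt_le_trans c0 cy.
have xn : v x != 0 by rewrite gt_eqF.
have yn : v y != 0 by rewrite gt_eqF.
have -> : u x / v x - u y / v y = (u x - u y) / v x + u y * (v y - v x) / (v x * v y).
  by field; rewrite xn yn.
apply: (le_trans (ler_normD _ _)); rewrite [X in _ <= X]mulrDl; apply: lerD.
  rewrite normrM mulrAC; apply: ler_pM => //; rewrite ger0_norm ?invr_ge0 ?(ltW vx0)//.
  by rewrite lef_pV2 ?posrE.
have -> : B * V / c ^+ 2 * dist x y = B * (V * dist x y) / c ^+ 2 by ring.
rewrite normrM; apply: ler_pM => //.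
  by rewrite normrM; apply: ler_pM => //; rewrite distrC.
rewrite ger0_norm ?invr_ge0 ?mulr_ge0 ?(ltW vx0) ?(ltW vy0)//.
rewrite lef_pV2 ?posrE ?exprn_gt0 ?mulr_gt0// expr2.
by apply: ler_pM => //; exact: ltW.
Qed.

End holder_operations.

Section equilibrium.
Context {R : realType} (alpha : {posnum R}).
Local Notation T := (unitI R).
Local Notation f := (intermittent_map alpha).
Local Notation ev := (@unitI_val R).
Local Notation branch := (branch alpha).
Local Notation wbranch := (wbranch alpha).
Variables (g : R) (phi h : T -> R) (lam c : R).
Hypotheses (g0 : 0 < g) (g1 : g <= 1) (phi_holder : holder_continuous g phi)
  (c0 : 0 < c) (h_bounds : forall x, c <= h x <= 1) (h_holder : holder_continuous g h)
  (h_eigen : forall x, transfer alpha phi h x = lam * h x).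
Local Notation dist x y := (`|ev x - ev y| `^ g).

Lemma eigenvalue_pos : 0 < lam.
Proof.
have hp x : 0 < h x by have /andP[k _] := h_bounds x; exact: lt_le_trans k.
have : 0 < lam * h (unitI0 R).
  by rewrite -h_eigen transferE addr_gt0// mulr_gt0 ?expR_gt0.
by rewrite pmulr_lgt0.
Qed.

(** Conjugation of L / lam by h: the Markov operator with these weights is F |-> L (h F) / (lam h),
    and the eigenvalue equation says that they sum to 1. *)
Definition normalized_weight (i : bool) (x : T) : R :=
  expR (phi (branch i x)) * h (branch i x) / (lam * h x).
Local Notation p := normalized_weight.

Let h_pos x : 0 < h x.
Proof. by have /andP[k _] := h_bounds x; exact: lt_le_trans k. Qed.

Lemma normalized_weight_sum x : p true x + p false x = 1.
Proof.
rewrite /p -mulrDl -transferE h_eigen divff//.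
by rewrite gt_eqF// mulr_gt0// eigenvalue_pos.
Qed.

Lemma normalized_weight_ge : exists2 pmin, 0 < pmin & forall i x, pmin <= p i x.
Proof.
have lam0 := eigenvalue_pos; have [S S0 hS] := phi_bound g0 phi_holder.
exists (expR (- S) * c / lam); first by rewrite divr_gt0// mulr_gt0 ?expR_gt0.
move=> i x; have /andP[h1 h2] := h_bounds x; have /andP[h3 _] := h_bounds (branch i x).
apply: ler_pM.
- by rewrite mulr_ge0 ?expR_ge0 ?(ltW c0).
- by rewrite invr_ge0 ltW.
- apply: ler_pM; rewrite ?expR_ge0 ?(ltW c0)// ler_expR.
  by have := hS (branch i x); rewrite ler_norml => /andP[].
- rewrite lef_pV2 ?posrE ?mulr_gt0//.
  by rewrite ler_piMr// ltW.
Qed.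

Lemma normalized_weight_holder : exists2 D, 0 < D &
  forall x y, `|p true x - p true y| <= D * dist x y.
Proof.
have lam0 := eigenvalue_pos; have [S S0 hS] := phi_bound g0 phi_holder.
have [M M0 hM] := holder_pos_const phi_holder.
have [N N0 hN] := holder_pos_const h_holder.
have eS := expR_gt0 S.
have hb x : `|h x| <= 1 by rewrite ger0_norm ?(ltW (h_pos x))//; have /andP[] := h_bounds x.
have phiS x : phi x <= S by have := hS x; rewrite ler_norml => /andP[].
exists ((expR S * M + expR S * N) / (lam * c) + expR S * (lam * N) / (lam * c) ^+ 2).
  by rewrite addr_gt0 ?divr_gt0 ?addr_gt0 ?exprn_gt0 ?mulr_gt0.
move=> x y.
apply: (@holder_quotient _ g (fun x => expR (phi (branch true x)) * h (branch true x))
  (fun x => lam * h x)).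
- by rewrite mulr_gt0.
- by rewrite mulr_ge0 ?ltW.
- have -> : expR (phi (branch true x)) * h (branch true x) -
     expR (phi (branch true y)) * h (branch true y) =
     (expR (phi (branch true x)) - expR (phi (branch true y))) * h (branch true x) +
     expR (phi (branch true y)) * (h (branch true x) - h (branch true y)) by ring.
  apply: (le_trans (ler_normD _ _)); rewrite [X in _ <= X]mulrDl; apply: lerD.
    rewrite normrM -[leRHS]mulr1; apply: ler_pM => //.
    apply: (le_trans (expR_dist_le (phiS _) (phiS _))); rewrite -mulrA ler_wpM2l ?(ltW eS)//.
    apply: (le_trans (hM _ _)); rewrite ler_wpM2l ?(ltW M0)//.
    exact: holder_branch_dist.
  rewrite normrM -mulrA; apply: ler_pM => //.
    by rewrite ger0_norm ?expR_ge0// ler_expR.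
  apply: (le_trans (hN _ _)); rewrite ler_wpM2l ?(ltW N0)//.
  exact: holder_branch_dist.
- rewrite -mulrBr normrM (ger0_norm (ltW lam0)) -mulrA ler_wpM2l ?(ltW lam0)//.
- rewrite normrM -[leRHS]mulr1; apply: ler_pM => //.
  by rewrite ger0_norm ?expR_ge0// ler_expR.
- by rewrite ler_wpM2l ?(ltW lam0)//; have /andP[] := h_bounds x.
- by rewrite ler_wpM2l ?(ltW lam0)//; have /andP[] := h_bounds y.
Qed.

Section stationary_entropy.
Variables (nu : probability T R) (pmin D : R).
Hypotheses (pmin0 : 0 < pmin)
  (p_ge : forall i x, pmin <= p i x)
  (p_holder : forall x y, `|p true x - p true y| <= D * dist x y)
  (nu_holder : forall F, holder_continuous g F ->
     \int[nu]_x markov alpha p F x = \int[nu]_x F x).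
Local Notation E F := (\int[nu]_x F x).

Let nu_inv : invariant_probability alpha nu :=
  stationary_invariant g0 g1 pmin0 p_ge normalized_weight_sum p_holder nu_holder.

Let word_cons i w (F : T -> R) (bF : bounded_measurable F) :=
  mean_word_cons g0 g1 pmin0 p_ge normalized_weight_sum p_holder nu_holder i w bF.

Let bounded_measurable_cell (w : seq bool) n :
  bounded_measurable (\1_[set x : T | word alpha n x = w] : T -> R) := bounded_measurable_word alpha w n.

Let pmf_cell n (w : n.-tuple bool) :
  pmf nu (cylinder alpha n) w = E (\1_[set x : T | word alpha n x = w]).
Proof.
rewrite mean_indic; last exact: measurable_word.
rewrite /pmf; congr (fine (nu _)); apply/seteqP; split=> x /= => [<-//|xw].
exact: val_inj.
Qed.

(** Each weight is at most 1 - pmin because the other is at least pmin. Exponentially small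
    cylinders are what makes the entropy positive. *)
Lemma cell_le_pmin w :
  E (\1_[set x : T | word alpha (size w) x = w]) <= (1 - pmin) ^+ size w.
Proof.
have q0 : 0 <= 1 - pmin.
  by rewrite subr_ge0 ltW//; exact: (pmin_lt1 pmin0 p_ge normalized_weight_sum).
elim: w => [|i w IH].
  rewrite (eq_mean nu (h := fun=> 1)) ?mean_cst// => x.
  by rewrite indicE mem_set.
rewrite (eq_mean nu (h := fun x => \1_[set x | word alpha (size w).+1 x = i :: w] x * 1)); last first.
  by move=> x; rewrite mulr1.
rewrite word_cons; last exact: bounded_measurable_cst.
rewrite exprS; apply: (le_trans _ (ler_wpM2l q0 IH)).
rewrite -meanZ//; apply: mean_le.
- apply: bounded_measurableM => //; apply: bounded_measurableM; last exact: bounded_measurable_cst.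
  exact: (bounded_measurable_p g0 pmin0 p_ge normalized_weight_sum p_holder).
- by apply: bounded_measurableM => //; exact: bounded_measurable_cst.
move=> x; rewrite mulr1 mulrC ler_wpM2r ?indicE//.
have := normalized_weight_sum x; have := p_ge (~~ i) x.
by case: (i) => /=; lra.
Qed.

Lemma cell_entropy_ge n : n%:R * - ln (1 - pmin) <= shannon_entropy nu (cylinder alpha n).
Proof.
have q0 : 0 < 1 - pmin.
  by rewrite subr_gt0; exact: (pmin_lt1 pmin0 p_ge normalized_weight_sum).
have sp := sum_pmf nu (@simple_cylinder _ alpha n).
have -> : n%:R * - ln (1 - pmin) =
    - \sum_w pmf nu (cylinder alpha n) w * (n%:R * ln (1 - pmin)).
  by rewrite -mulr_suml sp mul1r mulrN.
rewrite /shannon_entropy lerN2; apply: ler_sum => w _.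
have [->|pw] := eqVneq (pmf nu (cylinder alpha n) w) 0; first by rewrite !mul0r.
rewrite ler_wpM2l ?pmf_ge0// mulr_natl -lnXn// ler_ln ?posrE ?exprn_gt0//.
  by rewrite pmf_cell; have := cell_le_pmin w; rewrite size_tuple.
by rewrite lt_neqAle eq_sym pw pmf_ge0.
Qed.

(* The measure m of density 1/h with respect to nu is conformal: y_i carries it
   to a measure with m (y_i A) = lam^-1 int_A e^(phi o y_i) dm. *)
Lemma cell_le_branch_sum (e : R) : 0 < e -> exists2 C, 0 < C & forall w y,
  E (\1_[set x : T | word alpha (size w) x = w]) <=
  C * expR (branch_sum alpha phi w y + e * (size w)%:R) / lam ^+ size w.
Proof.
move=> e0; have lam0 := eigenvalue_pos.
have [t /andP[t0 t1] [M M0 hM]] := branch_distortion alpha g0 phi_holder e0.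
(* Sum of M t^j over j <= n, which collects the summable part of the distortion errors along the
   word. *)
pose B (n : nat) : R := M * (1 - t ^+ n.+1) / (1 - t).
have BS n : B n.+1 = B n + M * t ^+ n.+1.
  by rewrite /B !exprS; field; rewrite gt_eqF// subr_gt0.
have B_le n : B n <= M / (1 - t).
  rewrite /B ler_wpM2r ?invr_ge0 ?subr_ge0 ?(ltW t1)// ler_piMr ?(ltW M0)//.
  by rewrite gerBl exprn_ge0 ?ltW.
have bh : bounded_measurable (fun x => (h x)^-1).
  apply: (@holder_bounded_measurable _ g) => //.
  have [N N0 hN] := holder_pos_const h_holder.
  exists (0 / c + 1 * N / c ^+ 2) => x y; rewrite -(mul1r (h x)^-1) -(mul1r (h y)^-1).
  apply: (@holder_quotient _ g (fun=> 1) h); rewrite ?subrr ?normr0 ?mul0r ?normr1 ?(ltW N0)//.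
  - by have /andP[] := h_bounds x.
  - by have /andP[] := h_bounds y.
have key w y : E (fun x => \1_[set x : T | word alpha (size w) x = w] x * (h x)^-1) <=
   c^-1 * expR (branch_sum alpha phi w y + e * (size w)%:R + B (size w)) / lam ^+ size w.
  elim: w => [|i w IH].
    rewrite expr0 invr1 mulr1 /= mulr0 addr0 add0r.
    apply: (@le_trans _ _ c^-1).
      rewrite -[leRHS](mean_cst nu); apply: mean_le => //; do ?exact: bounded_measurable_cst.
        exact: bounded_measurableM.
      move=> x; rewrite indicE mem_set// mul1r lef_pV2 ?posrE//.
      by have /andP[] := h_bounds x.
    rewrite ler_peMr ?invr_ge0 ?(ltW c0)// -[leLHS]expR0 ler_expR /B mulr_ge0 ?invr_ge0 ?subr_ge0 ?(ltW t1)//.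
    by rewrite mulr_ge0 ?(ltW M0)// subr_ge0 expr1 ltW.
  rewrite [size _]/= word_cons//.
  pose k : R := expR (phi (wbranch (i :: w) y) + (e + M * t ^+ (size w).+1)) / lam.
  have k0 : 0 <= k by rewrite divr_ge0 ?expR_ge0 ?ltW.
  apply: (@le_trans _ _ (k * E (fun x => \1_[set x : T | word alpha (size w) x = w] x * (h x)^-1))).
    rewrite -meanZ; last exact: bounded_measurableM.
    apply: mean_le.
    - apply: bounded_measurableM => //; apply: bounded_measurableM.
        exact: (bounded_measurable_p g0 pmin0 p_ge normalized_weight_sum p_holder).
      exact: (bounded_measurable_branch _ _ bh).
    - by apply: bounded_measurableM; [exact: bounded_measurable_cst|exact: bounded_measurableM].
    move=> x; rewrite indicE; have [/set_mem/= xw|] := boolP (x \in _); last by rewrite !mul0r mulr0.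
    rewrite !mul1r.
    have -> : p i x / h (branch i x) = expR (phi (branch i x)) / lam * (h x)^-1.
      by rewrite /p; field; rewrite !gt_eqF.
    rewrite ler_wpM2r ?invr_ge0 ?(ltW (h_pos x))// /k ler_wpM2r ?invr_ge0 ?(ltW lam0)//.
    rewrite ler_expR -lerBlDl.
    have -> : branch i x = wbranch (i :: w) (iter (size w) f x).
      by rewrite -{1}(wbranch_word alpha (size w) x) xw.
    by apply: (le_trans (ler_norm _)); exact: hM.
  apply: (le_trans (ler_wpM2l k0 IH)).
  rewrite /k le_eqVlt; apply/predU1P; left.
  rewrite BS [lam ^+ _.+1]exprS invfM -natr1 [branch_sum _ _ (i :: w) _]/=.
  have -> : phi (branch i (wbranch w y)) + branch_sum alpha phi w y + e * ((size w)%:R + 1) +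
    (B (size w) + M * t ^+ (size w).+1) = (phi (branch i (wbranch w y)) + (e + M * t ^+ (size w).+1)) +
    (branch_sum alpha phi w y + e * (size w)%:R + B (size w)) by ring.
  by rewrite [in RHS]expRD; ring.
exists (c^-1 * expR (M / (1 - t))) => [|w y]; first by rewrite mulr_gt0 ?invr_gt0 ?expR_gt0.
apply: (@le_trans _ _ (E (fun x => \1_[set x : T | word alpha (size w) x = w] x * (h x)^-1))).
  apply: mean_le => //; first exact: bounded_measurableM.
  move=> x; rewrite ler_peMr ?indicE// invf_ge1//.
  by have /andP[] := h_bounds x.
apply: (le_trans (key w y)); rewrite ler_wpM2r ?invr_ge0 ?exprn_ge0 ?(ltW lam0)//.
rewrite expRD -mulrA ler_wpM2l ?invr_ge0 ?(ltW c0)// mulrC ler_wpM2r ?expR_ge0//.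
by rewrite ler_expR.
Qed.

(** Average of the logarithm of the bound on cells; the counterpart of [cylinder_entropy_le], with
    which it determines the limit of the normalized entropies. *)
Lemma cylinder_entropy_ge (e : R) : 0 < e -> exists K, forall n,
  n%:R * (ln lam - E phi - e) - K <= shannon_entropy nu (cylinder alpha n).
Proof.
move=> e0; have lam0 := eigenvalue_pos; have e2 : 0 < e / 2 by rewrite divr_gt0.
have [C C0 hC] := cell_le_branch_sum e2.
have [K hK] := mean_branch_sum g0 phi_holder nu_inv e2.
exists (ln C + K) => n; pose y := unitI0 R.
pose q (w : n.-tuple bool) := n%:R * ln lam - ln C - n%:R * (e / 2) - branch_sum alpha phi w y.
have sp := sum_pmf nu (@simple_cylinder _ alpha n).
have H : \sum_w pmf nu (cylinder alpha n) w * q w <= shannon_entropy nu (cylinder alpha n).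
  rewrite /shannon_entropy -sumrN; apply: ler_sum => w _; rewrite -mulrN.
  have [->|pw] := eqVneq (pmf nu (cylinder alpha n) w) 0; first by rewrite !mul0r.
  have pw0 : 0 < pmf nu (cylinder alpha n) w by rewrite lt_neqAle eq_sym pw pmf_ge0.
  rewrite ler_wpM2l ?pmf_ge0//.
  have := hC w y; rewrite size_tuple -pmf_cell => h1.
  have := h1; rewrite -ler_ln ?posrE//; last by rewrite divr_gt0 ?exprn_gt0 ?mulr_gt0 ?expR_gt0.
  rewrite ln_div ?posrE ?exprn_gt0 ?mulr_gt0 ?expR_gt0// lnM ?posrE ?expR_gt0// expRK lnXn//.
  rewrite -mulr_natl /q; lra.
apply: le_trans H.
rewrite (eq_bigr (fun w => pmf nu (cylinder alpha n) w * (n%:R * ln lam - ln C - n%:R * (e / 2)) -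
   pmf nu (cylinder alpha n) w * branch_sum alpha phi w y)); last by move=> w _; rewrite /q mulrBr.
rewrite sumrB -mulr_suml sp mul1r.
have := hK n y; rewrite ler_norml => /andP[_]; lra.
Qed.

Lemma equilibrium_entropy : entropy nu f = (ln lam - E phi)%:E.
Proof.
have lam0 := eigenvalue_pos; have invc : 0 < 1 / c by rewrite divr_gt0.
have hz x : transfer alpha phi h x <= lam * h x by rewrite h_eigen.
have growth := supersolution_growth c0 lam0 h_bounds hz.
have gr n : iter n (transfer alpha phi) (fun=> 1) (unitI0 R) <= 1 / c * lam ^+ n by exact: growth.
have ub := cylinder_entropy_le g0 phi_holder nu_inv lam0 invc gr.
apply/eqP; rewrite eq_le (entropy_le g0 phi_holder nu_inv lam0 invc gr)/=.
(* The refinements of the partition by the first digit are the cylinders, so that this partition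
   attains the supremum. *)
pose a (x : T) : 'I_2 := if digit alpha x then ord_max else ord0.
apply: ereal_sup_ge; exists (partition_entropy nu f (fun i => a @^-1` [set i]))%:E.
  exists 2%N, (fun i => a @^-1` [set i]); split=> //; split.
  - move=> i; rewrite (_ : a @^-1` [set i] = digit alpha @^-1` [set (i == ord_max)]).
      by apply: (measurable_preimage (@measurable_digit _ alpha)).
    have aE x : (a x == ord_max) = digit alpha x by rewrite /a; case: digit.
    apply/seteqP; split=> x /=; first by move=> <-; rewrite aE.
    rewrite /a => ->; case: eqVneq => [->//|].
    by case: i => -[|[|//]] //= i2 h1; apply: val_inj.
  - by move=> i j _ _ [x [/= <- <-]].
  - by apply/seteqP; split=> // x _; exists (a x).
rewrite lee_fin /partition_entropy.
rewrite (_ : (fun n => _) = fun n => shannon_entropy nu (cylinder alpha n) / n%:R).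
  by rewrite (cvg_lim _ (cvgn_linear_growth ub cylinder_entropy_ge)).
apply/funext => n; congr (_ / _); rewrite refinement_entropyE.
(* Each labelling is a function of the other, and entropy does not increase under functions, so that
   both have the same entropy. *)
pose to_ffun (w : n.-tuple bool) : {ffun 'I_n -> 'I_2} :=
  [ffun i => if tnth w i then ord_max else ord0].
pose of_ffun (v : {ffun 'I_n -> 'I_2}) : n.-tuple bool := [tuple v i == ord_max | i < n].
have digits x i : tnth (cylinder alpha n x) i = digit alpha (iter i f x).
  by rewrite (tnth_nth false) /= (nth_map 0%N) ?size_iota// nth_iota.
have XE : (fun x => [ffun i : 'I_n => a (iter i f x)]) = to_ffun \o cylinder alpha n.
  by apply/funext => x; apply/ffunP => i; rewrite !ffunE digits.
have cylE : of_ffun \o (to_ffun \o cylinder alpha n) = cylinder alpha n.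
  apply/funext => x; apply: eq_from_tnth => i.
  rewrite tnth_mktuple ffunE; case: (tnth (cylinder alpha n x) i) => //.
rewrite XE; apply/eqP; rewrite eq_le shannon_entropy_comp/=; last exact: simple_cylinder.
rewrite -{1}cylE; apply: shannon_entropy_comp; apply: simple_rv_comp.
exact: simple_cylinder.
Qed.

Lemma equilibrium_entropy_gt0 : (0 < entropy nu f)%E.
Proof.
have q0 : 0 < 1 - pmin by rewrite subr_gt0; exact: (pmin_lt1 pmin0 p_ge normalized_weight_sum).
apply: (@lt_le_trans _ _ (- ln (1 - pmin))%:E).
  by rewrite lte_fin oppr_gt0 ln_lt0// q0/= gtrBl.
have lam0 := eigenvalue_pos; have invc : 0 < 1 / c by rewrite divr_gt0.
have hz x : transfer alpha phi h x <= lam * h x by rewrite h_eigen.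
have growth := supersolution_growth c0 lam0 h_bounds hz.
have gr n : iter n (transfer alpha phi) (fun=> 1) (unitI0 R) <= 1 / c * lam ^+ n by exact: growth.
have ub := cylinder_entropy_le g0 phi_holder nu_inv lam0 invc gr.
have cv := cvgn_linear_growth ub cylinder_entropy_ge.
rewrite equilibrium_entropy lee_fin -(cvg_lim _ cv)//; apply: limr_ge; first by apply/cvg_ex; eexists; exact: cv.
near=> n; have n0 : 0 < n%:R :> R by rewrite ltr0n; near: n; exact: nbhs_infty_gt.
by rewrite ler_pdivlMr// mulrC; exact: cell_entropy_ge.
Unshelve. all: by end_near. Qed.

End stationary_entropy.

Theorem equilibrium_state_exists : exists nu : probability T R,
  [/\ invariant_probability alpha nu, exponentially_mixing alpha nu, (0 < entropy nu f)%E &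
      entropy nu f = (ln lam - \int[nu]_x phi x)%:E].
Proof.
have [pmin pmin0 p_ge] := normalized_weight_ge.
have [D D0 p_holder] := normalized_weight_holder.
have p_sum := normalized_weight_sum.
have [nu hnu] := stationary_holder_measure_exists alpha g0 pmin0 D0 p_ge p_sum p_holder.
exists nu; split.
- exact: (stationary_invariant g0 g1 pmin0 p_ge p_sum p_holder hnu).
- exact: (stationary_mixing g0 g1 pmin0 D0 p_ge p_sum p_holder hnu).
- exact: (equilibrium_entropy_gt0 pmin0 p_ge p_holder hnu).
- exact: (equilibrium_entropy pmin0 p_ge p_holder hnu).
Qed.

End equilibrium.

(** * Entropy bounds *)

Section entropy_bounds.
Context {R : realType} (alpha : {posnum R}).
Local Notation T := (unitI R).
Local Notation f := (intermittent_map alpha).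
Local Notation ev := (@unitI_val R).
Local Notation branch := (branch alpha).
Local Notation a := alpha%:num.
Implicit Types (nu : probability T R) (phi : T -> R).
Local Notation mean nu h := (\int[nu]_x h x).

Lemma entropy_ge0 nu : (0 <= entropy nu f)%E.
Proof.
apply: ereal_sup_ge; exists (partition_entropy nu f (fun i : 'I_1 => (fun=> ord0 : 'I_1) @^-1` [set i]))%:E.
  exists 1%N, (fun i : 'I_1 => (fun=> ord0 : 'I_1) @^-1` [set i]); split=> //; split.
  - move=> i; rewrite (_ : _ @^-1` _ = setT)//.
    by apply/seteqP; split=> x //= _; rewrite (ord1 i).
  - by move=> i j _ _ [x [/= <- <-]].
  - by apply/seteqP; split=> // x _; exists ord0.
rewrite lee_fin /partition_entropy (_ : (fun n => _) = fun=> 0).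
  by rewrite (cvg_lim _ (cvg_cst 0)).
apply/funext => n; rewrite refinement_entropyE /shannon_entropy big1 ?oppr0 ?mul0r// => w _.
rewrite (_ : pmf _ _ w = 1) ?ln1 ?mulr0// /pmf (_ : _ @^-1` _ = setT) ?probability_setT//.
by apply/seteqP; split=> x //= _; apply/ffunP => i; rewrite ffunE [RHS]ord1.
Qed.

Section variational.
Variables (g : R) (phi : T -> R) (nu : probability T R).
Hypotheses (g0 : 0 < g) (phi_holder : holder_continuous g phi)
  (nu_inv : invariant_probability alpha nu).

Lemma supersolvable_entropy_le z : supersolvable alpha phi z ->
  (entropy nu f <= (ln z - mean nu phi)%:E)%E.
Proof.
move=> [z0 [h [c [C [c0 hb hz]]]]].
have C0 : 0 < C by have /andP[h1 h2] := hb (unitI0 R); exact: lt_le_trans c0 (le_trans h1 h2).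
have Cc : 0 < C / c by rewrite divr_gt0.
have gr n : iter n (transfer alpha phi) (fun=> 1) (unitI0 R) <= C / c * z ^+ n.
  exact: supersolution_growth.
exact: (entropy_le g0 phi_holder nu_inv z0 Cc gr).
Qed.

Lemma entropy_fin_num_holder : entropy nu f \is a fin_num.
Proof.
have [z hz] := supersolvable_neq0 alpha g0 phi_holder.
by rewrite ge0_fin_numE ?entropy_ge0// (le_lt_trans (supersolvable_entropy_le hz))// ltry.
Qed.

Lemma expR_free_energy_le :
  expR (fine (entropy nu f) + mean nu phi) <= eigenvalue alpha phi.
Proof.
apply: lb_le_inf; first exact: (supersolvable_neq0 alpha g0 phi_holder).
move=> z hz; have [z0 _] := hz; rewrite -ler_ln ?posrE ?expR_gt0// expRK -lerBrDr.
by rewrite -lee_fin fineK ?entropy_fin_num_holder//; exact: supersolvable_entropy_le.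
Qed.

End variational.

Lemma holder_continuous_cst g (k : R) : holder_continuous g (fun _ : T => k).
Proof. by exists 0 => x y; rewrite subrr normr0 mul0r. Qed.

Lemma entropy_fin_num nu : invariant_probability alpha nu -> entropy nu f \is a fin_num.
Proof. exact: (entropy_fin_num_holder ltr01 (holder_continuous_cst 1 0)). Qed.

(** For the zero potential the constant 1 is an eigenfunction with eigenvalue 2. The resulting
    measure serves as nu0 in the definition of K. *)
Lemma maximal_entropy_measure : exists nu,
  invariant_probability alpha nu /\ (0 < entropy nu f)%E.
Proof.
have h1 : ((1 : R) <= (1 : R)) && ((1 : R) <= (1 : R)) by rewrite lexx.
have he (x : T) : transfer alpha (fun=> 0) (fun=> 1) x = 2 * 1.
  by rewrite transferE expR0 !mulr1.
have [nu [inv _ pos _]] := @equilibrium_state_exists _ alpha 1 (fun=> 0) (fun=> 1) 2 1 ltr01 (lexx 1)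
  (holder_continuous_cst 1 0) ltr01 (fun=> h1) (holder_continuous_cst 1 1) he.
by exists nu.
Qed.

Lemma free_energyE g phi nu : 0 < g -> holder_continuous g phi -> invariant_probability alpha nu ->
  free_energy alpha phi nu = (fine (entropy nu f) + mean nu phi)%:E.
Proof.
move=> g0 hphi nu_inv; rewrite EFinD fineK ?entropy_fin_num//.
by rewrite -EFin_mean//; exact: (holder_bounded_measurable g0 hphi).
Qed.

(** A free energy above phi 0 forces e^(phi 0) < lam, so that the eigenfunction exists; the free
    energy of its equilibrium state is ln lam, which bounds all the others. *)
Lemma gibbs_state_of_large_free_energy g phi nu : 0 < g -> g <= 1 -> holder_continuous g phi ->
  invariant_probability alpha nu -> phi (unitI0 R) < fine (entropy nu f) + mean nu phi ->
  exists nu', [/\ gibbs_state alpha phi nu', exponentially_mixing alpha nu' & (0 < entropy nu' f)%E].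
Proof.
move=> g0 g1 hphi nu_inv large.
have lam0 : 0 < eigenvalue alpha phi.
  exact: lt_le_trans (expR_gt0 _) (expR_free_energy_le g0 hphi nu_inv).
have le_lam nu' : invariant_probability alpha nu' ->
    fine (entropy nu' f) + mean nu' phi <= ln (eigenvalue alpha phi).
  move=> inv'; rewrite -ler_expR lnK ?posrE//.
  exact: (expR_free_energy_le g0 hphi inv').
have gap : expR (phi (unitI0 R)) < eigenvalue alpha phi.
  by apply: lt_le_trans (expR_free_energy_le g0 hphi nu_inv); rewrite ltr_expR.
have [h [c [c0 hb hh he]]] := eigenfunction_exists g0 hphi gap.
have [nu' [inv' mix pos ent]] := equilibrium_state_exists g0 g1 hphi c0 hb hh he.
exists nu'; split=> //; split=> //; apply/eqP; rewrite eq_le; apply/andP; split.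
  by apply: ereal_sup_ubound; exists nu'.
apply: ge_ereal_sup => _ [nu'' inv'' <-].
rewrite !(free_energyE g0 hphi)// lee_fin (le_trans (le_lam _ inv''))//.
by rewrite ent /= subrK.
Qed.

(** Subadditivity of the power g: u / x <= (u / x)^g is applied to u = y and u = x - y, and the two
    are added. *)
Lemma powR_dist_le (g : R) (x y : T) : 0 < g -> g <= 1 ->
  `|ev x `^ g - ev y `^ g| <= `|ev x - ev y| `^ g.
Proof.
move=> g0 g1; wlog xy : x y / ev y < ev x.
  move=> H; have [/H|/H h|h] := ltgtP (ev y) (ev x); first by [].
    by rewrite distrC [X in _ <= X `^ _]distrC.
  by rewrite h !subrr normr0 powR_ge0.
have y0 := unitI_ge0 y; have x0 : 0 < ev x := le_lt_trans y0 xy.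
have d0 : 0 <= ev x - ev y by rewrite subr_ge0 ltW.
have mono (u : R) : 0 <= u -> u <= ev x -> u / ev x <= (u / ev x) `^ g.
  move=> u0 ux; have [->|un] := eqVneq u 0; first by rewrite mul0r powR_ge0.
  have up : 0 < u by rewrite lt_neqAle eq_sym un.
  rewrite -[leLHS]powRr1 ?divr_ge0 ?(ltW x0)//; apply: ger_powR => //.
  by rewrite divr_gt0//= ler_pdivrMr// mul1r.
have xg0 : 0 < ev x `^ g by rewrite powR_gt0.
have h1 := mono (ev y) y0 (ltW xy).
have h2 : (ev x - ev y) / ev x <= ((ev x - ev y) / ev x) `^ g by apply: mono => //; rewrite gerBl.
have h3 : 1 <= ((ev x - ev y) / ev x) `^ g + (ev y / ev x) `^ g.
  apply: le_trans (lerD h2 h1); rewrite -mulrDl subrK divff// gt_eqF//.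
rewrite ger0_norm; last first.
  by rewrite subr_ge0; apply: ge0_ler_powR; rewrite ?nnegrE ?(ltW g0) ?(ltW x0)// ltW.
rewrite (ger0_norm d0) lerBlDr.
have pe (u : R) : 0 <= u -> u `^ g = (u / ev x) `^ g * ev x `^ g.
  by move=> u0; rewrite -powRM ?divr_ge0 ?(ltW x0)// divfK// gt_eqF.
rewrite [X in _ <= X + _]pe// [X in _ <= _ + X]pe// -mulrDl.
by rewrite ler_peMl// ltW.
Qed.

(* For t large, h = 1 / (x^alpha + e) satisfies L h <= (1 + e) h for the potential
   - t x^g, uniformly in e: this is the invariant density of order x^-alpha
   of the map near the indifferent fixed point. *)
Lemma indifferent_entropy_le (g : R) : 0 < g -> g <= 1 -> g <= a -> exists2 t, 0 < t &
  forall nu, invariant_probability alpha nu ->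
    fine (entropy nu f) <= t * mean nu (fun x => ev x `^ g).
Proof.
move=> g0 g1 ga; have a0 : 0 < a by [].
set kap := ev (breakpoint alpha); have k0 : 0 < kap := breakpoint_gt0 alpha.
have kg0 : 0 < kap `^ g by rewrite powR_gt0.
have ka0 : 0 < kap `^ a by rewrite powR_gt0.
pose M : R := 2 * 2 `^ a / kap `^ a.
have M0 : 0 < M by rewrite divr_gt0// mulr_gt0// powR_gt0.
(* The summand a offsets (1 + u)^a <= e^(a u) on branch 0, the summand 1 leaves e^(- u) <= 1 - u /
   2, and the last makes the contribution of branch 1 at most (u + e) / 2; here u = y^a for y the
   branch-0 preimage. *)
pose t : R := a + 1 + M / kap `^ g.
have t0 : 0 < t by rewrite addr_gt0 ?addr_gt0 ?divr_gt0.
have ht : expR (- (t * kap `^ g)) * M <= 1.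
  rewrite expRN mulrC ler_pdivrMr ?expR_gt0// mul1r.
  apply: (@le_trans _ _ (1 + t * kap `^ g)); last exact: expR_ge1Dx.
  rewrite /t mulrDl divfK ?gt_eqF//; have := mulr_gt0 a0 kg0; lra.
exists t => // nu nu_inv.
have hom : holder_continuous g (fun x : T => - t * ev x `^ g).
  exists t => x y; rewrite -mulrBr normrM normrN (ger0_norm (ltW t0)).
  by rewrite ler_wpM2l ?(ltW t0)// powR_dist_le.
rewrite -subr_ge0 -oppr_le0 opprB; apply/ler_addgt0Pr => e e0; rewrite add0r.
pose h (x : T) : R := (ev x `^ a + e)^-1.
have hd x : 0 < ev x `^ a + e by rewrite ltr_wpDl ?powR_ge0.
have pow1 x : ev x `^ a <= 1 by rewrite powR_le1 ?(ltW a0)// unitI_ge0 unitI_le1.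
have sup : supersolvable alpha (fun x : T => - t * ev x `^ g) (1 + e).
  split; first by rewrite addr_gt0.
  exists h, (1 + e)^-1, e^-1; split.
  - by rewrite invr_gt0 addr_gt0.
  - move=> x; rewrite /h !lef_pV2 ?posrE ?hd ?addr_gt0//.
    by rewrite lerD2r pow1 lerDr powR_ge0.
  - move=> x; rewrite transferE.
    set y := branch false x; set y1 := branch true x.
    pose u := ev y `^ a.
    have u0 : 0 <= u by rewrite powR_ge0.
    have u1 : u <= 1 by exact: pow1.
    have xE : ev x = ev y * (1 + u) by have := branchP alpha false x; rewrite addr0 => <-.
    have xaE : ev x `^ a = u * (1 + u) `^ a by rewrite xE powRM ?unitI_ge0// addr_ge0.
    have ug : u <= ev y `^ g.
      have [y00|yn] := eqVneq (ev y) 0; first by rewrite /u y00 !powR0 ?gt_eqF.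
      by apply: ger_powR => //; rewrite lt_neqAle eq_sym yn unitI_ge0 unitI_le1.
    have p1 : 1 <= (1 + u) `^ a.
      apply: (@le_trans _ _ ((1 + u) `^ 0)); first by rewrite powRr0.
      by apply: ler_powR; rewrite ?lerDl// ltW.
    have pe : (1 + u) `^ a <= expR (a * u).
      rewrite /powR gt_eqF ?ltr_wpDr// ler_expR ler_wpM2l ?(ltW a0)//.
      by apply: le_ln1Dx; apply: lt_le_trans u0; rewrite ltrN10.
    have p2 : (1 + u) `^ a <= 2 `^ a.
      apply: ge0_ler_powR; rewrite ?nnegrE ?(ltW a0) ?addr_ge0//; lra.
    have eu : expR (- u) <= 1 - u / 2.
      rewrite expRN invf_ple ?posrE ?expR_gt0//; last by lra.
      apply: le_trans (expR_ge1Dx u).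
      rewrite -div1r ler_pdivrMr; last by lra.
      nra.
    have ue0 : 0 < u + e := hd y.
    rewrite /h -/u ler_pdivlMr// mulrDl.
    apply: (@le_trans _ _ ((u + e) / 2 + (1 - u / 2))); last by lra.
    apply: lerD.
      have ky : kap `^ a <= ev y1 `^ a.
        apply: ge0_ler_powR; rewrite ?nnegrE ?(ltW a0) ?(ltW k0) ?unitI_ge0//.
        exact: breakpoint_le_branch1.
      have kgy : kap `^ g <= ev y1 `^ g.
        apply: ge0_ler_powR; rewrite ?nnegrE ?(ltW g0) ?(ltW k0) ?unitI_ge0//.
        exact: breakpoint_le_branch1.
      apply: (@le_trans _ _ (expR (- (t * kap `^ g)) * (kap `^ a)^-1 * (2 `^ a * (u + e)))).
        apply: ler_pM.
        - by rewrite mulr_ge0 ?expR_ge0 ?invr_ge0 ?ltW.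
        - by rewrite ltW.
        - apply: ler_pM; rewrite ?expR_ge0 ?invr_ge0 ?(ltW (hd _))//.
            by rewrite ler_expR mulNr lerN2 ler_wpM2l// ltW.
          by rewrite lef_pV2 ?posrE ?hd//; apply: (le_trans ky); rewrite lerDl (ltW e0).
        - rewrite xaE mulrDr; apply: lerD; first by rewrite mulrC ler_wpM2r.
          by rewrite ler_peMl ?(ltW e0)//; exact: le_trans p1 p2.
      have -> : expR (- (t * kap `^ g)) * (kap `^ a)^-1 * (2 `^ a * (u + e)) =
         expR (- (t * kap `^ g)) * M * ((u + e) / 2) by rewrite /M; field; rewrite gt_eqF.
      by rewrite ler_piMl// divr_ge0// addr_ge0// ltW.
    apply: le_trans eu.
    apply: (@le_trans _ _ (expR (- t * ev y `^ g) * (1 + u) `^ a)).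
      rewrite -mulrA ler_wpM2l ?expR_ge0// mulrC ler_pdivrMr//.
      rewrite xaE mulrDr [(1 + u) `^ a * u]mulrC lerD2l ler_peMl ?(ltW e0)//.
    apply: (@le_trans _ _ (expR (- t * ev y `^ g) * expR (a * u))); first by rewrite ler_wpM2l ?expR_ge0.
    rewrite -expRD ler_expR.
    have tu : t * u <= t * ev y `^ g by rewrite (ler_wpM2l (ltW t0)).
    have Mu : 0 <= M / kap `^ g * u by rewrite mulr_ge0// divr_ge0// ltW.
    have tE : t * u = a * u + u + M / kap `^ g * u by rewrite /t; ring.
    move: tu; rewrite tE mulNr => tu; clear -tu Mu; lra.
have := supersolvable_entropy_le g0 hom nu_inv sup.
rewrite -(fineK (entropy_fin_num nu_inv)) lee_fin meanZ; last first.
  have : holder_continuous g (fun x : T => ev x `^ g).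
    by exists 1 => x y; rewrite mul1r powR_dist_le.
  exact: holder_bounded_measurable.
have : ln (1 + e) <= e by apply: le_ln1Dx; lra.
rewrite mulNr; lra.
Qed.

Lemma dirac0_mean g phi : 0 < g -> holder_continuous g phi ->
  mean (\d_(unitI0 R) : probability T R) phi = phi (unitI0 R).
Proof.
move=> g0 hphi; have [mphi _] := holder_bounded_measurable g0 hphi.
rewrite /Rintegral integral_dirac//; last exact/measurable_EFinP.
by rewrite diracT mul1e.
Qed.

Lemma dirac0_invariant : invariant_probability alpha (\d_(unitI0 R) : probability T R).
Proof.
move=> A mA; rewrite /= !diracE; congr (nat_of_bool _)%:R%:E.
have f0 : f (unitI0 R) = unitI0 R by rewrite -{1}(branch0_0 alpha) branch0K.
by apply/idP/idP; rewrite !inE /= f0.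
Qed.

End entropy_bounds.

(** * Periodic orbits *)

Section periodic_points.
Context {R : realType} (alpha : {posnum R}).
Local Notation T := (unitI R).
Local Notation f := (intermittent_map alpha).
Local Notation ev := (@unitI_val R).
Local Notation branch := (branch alpha).
Local Notation branch0 n := (iter n (branch false)).

Lemma branch0_iter_le n x : ev (branch0 n x) <= ev x.
Proof. by elim: n => //= n IH; exact: le_trans (branch0_le _ _) IH. Qed.

Lemma branch0_iter_neq0 n x : x != unitI0 R -> branch0 n x != unitI0 R.
Proof. by move=> x0; elim: n => //= n; exact: branch_neq0. Qed.

Lemma branch0_iter_dist n x y : `|ev (branch0 n x) - ev (branch0 n y)| <= `|ev x - ev y|.
Proof. by elim: n => //= n IH; exact: le_trans (branch_dist _ _ _ _) IH. Qed.

Lemma clamp_dist s t : `|ev (clamp s) - ev (clamp t)| <= `|s - t : R|.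
Proof.
exact: le_trans (maxr_dist _ _ _) (minr_dist _ _ _).
Qed.

(** The orbit of such a point takes branch 1 once in n + 1 steps, hence spends long times near 0 for
    large n. *)
Lemma periodic_point_exists n : exists x, branch true (branch0 n x) = x.
Proof.
pose G (t : R) := ev (branch true (branch0 n (clamp t))) - t.
have Gd s t : `|G s - G t| <= 2 * `|s - t|.
  have -> : G s - G t = (ev (branch true (branch0 n (clamp s))) - ev (branch true (branch0 n (clamp t)))) - (s - t).
    by rewrite /G; ring.
  rewrite mulrDl mul1r; apply: (le_trans (ler_normB _ _)); rewrite lerD2r.
  apply: (le_trans (branch_dist _ _ _ _)); apply: (le_trans (branch0_iter_dist _ _ _)).
  exact: clamp_dist.
have cG : continuous G.
  move=> s; apply/cvgrPdist_le => e e0; near=> t.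
  apply: (le_trans (Gd s t)); rewrite -ler_pdivlMl//.
  by near: t; apply: cvgr_dist_le; [exact: cvg_id|rewrite mulr_gt0// invr_gt0].
have [c c01 Gc] : exists2 c, c \in `[0, 1]%R & G c = 0.
  apply: IVT => //; first by apply: continuous_subspaceT.
  have G0 : 0 <= G 0 by rewrite /G subr0 unitI_ge0.
  have G1 : G 1 <= 0 by rewrite /G subr_le0 unitI_le1.
  by rewrite ge_min le_max G0 G1 orbT.
exists (clamp c); apply: unitI_val_inj; rewrite [RHS]clamp_id; last by rewrite in_itv in c01.
by apply/eqP; rewrite -subr_eq0; apply/eqP.
Unshelve. all: by end_near. Qed.

Definition periodic_point n : T := sval (cid (periodic_point_exists n)).

Lemma periodic_pointP n : branch true (branch0 n (periodic_point n)) = periodic_point n.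
Proof. by rewrite /periodic_point; case: cid. Qed.

Lemma periodic_point_gt0 n : 0 < ev (periodic_point n).
Proof.
rewrite -periodic_pointP; exact: lt_le_trans (breakpoint_gt0 alpha) (breakpoint_le_branch1 _ _).
Qed.

Lemma periodic_point_neq0 n : periodic_point n != unitI0 R.
Proof. by apply: contraTneq (periodic_point_gt0 n) => ->; rewrite ltxx. Qed.

Lemma iter_branch0_periodic n k : (k <= n)%N ->
  iter k.+1 f (periodic_point n) = branch0 (n - k) (periodic_point n).
Proof.
elim: k => [_|k IH kn].
  rewrite subn0 /= -{1}periodic_pointP branchK//.
  exact: branch0_iter_neq0 (periodic_point_neq0 n).
by rewrite iterS IH 1?ltnW// -[in LHS](@subnSK k n)//= branch0K.
Qed.

Lemma periodic_point_period n : iter n.+1 f (periodic_point n) = periodic_point n.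
Proof. by rewrite iter_branch0_periodic// subnn. Qed.

Lemma periodic_orbit_le n k : (k <= n)%N -> ev (iter k f (periodic_point n)) <= ev (periodic_point n).
Proof.
by case: k => [|k] kn //; rewrite iter_branch0_periodic ?branch0_iter_le// ltnW.
Qed.

(** Otherwise the contraction of branch 1 forces the two points to coincide. Then the image of this
    point is fixed by branch 0, hence by f, and periodicity makes the point itself fixed, with both
    digits. *)
Lemma periodic_point_lt n : ev (periodic_point n.+1) < ev (periodic_point n).
Proof.
set a := periodic_point n; set b := periodic_point n.+1.
rewrite ltNge; apply/negP => ab.
have k1 := breakpoint_lt1 alpha.
have h1 : ev (branch0 n.+1 b) <= ev (branch0 n b) by exact: branch0_le.
have h2 : ev b - ev a <= ev (breakpoint alpha) * (ev b - ev a).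
  rewrite -{1}(periodic_pointP n : _ = a) -{1}(periodic_pointP n.+1 : _ = b) -/a -/b.
  apply: (@le_trans _ _ (ev (branch true (branch0 n b)) - ev (branch true (branch0 n a)))).
    by rewrite lerD2r (branch_contract _ _ h1).1.
  apply: (le_trans (ler_norm _)); apply: (le_trans (branch1_dist _ _ _)).
  rewrite ler_wpM2l ?(ltW (breakpoint_gt0 _))//; apply: (le_trans (branch0_iter_dist _ _ _)).
  by rewrite ger0_norm// subr_ge0.
have eab : b = a.
  apply: unitI_val_inj; apply/eqP; rewrite -subr_eq0 eq_le subr_ge0 ab andbT.
  have d0 : 0 <= ev b - ev a by rewrite subr_ge0.
  rewrite leNgt; apply/negP => dp; move: h2; rewrite leNgt => /negP; apply.
  by rewrite gtr_pMl.
have zz : branch0 n a != unitI0 R.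
  exact: branch0_iter_neq0 (periodic_point_neq0 n).
have fz : branch0 n a = f a by rewrite -[in RHS](periodic_pointP n : _ = a) branchK.
have fz' : branch0 n.+1 b = f b.
  by rewrite -[in RHS](periodic_pointP n.+1 : _ = b) branchK//;
    exact: branch0_iter_neq0 (periodic_point_neq0 n.+1).
rewrite eab in fz'.
have fix_fa : branch false (f a) = f a by rewrite -{1}fz.
have ffa : f (f a) = f a by rewrite -{1}fix_fa branch0K.
have fk k : iter k.+1 f a = f a by elim: k => //= k ->.
have := periodic_point_period n; rewrite -/a fk => fa.
have : digit alpha a = true by rewrite -(periodic_pointP n : _ = a) digit_branch.
by rewrite -fa -fix_fa digit_branch// fa periodic_point_neq0.
Qed.

Lemma periodic_point_le m n : (m <= n)%N -> ev (periodic_point n) <= ev (periodic_point m).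
Proof.
move=> /subnK <-; elim: (n - m)%N => //= k IH; rewrite addSn.
exact: le_trans (ltW (periodic_point_lt _)) IH.
Qed.

Section orbit_measure.
Variable n : nat.
Local Notation x := (periodic_point n).

Definition orbit_measure : set T -> \bar R :=
  mscale (n.+1%:R^-1)%:nng (msum (fun k => \d_(iter k f x)) n.+1).

HB.instance Definition _ := Measure.on orbit_measure.

Let orbit_measure_setT : orbit_measure setT = 1%E.
Proof.
rewrite /orbit_measure /mscale /= /msum /= (eq_bigr (fun=> 1%E)); last by move=> k _; rewrite diracT.
by rewrite sumEFin -EFinM sumr_const card_ord mulVf.
Qed.

HB.instance Definition _ := Measure_isProbability.Build _ _ _ orbit_measure orbit_measure_setT.

Lemma orbit_measure_invariant : invariant_probability alpha orbit_measure.
Proof.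
move=> A mA; rewrite /= /orbit_measure /mscale; congr (_ * _)%E; rewrite /= /msum.
have E k : \d_(iter k f x) (f @^-1` A) = \d_(iter k.+1 f x) A :> \bar R.
  by rewrite /= !diracE; congr (nat_of_bool _)%:R%:E; apply/idP/idP; rewrite !inE.
rewrite (eq_bigr (fun k : 'I_n.+1 => \d_(iter k.+1 f x) A)); last by move=> k _; exact: E.
rewrite big_ord_recr [RHS]big_ord_recl /= -iterS periodic_point_period addeC.
by congr (_ + _)%E; apply: eq_bigr => k _; rewrite /bump leq0n.
Qed.

Lemma integral_orbit_measure (h : T -> R) : bounded_measurable h -> (forall y, 0 <= h y) ->
  \int[orbit_measure]_y h y = n.+1%:R^-1 * \sum_(k < n.+1) h (iter k f x).
Proof.
move=> [mh _] h0; rewrite /Rintegral.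
have mh' : measurable_fun setT (EFin \o h) by exact/measurable_EFinP.
have h0' y : setT y -> (0 <= (EFin \o h) y)%E by rewrite /= lee_fin.
rewrite [X in fine X](_ : _ = (n.+1%:R^-1 * \sum_(k < n.+1) h (iter k f x))%:E)//.
rewrite ge0_integral_mscale// ge0_integral_measure_sum// EFinM -sumEFin; congr (_ * _)%E.
by apply: eq_bigr => k _; rewrite integral_dirac// diracT mul1e.
Qed.

End orbit_measure.

Lemma bump_holder (g c : R) : g <= 1 ->
  holder_continuous g (fun x : T => Num.max 0 (ev x - c)).
Proof.
move=> g1; exists 1 => x y; rewrite mul1r; apply: le_trans (dist_le_holder g1 x y).
by apply: (le_trans (maxr_dist _ _ _)); rewrite opprD addrACA opprK addNr addr0.
Qed.

Variables (gamma : {posnum R}) (gamma1 : gamma%:num <= 1).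

Definition holder_of phi (hphi : holder_continuous gamma%:num phi) : holder gamma :=
  Holder (mem_set hphi : phi \in holder_pred gamma).

Lemma holder_sumE n (c : 'I_n -> R) (v : 'I_n -> holder gamma) x :
  (\sum_(i < n) c i *: v i) x = \sum_(i < n) c i * v i x.
Proof.
elim: n c v => [|n IH] c v; first by rewrite !big_ord0.
rewrite !big_ord_recr /=; rewrite -IH.
by [].
Qed.

(* The function with index i vanishes on the orbit of x_m for m > i and not on
   that of x_i, so that the integration constraints form a triangular system. *)
Lemma constant_integral_infinite_codim :
  infinite_codim (constant_integral_space alpha gamma).
Proof.
move=> n; have g0 : 0 < gamma%:num by [].
pose v (i : 'I_n) := holder_of (bump_holder (ev (periodic_point i.+1)) gamma1).
exists v => c hc.
have bv i : bounded_measurable (v i) by exact: (holder_bounded_measurable g0 (holderP (v i))).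
have v0 i y : 0 <= v i y by rewrite /= le_max lexx.
have vanish (i : 'I_n) m : (i < m)%N -> \int[orbit_measure m]_y v i y = 0.
  move=> im; rewrite integral_orbit_measure// big1 ?mulr0// => k _ /=.
  apply/max_idPl; rewrite subr_le0; apply: (le_trans (periodic_orbit_le _)); first by rewrite -ltnS.
  exact: periodic_point_le.
have pos (i : 'I_n) : 0 < \int[orbit_measure i]_y v i y.
  rewrite integral_orbit_measure// mulr_gt0 ?invr_gt0// big_ord_recl /= ltr_pwDl//.
    by rewrite lt_max subr_gt0 periodic_point_lt orbT.
  by apply: sumr_ge0 => k _; exact: v0.
have eq0 m : \sum_(i < n) c i * \int[orbit_measure m]_y v i y = 0.
  have := hc _ (@orbit_measure_invariant m).
  have bs : bounded_measurable (\sum_(i < n) c i *: v i : holder gamma).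
    exact: (holder_bounded_measurable g0 (holderP _)).
  rewrite EFin_mean// => E; have := EFin_inj E; rewrite holder_sumE.
  rewrite [X in _ = X]big1; last first.
    move=> i _; rewrite /= [X in _ * X](_ : _ = 0) ?mulr0//.
    by apply/max_idPl; rewrite subr_le0 unitI_ge0.
  rewrite (eq_mean _ (holder_sumE c v)) mean_sum.
    by move=> S0; rewrite -[RHS]S0; apply: eq_bigr => i _; rewrite meanZ.
  by move=> i; apply: bounded_measurableM => //; exact: bounded_measurable_cst.
(* Elimination from the largest index downwards: on the orbit of x_i the functions of smaller index
   vanish, and the coefficients of larger index are already 0. *)
suff H k : forall i : 'I_n, (n - i <= k)%N -> c i = 0 by move=> i; apply: (H n); rewrite leq_subr.
elim: k => [i|k IH i ik]; first by rewrite leqn0 subn_eq0 leqNgt ltn_ord.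
have := eq0 i; rewrite (bigD1 i)//= big1 ?addr0.
  by move=> /eqP; rewrite mulf_eq0 (gt_eqF (pos i)) orbF => /eqP.
move=> j ji; have [lt_ji|] := ltnP j i; first by rewrite vanish ?mulr0.
rewrite leq_eqVlt eq_sym => /orP[/eqP/val_inj jE|lt_ij]; first by rewrite jE eqxx in ji.
rewrite IH ?mul0r//; rewrite -ltnS; apply: leq_trans ik.
by rewrite ltn_sub2l// ltn_ord.
Qed.

End periodic_points.

(** * Phase transition locus *)

Section phase_transition.
Context {R : realType} (alpha gamma : {posnum R}).
Hypothesis hgamma : gamma%:num <= Num.min alpha%:num 1.
Local Notation T := (unitI R).
Local Notation f := (intermittent_map alpha).
Local Notation ev := (@unitI_val R).
Local Notation H := (holder gamma).
Local Notation inv := (invariant_probability alpha).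
Local Notation mean nu h := (\int[nu]_x h x).
Local Notation ent nu := (fine (entropy nu f)).
Implicit Types (phi psi : H) (nu : probability T R) (s : R).

Let g0 : 0 < gamma%:num. Proof. by []. Qed.
Let g1 : gamma%:num <= 1.
Proof. by move: hgamma; rewrite le_min => /andP[]. Qed.
Let ga : gamma%:num <= alpha%:num.
Proof. by move: hgamma; rewrite le_min => /andP[]. Qed.

(** Normalized to vanish for the Dirac mass at 0, which moves the threshold phi 0 to 0. *)
Definition drift phi nu : R := mean nu phi - phi (unitI0 R).

Lemma holder_mean phi : bounded_measurable phi.
Proof. exact: (holder_bounded_measurable g0 (holderP phi)). Qed.

Lemma driftD phi psi nu : drift (phi + psi) nu = drift phi nu + drift psi nu.
Proof.
rewrite /drift (_ : mean nu _ = mean nu (fun x => phi x + psi x))//.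
rewrite meanD; [|exact: holder_mean|exact: holder_mean].
by rewrite [(phi + psi) _](_ : _ = phi (unitI0 R) + psi (unitI0 R))//; ring.
Qed.

Lemma driftZ s phi nu : drift (s *: phi) nu = s * drift phi nu.
Proof.
rewrite /drift (_ : mean nu _ = mean nu (fun x => s * phi x))//.
by rewrite meanZ ?mulrBr//; exact: holder_mean.
Qed.

Lemma driftB phi psi nu : drift (phi - psi) nu = drift phi nu - drift psi nu.
Proof. by rewrite -scaleN1r driftD driftZ mulN1r. Qed.

Lemma omega_subproof : holder_continuous gamma%:num (fun x : T => ev x `^ gamma%:num).
Proof. by exists 1 => x y; rewrite mul1r; exact: powR_dist_le. Qed.

Definition omega : H := holder_of omega_subproof.

Lemma omega0 : omega (unitI0 R) = 0.
Proof. by rewrite /= powR0// gt_eqF. Qed.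

Lemma drift_omega nu : drift omega nu = mean nu omega.
Proof. by rewrite /drift omega0 subr0. Qed.

Lemma mean_omega_ge0 nu : 0 <= mean nu omega.
Proof.
rewrite -(mean_cst nu 0); apply: mean_le; [exact: bounded_measurable_cst|exact: holder_mean|].
by move=> x; rewrite powR_ge0.
Qed.

(** The Hoelder condition between x and 0, integrated. This inequality singles out omega among all
    directions. *)
Lemma drift_norm_le phi nu : `|drift phi nu| <= `|phi| * mean nu omega.
Proof.
have phi_dist x : `|phi x - phi (unitI0 R)| <= `|phi| * omega x.
  apply: (le_trans (le_holder_seminorm x (unitI0 R) (holderP phi))).
  rewrite /= subr0 (ger0_norm (unitI_ge0 x)) ler_wpM2r ?powR_ge0//.
  have -> : `|phi| = holder_norm phi by [].
  by rewrite /holder_norm lerDr (le_trans _ (holder_le_sup_norm phi (unitI0 R))).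
have -> : drift phi nu = mean nu (fun x => phi x - phi (unitI0 R)).
  by rewrite meanB ?mean_cst//; [exact: holder_mean|exact: bounded_measurable_cst].
have bB : bounded_measurable (fun x => phi x - phi (unitI0 R)).
  by apply: bounded_measurableB; [exact: holder_mean|exact: bounded_measurable_cst].
have bo c : bounded_measurable (fun x => c * omega x).
  by apply: bounded_measurableM; [exact: bounded_measurable_cst|exact: holder_mean].
rewrite ler_norml -mulNr -!meanZ; do ?exact: holder_mean.
by apply/andP; split; apply: mean_le => // x; have := phi_dist x; rewrite ler_norml -mulNr => /andP[].
Qed.

Lemma mean_omega_le1 nu : mean nu omega <= 1.
Proof.
rewrite -(mean_cst nu 1); apply: mean_le; [exact: holder_mean|exact: bounded_measurable_cst|].
by move=> x; apply: powR_le1; rewrite ?unitI_ge0 ?unitI_le1.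
Qed.

Lemma mean_omega_gt0 nu : inv nu -> 0 < ent nu -> 0 < mean nu omega.
Proof.
have [t t0 ht] := indifferent_entropy_le g0 g1 ga.
move=> /ht h1 h2; have := lt_le_trans h2 h1; rewrite pmulr_rgt0//.
Qed.

(* The potentials whose pressure is [phi 0]; the pressure is at least that
   value because the entropy of the Dirac mass at [0] vanishes. *)
Definition flat : set H := [set phi | forall nu, inv nu -> ent nu + drift phi nu <= 0].

Lemma flat_subP phi s : flat (phi - s *: omega) <->
  forall nu, inv nu -> ent nu + drift phi nu <= s * mean nu omega.
Proof.
have E nu : ent nu + drift (phi - s *: omega) nu = ent nu + drift phi nu - s * mean nu omega.
  by rewrite driftB driftZ drift_omega addrA.
by split=> h nu inv_nu; have := h nu inv_nu; rewrite E subr_le0.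
Qed.

Definition freezing_time phi : R := inf [set s | flat (phi - s *: omega)].

Lemma flat_nonempty phi : exists s, flat (phi - s *: omega).
Proof.
have [t t0 ht] := indifferent_entropy_le g0 g1 ga.
exists (t + `|phi|); apply/flat_subP => nu inv_nu.
rewrite mulrDl; apply: lerD; first exact: ht.
by apply: le_trans (drift_norm_le phi nu); exact: ler_norm.
Qed.

Lemma flat_lbound phi nu : inv nu -> 0 < ent nu ->
  lbound [set s | flat (phi - s *: omega)] ((ent nu + drift phi nu) / mean nu omega).
Proof.
move=> inv_nu hnu s /flat_subP /(_ _ inv_nu) h.
by rewrite ler_pdivrMr//; exact: mean_omega_gt0.
Qed.

Lemma ent_gt0 nu : inv nu -> (0 < entropy nu f)%E -> 0 < ent nu.
Proof. by move=> inv_nu h; rewrite -lte_fin fineK// (entropy_fin_num inv_nu). Qed.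

(** Every nu imposes a closed lower bound on s if its mean of omega is positive; if that mean is 0,
    the constraint does not involve s and holds because some s satisfies it. So the infimum is
    attained. *)
Lemma flat_freezing_time phi s : flat (phi - s *: omega) <-> freezing_time phi <= s.
Proof.
have [nu0 [inv0 /(ent_gt0 inv0) h0]] := maximal_entropy_measure alpha.
split=> [hs|hs].
  by apply: ge_inf => //; eexists; exact: (flat_lbound inv0 h0).
apply/flat_subP => nu inv_nu; apply: (@le_trans _ _ (freezing_time phi * mean nu omega)); last first.
  by rewrite ler_wpM2r// mean_omega_ge0.
have [s0 hs0] := flat_nonempty phi; have := mean_omega_ge0 nu.
rewrite le_eqVlt => /orP[/eqP w0|w0].
  by have := (flat_subP _ _).1 hs0 nu inv_nu; rewrite -w0 !mulr0.
rewrite -ler_pdivrMr//; apply: lb_le_inf; first by exists s0.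
by move=> s' /flat_subP /(_ _ inv_nu); rewrite ler_pdivrMr.
Qed.

Lemma not_flat_intermittent phi nu : inv nu -> 0 < ent nu + drift phi nu ->
  intermittent_phase alpha gamma phi.
Proof.
move=> inv_nu h.
have [|nu' [h1 h2 h3]] := gibbs_state_of_large_free_energy g0 g1 (holderP phi) inv_nu.
  by rewrite -subr_gt0 -addrA.
by exists nu'.
Qed.

(* A Gibbs state of [phi] with positive entropy gives a positive mean to [omega],
   hence violates the inequalities that hold on the ray beyond the freezing time. *)
Lemma intermittent_far phi psi s : intermittent_phase alpha gamma phi ->
  freezing_time psi < s -> `|phi - (psi - s *: omega)| < s - freezing_time psi -> False.
Proof.
move=> [nu [[inv_nu gibbs] _ /(ent_gt0 inv_nu) hnu]] ts d.
have w0 := mean_omega_gt0 inv_nu hnu.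
have h0 : 0 <= ent nu + drift phi nu.
  have : (free_energy alpha phi \d_(unitI0 R) <= free_energy alpha phi nu)%E.
    by rewrite gibbs; apply: ereal_sup_ubound; exists \d_(unitI0 R) => //; exact: dirac0_invariant.
  rewrite !(free_energyE g0 (holderP phi))//; last exact: dirac0_invariant.
  rewrite lee_fin (dirac0_mean g0 (holderP phi)) => h.
  rewrite /drift addrA subr_ge0; apply: le_trans h.
  by rewrite lerDr fine_ge0// entropy_ge0.
have := (flat_freezing_time psi (freezing_time psi)).2 (lexx _).
move=> /flat_subP /(_ nu inv_nu) h1.
have h2 := drift_norm_le (phi - (psi - s *: omega)) nu.
have := le_trans (ler_norm _) h2; rewrite !driftB driftZ drift_omega => h3.
have : `|phi - (psi - s *: omega)| * mean nu omega < (s - freezing_time psi) * mean nu omega.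
  by rewrite ltr_pM2r.
rewrite mulrBl; lra.
Qed.

(** A measure that violates flatness for phi still does so nearby, since its drift is 1-Lipschitz in
    the potential. *)
Lemma not_flat_interior phi : ~ flat phi -> (intermittent_phase alpha gamma)° phi.
Proof.
move=> /existsNP[nu] /not_implyP[inv_nu /negP]; rewrite -ltNge => e0.
apply/nbhs_ballP; exists (ent nu + drift phi nu) => // phi'.
rewrite -ball_normE /= => d; apply: (not_flat_intermittent inv_nu).
have := drift_norm_le (phi - phi') nu => h; have := le_trans (ler_norm _) h; rewrite driftB.
have : `|phi - phi'| * mean nu omega <= `|phi - phi'|.
  by rewrite ler_piMr ?mean_omega_le1.
lra.
Qed.

(** Beyond the freezing time a whole ball avoids the intermittent phase, by [intermittent_far];
    before it the point is interior. At the freezing time both kinds of points are arbitrarily close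
    on the same line. *)
Lemma phase_transition_locusP phi s :
  phase_transition_locus alpha gamma (phi - s *: omega) <-> s = freezing_time phi.
Proof.
have small r : 0 < r -> exists2 d, 0 < d & `|d *: omega| < r.
  move=> r0; have o0 : 0 < `|omega| + 1 by rewrite ltr_wpDl.
  have d0 : 0 < r / (`|omega| + 1) by rewrite divr_gt0.
  exists (r / (`|omega| + 1)) => //; rewrite normrZ (ger0_norm (ltW d0)) mulrAC ltr_pdivrMr//.
  by rewrite ltr_pM2l// ltrDl.
split=> [[cl ni]|->].
  apply/eqP; rewrite eq_le; apply/andP; split; rewrite leNgt; apply/negP => hs.
    have r0 : 0 < s - freezing_time phi by rewrite subr_gt0.
    have [phi' [I B]] := cl _ (nbhsx_ballx (phi - s *: omega) _ r0).
    by apply: (intermittent_far I hs); move: B; rewrite -ball_normE /= distrC.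
  by apply: ni; apply: not_flat_interior => /flat_freezing_time; rewrite leNgt hs.
split.
  move=> B /nbhs_ballP[r /= r0 rB]; have [d d0 hd] := small r r0.
  exists (phi - (freezing_time phi - d) *: omega); split.
    apply: nbhs_singleton; apply: not_flat_interior => /flat_freezing_time.
    by rewrite leNgt gtrBl d0.
  apply: rB; rewrite -ball_normE /=.
  by rewrite opprB addrC addrA subrK -scalerBl addrAC subrr sub0r scaleNr normrN.
move=> /nbhs_ballP[r /= r0 rI]; have [d d0 hd] := small r r0.
have ts : freezing_time phi < freezing_time phi + d by rewrite ltrDl.
apply: (@intermittent_far (phi - (freezing_time phi + d) *: omega) phi (freezing_time phi + d)) => //.
  apply: rI; rewrite -ball_normE /= opprB addrC addrA subrK -scalerBl addrAC subrr add0r.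
  exact: hd.
by rewrite subrr normr0 subr_gt0.
Qed.

(** The entropy is at most t int omega, which vanishes for this measure. *)
Lemma dirac0_entropy : ent (\d_(unitI0 R) : probability T R) = 0.
Proof.
apply/eqP; rewrite eq_le fine_ge0 ?entropy_ge0// andbT.
have [t t0 ht] := indifferent_entropy_le g0 g1 ga.
apply: (le_trans (ht _ (dirac0_invariant alpha))).
by rewrite (dirac0_mean g0 omega_subproof) -/(omega (unitI0 R)) powR0 ?mulr0// gt_eqF.
Qed.

Lemma phase_flat phi :
  (phase_transition_locus alpha gamma `|` stationary_phase alpha gamma) phi -> flat phi.
Proof.
move=> [|/interior_subset[[_ gibbs] _] nu inv_nu].
  rewrite -{1}(subr0 phi) -(scale0r omega) => /phase_transition_locusP h.
  by rewrite -(subr0 phi) -(scale0r omega); apply/flat_freezing_time; rewrite -h.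
have : (free_energy alpha phi nu <= free_energy alpha phi \d_(unitI0 R))%E.
  by rewrite gibbs; apply: ereal_sup_ubound; exists nu.
rewrite !(free_energyE g0 (holderP phi))//; last exact: dirac0_invariant.
by rewrite lee_fin (dirac0_mean g0 (holderP phi)) dirac0_entropy add0r /drift addrA subr_le0.
Qed.


Lemma flat_affine_direction (v w : H) : (forall a, flat (v + a *: w)) ->
  constant_integral_space alpha gamma w.
Proof.
move=> vw nu inv_nu; rewrite EFin_mean; last exact: holder_mean.
congr EFin; apply/eqP; rewrite -subr_eq0 -/(drift w nu); apply/eqP.
set b := ent nu + drift v nu; have h a : b + a * drift w nu <= 0.
  by have := vw a nu inv_nu; rewrite driftD driftZ addrA.
(* An affine function of a bounded above on the whole line has slope 0: otherwise this a would give
   it the value 1. *)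
apply/eqP; apply: contraT => d0; have := h ((1 - b) / drift w nu).
by rewrite divfK// addrCA subrr addr0 ler10.
Qed.

Lemma affine_space_in_phases (A : set H) : affine_space A ->
  A `<=` phase_transition_locus alpha gamma `|` stationary_phase alpha gamma ->
  exists (phi : H) (W : set H),
    [/\ submod_closed (mem W), W `<=` constant_integral_space alpha gamma,
        A = translate phi W & infinite_codim W].
Proof.
move=> [v [W [sW AE]]] Aphase; exists v, W.
have WZ a w : W w -> W (a *: w).
  move=> Ww; have [W0 /(_ a w 0)] := sW; rewrite addr0 => h.
  by apply: set_mem; apply: h; [exact: mem_set|].
have Wc : W `<=` constant_integral_space alpha gamma.
  move=> w Ww; apply: (@flat_affine_direction v) => a; apply: phase_flat.
  by apply: Aphase; rewrite AE; exists (a *: w) => //; exact: WZ.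
split=> // n; have [u hu] := constant_integral_infinite_codim alpha g1 n.
by exists u => c /Wc; exact: hu.
Qed.

Section coordinates.
Variable nu0 : probability T R.
Hypotheses (inv0 : inv nu0) (ent0 : 0 < ent nu0).

Let w0 : 0 < mean nu0 omega. Proof. exact: mean_omega_gt0. Qed.

Definition slope phi : R := drift phi nu0 / mean nu0 omega.

Lemma slopeD phi psi : slope (phi + psi) = slope phi + slope psi.
Proof. by rewrite /slope driftD mulrDl. Qed.

Lemma slopeZ s phi : slope (s *: phi) = s * slope phi.
Proof. by rewrite /slope driftZ mulrA. Qed.

Lemma slopeB phi psi : slope (phi - psi) = slope phi - slope psi.
Proof. by rewrite -scaleN1r slopeD slopeZ mulN1r. Qed.

Lemma slope_omega : slope omega = 1.
Proof. by rewrite /slope drift_omega divff// gt_eqF. Qed.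

Definition slope_kernel : set H := [set phi | slope phi = 0].

(** The sign makes the second coordinate the time s on the line {psi - s omega}. *)
Definition coordinates phi : (H * R^o)%type := (phi - slope phi *: omega, - slope phi).

Definition potential_of (p : (H * R^o)%type) : H := p.1 - (p.2 : R) *: omega.

Lemma coordinates_linear : linear coordinates.
Proof.
move=> a phi psi; rewrite /coordinates slopeD slopeZ; congr (_, _).
  by rewrite /= scalerBr scalerDl scalerA opprD addrACA.
change (- (a * slope phi + slope psi) = a * - slope phi + - slope psi); ring.
Qed.

Lemma coordinatesK : cancel coordinates potential_of.
Proof. by move=> phi; rewrite /potential_of /= scaleNr opprK subrK. Qed.

Lemma coordinates_kernel phi : slope_kernel (coordinates phi).1.
Proof. by rewrite /slope_kernel /= slopeB slopeZ slope_omega mulr1 subrr. Qed.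

Lemma potential_ofK p : slope_kernel p.1 -> coordinates (potential_of p) = p.
Proof.
case: p => psi s; rewrite /slope_kernel /potential_of /coordinates /= slopeB slopeZ slope_omega => ->.
by rewrite mulr1 sub0r scaleNr !opprK subrK.
Qed.

Lemma slope_continuous : continuous slope.
Proof.
move=> phi; have FF : Filter (nbhs phi) := nbhs_filter phi.
apply/(@cvgrPdist_le _ _ _ _ FF) => e e0; apply/nbhs_ballP; exists e => // psi.
rewrite -ball_normE /= => /ltW d; rewrite -slopeB /slope normrM.
rewrite (ger0_norm (_ : 0 <= (mean nu0 omega)^-1)) ?invr_ge0 ?(ltW w0)// ler_pdivrMr//.
by apply: (le_trans (drift_norm_le _ _)); rewrite ler_wpM2r ?(ltW w0).
Qed.

Lemma coordinates_continuous : continuous coordinates.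
Proof.
move=> phi; have FF : Filter (nbhs phi) := nbhs_filter phi.
have c1 : (fun psi => psi - slope psi *: omega) @ nbhs phi --> phi - slope phi *: omega.
  apply: cvgB; first exact: cvg_id.
  by apply: cvgZr_tmp; exact: slope_continuous.
have c2 : (fun psi => - slope psi : R^o) @ nbhs phi --> (- slope phi : R^o).
  by apply: cvgN; exact: slope_continuous.
by move=> A hA; exact: (cvg_pair c1 c2 hA).
Qed.

Lemma potential_of_continuous : continuous potential_of.
Proof.
move=> p; apply: cvgB; first exact: cvg_fst.
by apply: cvgZr_tmp; exact: cvg_snd.
Qed.

Lemma slope_kernel_submod : submod_closed (mem slope_kernel).
Proof.
split=> [|a phi psi]; rewrite !inE /slope_kernel /=.
  by rewrite -(scale0r omega) slopeZ mul0r.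
by move=> p1 p2; rewrite slopeD slopeZ p1 p2 mulr0 addr0.
Qed.

Lemma slope_kernel_codim : has_codim slope_kernel 1.
Proof.
split.
  exists (fun=> omega) => c; rewrite /slope_kernel /= big_ord1 slopeZ slope_omega mulr1.
  by move=> c0 i; rewrite ord1.
move=> [v hv].
(* The combination that cancels the slopes of both vectors. Freeness makes the slope of the first
   one 0, so that this vector already lies in the kernel. *)
pose c (i : 'I_2) : R := if i == ord0 then slope (v ord_max) else - slope (v ord0).
have sum2 (F : 'I_2 -> H) : \sum_(i < 2) F i = F ord0 + F ord_max.
  by rewrite big_ord_recl big_ord1; congr (_ + F _); exact: val_inj.
have hc : slope_kernel (\sum_(i < 2) c i *: v i).
  by rewrite /slope_kernel /= sum2 slopeD !slopeZ /c /=; ring.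
have c0 := hv c hc.
have s0 : slope (v ord0) = 0 by have := c0 ord_max; rewrite /c /= => /eqP; rewrite oppr_eq0 => /eqP.
have hd : slope_kernel (\sum_(i < 2) (i == ord0)%:R *: v i).
  by rewrite /slope_kernel /= sum2 slopeD !slopeZ /= s0; ring.
by have /eqP := hv (fun i => (i == ord0)%:R) hd ord0; rewrite eqxx oner_eq0.
Qed.

(** On the kernel nu0 has drift 0, and its constraint alone forces s to be at least its entropy
    divided by its mean of omega. *)
Lemma freezing_time_gt0 psi : slope_kernel psi -> 0 < freezing_time psi.
Proof.
move=> K; have d0 : drift psi nu0 = 0.
  by move: K => /eqP; rewrite /slope mulf_eq0 invr_eq0 (gt_eqF w0) orbF => /eqP.
apply: (@lt_le_trans _ _ (ent nu0 / mean nu0 omega)); first by rewrite divr_gt0.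
have := (flat_freezing_time psi (freezing_time psi)).2 (lexx _).
by move=> h; have := flat_lbound inv0 ent0 h; rewrite d0 addr0.
Qed.

(** For each nu, average the two constraints at the freezing times, with the entropy split in the
    proportions t and 1 - t. *)
Lemma freezing_time_convex : convex_function slope_kernel freezing_time.
Proof.
move=> t phi psi _ _.
rewrite [leLHS](_ : _ = freezing_time (t%:num *: phi + (1 - t%:num) *: psi))//.
rewrite convRE; apply/flat_freezing_time/flat_subP => nu inv_nu.
have h phi' := (flat_subP phi' _).1 ((flat_freezing_time phi' _).2 (lexx _)) nu inv_nu.
have t0 : 0 <= t%:num :> R by [].
have t1 : 0 <= 1 - t%:num :> R by rewrite subr_ge0.
have := lerD (ler_wpM2l t0 (h phi)) (ler_wpM2l t1 (h psi)).
rewrite driftD !driftZ /unstable.onem; set u := t%:num : R => k; clearbody u.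
have -> : ent nu + (u * drift phi nu + (1 - u) * drift psi nu) =
  u * (ent nu + drift phi nu) + (1 - u) * (ent nu + drift psi nu) by ring.
by apply: (le_trans k); rewrite [X in _ <= X]mulrDl -!mulrA.
Qed.

Lemma phase_transition_graph : coordinates @` phase_transition_locus alpha gamma =
  [set p | slope_kernel p.1 /\ p.2 = freezing_time p.1].
Proof.
apply/seteqP; split=> [_ [phi phiPT <-]|p [Kp pE]].
  split; first exact: coordinates_kernel.
  apply/phase_transition_locusP; rewrite -[X in phase_transition_locus _ _ X](_ : phi = _)//.
  by rewrite -[LHS]coordinatesK.
exists (potential_of p); last exact: potential_ofK.
exact/phase_transition_locusP.
Qed.

End coordinates.

End phase_transition.

Theorem proposition3p8 (R : realType) (alpha gamma : {posnum R})
    (hgamma : gamma%:num <= Num.min alpha%:num 1) :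
  (exists (K : set (holder gamma)) (tau : holder gamma -> R)
      (L : {linear holder gamma -> (holder gamma * R^o)%type})
      (L' : holder gamma * R^o -> holder gamma),
    [/\ submod_closed (mem K) /\ has_codim K 1,
        (forall psi, K psi -> 0 < tau psi) /\ convex_function K tau,
        [/\ set_bij setT (K `*` setT) L, cancel L L',
            continuous L & {within K `*` setT, continuous L'}],
        forall psi, K psi -> L psi = (psi, 0) &
        L @` phase_transition_locus alpha gamma =
          [set p | K p.1 /\ p.2 = tau p.1]])
  /\
  (forall A : set (holder gamma), affine_space A ->
    A `<=` phase_transition_locus alpha gamma
             `|` stationary_phase alpha gamma ->
    exists (phi : holder gamma) (W : set (holder gamma)),
      [/\ submod_closed (mem W), W `<=` constant_integral_space alpha gamma,
          A = translate phi W & infinite_codim W]).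
Proof.
split; last exact: affine_space_in_phases.
have [nu0 [inv0 /(ent_gt0 inv0) ent0]] := maximal_entropy_measure alpha.
pose L : {linear holder gamma -> (holder gamma * R^o)%type} :=
  HB.pack (coordinates hgamma nu0)
    (GRing.isLinear.Build _ _ _ _ _ (@coordinates_linear _ _ _ hgamma nu0)).
exists (slope_kernel hgamma nu0), (freezing_time hgamma), L, (potential_of hgamma).
split.
- by split; [exact: slope_kernel_submod|exact: slope_kernel_codim].
- by split; [exact: freezing_time_gt0|exact: freezing_time_convex].
- split; [|exact: coordinatesK|exact: coordinates_continuous|].
    split=> [phi _|phi psi _ _|p [Kp _]].
    + by split=> //; exact: coordinates_kernel.
    + exact: (can_inj (coordinatesK hgamma nu0)).
    + by exists (potential_of hgamma p) => //; exact: potential_ofK.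
  by apply: continuous_subspaceT; exact: potential_of_continuous.
- by move=> psi Kpsi; rewrite /= /coordinates Kpsi scale0r subr0 oppr0.
- exact: phase_transition_graph.
Qed.
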